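(* Let $a>0$, let $\mathcal L_a$, $(P_t)_{t\ge 0}$ and $\mu$ be the generator, semigroup and invariant measure of the process with parameter $a$ described in the context, and let $\lambda=\inf\{-\mathrm{Re}(\theta):\ \theta \text{ eigenvalue of } \mathcal L_a \text{ restricted to } \mathbf 1^\perp\}$. Then $\lambda=a-\sqrt{a^2-1}$ if $a\ge 1$, and $\lambda=a$ if $a\le 1$. More precisely, for the operator norm on $L^2(\mu)$ and for all $t>0$: (i) If $a>1$, then with $\omega=\sqrt{a^2-1}$ and $\gamma=e^{-2\omega t}$, $$\|P_t-\mu\| = e^{(-a+\sqrt{a^2-1})t}\sqrt{1+\frac{2}{\omega^2\left(\frac{1+\gamma}{1-\gamma}\right)+a\sqrt{1+\omega^2\left(\frac{1+\gamma}{1-\gamma}\right)^2}-1}};$$ moreover $\|P_t-\mu\|=1-\frac{t^3}{3}+o(t^3)$ as $t\to 0$, and $\|P_t-\mu\|\sim \frac{a^2}{a^2-1}\,e^{-\lambda t}$ as $t\to+\infty$. (ii) If $a=1$, then $$\|P_t-\mu\| = e^{-t}\sqrt{1+\frac{2}{\sqrt{1+\frac1{t^2}}-1}};$$ moreover $\|P_t-\mu\|=1-\frac{t^3}{3}+o(t^3)$ as $t\to0$, and $\|P_t-\mu\|\sim 2te^{-t}$ as $t\to+\infty$. (iii) If $a<1$, then $\|P_t-\mu\|=e^{-at}\sqrt{g(t)}$, and $\|P_t-\mu\|=1-\frac{at^3}{3}+o(t^3)$ as $t\to 0$, where the function $g$ satisfies $$\limsup_{t\to+\infty} g(t)=\frac{1+a}{1-a},\qquad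 \liminf_{t\to+\infty} g(t)=1,$$ and, with $\nu=2\sqrt{1-a^2}$, if $t\in\left[0,\frac{\pi}{\nu}\right]$ then $$g(t)=1+\frac{2}{\sqrt{\frac{\nu^2}{a^2}\,\frac{1}{2(1-\cos(\nu t))}+1}-1}.$$
   Context: Let $\mathbb T=\mathbb R/2\pi\mathbb Z$ and $a>0$. Let $(Y_t)_{t\ge0}$ be the continuous-time Markov chain on $\{-1,1\}$ that changes sign at constant rate $a$, and let $X_t=X_0+\int_0^t Y_s\,ds\in\mathbb T$. The pair $(X_t,Y_t)$ is a Markov process with generator $$\mathcal L_a f(x,y)=y\,\partial_x f(x,y)+a\big(f(x,-y)-f(x,y)\big),\qquad (x,y)\in\mathbb T\times\{-1,1\}.$$ Let $\mu$ be the uniform probability on $\mathbb T\times\{-1,1\}$ (the invariant measure). The semigroup on the complex Hilbert space $L^2(\mu)$ is $P_tf(x,y)=\mathbb E\big(f(X_t,Y_t)\mid X_0=x,Y_0=y\big)$. The symbol $\mu$ also denotes the operator $f\mapsto\left(\int f\,d\mu\right)\mathbf 1$ on $L^2(\mu)$, where $\mathbf 1$ is the constant function equal to 1; $\mathbf 1^\perp$ is its orthogonal complement in $L^2(\mu)$, and $\|\cdot\|$ is the operator norm on $L^2(\mu)$.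
   Formalization: The printed asymptotics contradict the closed formulas and are corrected: as t→0 the expansion is 1-at^3/6 in (i) and (iii) and 1-t^3/6 in (ii) (not 1-t^3/3, 1-at^3/3); in (i) as t→+∞ the constant is a/sqrt(a^2-1), not a^2/(a^2-1). *)

(* Defs.v *)
From HB Require Import structures.
From mathcomp Require Import all_boot all_order all_algebra.
From mathcomp Require Import all_classical all_reals all_analysis.
From mathcomp Require Import complex.

Set Implicit Arguments.
Unset Strict Implicit.
Unset Printing Implicit Defensive.

Import Order.TTheory GRing.Theory Num.Theory.
Import numFieldNormedType.Exports.

Local Open Scope classical_set_scope.
Local Open Scope ring_scope.

(* The state space {-1, 1} is encoded by [bool], with false for 1 and true for
   -1; the sign change is [negb].
   Functions on T * {-1, 1}, where T = R / 2 pi Z, are encoded as functions on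
   [R * bool] that are 2 pi-periodic in the first variable (the periodicity is
   part of [inL2]). Elements of L^2 are functions, not classes: all the notions
   below are invariant under equality almost everywhere, except that membership
   in the domain of the generator is stated for the absolutely continuous
   representative. *)
Notation phase R := (measurableTypeR R * bool)%type.

Section Space.
Context {R : realType}.

Definition sgn (y : bool) : R := (-1) ^+ y.

Lemma two_pi_gt0 : (0 : R) < 2 * pi.
Proof. by rewrite mulr_gt0// pi_gt0. Qed.

(* The uniform probability on T * {-1, 1}, carried by [0, 2 pi] * bool. *)
Definition mu : {measure set (phase R) -> \bar R} :=
  (uniform_prob two_pi_gt0 \x bernoulli_prob (2^-1 : R))%E.

Definition Cintegral d (T : measurableType d) (m : {measure set T -> \bar R})
    (D : set T) (f : T -> R[i]) : R[i] :=
  Complex (Rintegral m D (fun x => complex.Re (f x)))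
          (Rintegral m D (fun x => complex.Im (f x))).

Definition L2norm (f : phase R -> R[i]) : \bar R :=
  Lnorm mu 2%:E (fun z => (ComplexField.Normc.normc (f z))%:E).

Definition inL2 (f : phase R -> R[i]) : Prop :=
  [/\ forall x y, f (x + 2 * pi, y) = f (x, y),
      measurable_fun setT (fun z => complex.Re (f z)),
      measurable_fun setT (fun z => complex.Im (f z)) &
      (L2norm f < +oo)%E].

Definition L2inner (f g : phase R -> R[i]) : R[i] :=
  Cintegral mu setT (fun z => f z * conjc (g z)).

Definition one_fun : phase R -> R[i] := fun=> 1.

(* The operator norm on L^2(mu), as an extended real number. *)
Definition opnorm (A : (phase R -> R[i]) -> (phase R -> R[i])) : \bar R :=
  ereal_sup [set L2norm (A f) | f in [set f | inL2 f /\ (L2norm f <= 1)%E]].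

Definition mu_op (f : phase R -> R[i]) : phase R -> R[i] :=
  fun=> Cintegral mu setT f.

End Space.

Section Process.
Context {R : realType} d (Omega : measurableType d).
Variables (Pr : bool -> probability Omega R) (Y : R -> Omega -> bool).

(* [Y] (at nonnegative times) is under each [Pr y] a continuous-time Markov
   chain started at [y], with right-continuous paths and a time-homogeneous
   transition function [p] whose jump rate from each state to the opposite one
   is [a]. The finite-dimensional laws are those of a Markov chain with
   transition function [p]; since t 0 = 0 and the law is [Pr (s 0)], the case
   n = 0 says that Y 0 = s 0 almost surely. *)
Record flip_chain (a : R) : Prop := FlipChain {
  flip_measurable : forall t, 0 <= t -> measurable_fun setT (Y t);
  flip_right_continuous : forall w t, 0 <= t ->
    \forall s \near t^'+, Y s w = Y t w;
  flip_transition : exists p : R -> bool -> bool -> R,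
    (forall (n : nat) (t : nat -> R) (s : nat -> bool),
       t 0%N = 0 -> (forall i, (i < n)%N -> t i <= t i.+1) ->
       Pr (s 0%N) [set w | forall i, (i <= n)%N -> Y (t i) w = s i] =
       (\prod_(i < n) p (t i.+1 - t i) (s i) (s i.+1))%:E) /\
    (forall y, p h y (~~ y) / h @[h --> 0^'+] --> a) }.

(* The position X_t, lifted from T to R, when X_0 = x. *)
Definition position (x t : R) (w : Omega) : R :=
  x + Rintegral lebesgue_measure `[0, t] (fun s => sgn (Y s w)).

(* P_t f (x, y) is the expectation of f (X_t, Y_t) given X_0 = x, Y_0 = y. *)
Definition semigroup (t : R) (f : phase R -> R[i]) : phase R -> R[i] :=
  fun z => Cintegral (Pr z.2) setT (fun w => f (position z.1 t w, Y t w)).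

End Process.

Section Generator.
Context {R : realType}.

(* The graph of the generator on L^2(mu): L_a f = u. The domain consists of the
   f that are absolutely continuous in x with derivative [df] in L^2. *)
Definition generator (a : R) (f u : phase R -> R[i]) : Prop :=
  [/\ inL2 f, inL2 u &
    exists df : phase R -> R[i], [/\ inL2 df,
      forall x y, 0 <= x <= 2 * pi ->
        f (x, y) = f (0, y) +
          Cintegral lebesgue_measure `[0, x] (fun s => df (s, y)) &
      {ae mu, forall z, u z = real_complex R (sgn z.2) * df z +
        real_complex R a * (f (z.1, ~~ z.2) - f z)}]].

(* Eigenvalues of the restriction of L_a to the orthogonal complement of 1. *)
Definition eigenvalue_perp (a : R) (theta : R[i]) : Prop :=
  exists f : phase R -> R[i],
    [/\ generator a f (fun z => theta * f z),
        L2inner f one_fun = 0 &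
        L2norm f <> 0%E].

End Generator.

(* Main.v *)
Require Import Defs.
From HB Require Import structures.
From mathcomp Require Import all_boot all_order all_algebra.
From mathcomp Require Import all_classical all_reals all_analysis.
From mathcomp Require Import complex measurable_realfun.
From mathcomp Require Import ring lra.

(* On the trigonometric mode of frequency n the generator is the matrix
   [[in - a, a], [a, -in - a]], whose exponential is given by C = gcosh k t and
   S = gsinh k t, k = a^2 - n^2: hyperbolic, affine or trigonometric functions of
   t according to the sign of k. The norm of the exponential is
   e^(-at) amp (a |S|), where amp z = z + sqrt (1 + z^2), and by orthogonality
   ||P_t - mu|| is the supremum of these norms over n >= 1: the constants only
   contribute the factor e^(-2at) through the mode n = 0. The mode n = 1
   dominates if a >= 1, or if t is small. If a < 1, |S| <= 1 / sqrt (1 - a^2) for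
   all n >= 1, with equality periodically for n = 1, while at suitable large times
   all the phases are close to multiples of pi, so that all the norms are close to
   e^(-at).
   The process is related to the modes by sampling the chain on a grid of mesh h:
   one step of the sampled chain agrees with the flow of the mode up to o(h), and
   the Riemann sums of the velocity converge by right continuity. The bound
   extends from trigonometric polynomials to L^2 by density, because averaging
   over translates is bounded in L^2.
   The Fourier coefficients of an eigenfunction show that an eigenvalue theta on
   the orthogonal of 1 satisfies (theta + a)^2 = a^2 - n^2 for some n >= 1, or
   theta = -2a. *)

Set Implicit Arguments.
Unset Strict Implicit.
Unset Printing Implicit Defensive.

Import Order.TTheory GRing.Theory Num.Theory.
Import numFieldNormedType.Exports.

Local Open Scope classical_set_scope.
Local Open Scope ring_scope.

(** * Hyperbolic functions and norms of single modes *)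

(** On the n-th mode the square of L_a + a is the scalar k = a^2 - n^2, so the exponential of t (L_a
    + a) is C + S (L_a + a). Moreover C^2 + n^2 S^2 = 1 + a^2 S^2, so the norm of a mode depends on
    n only through |S|: every comparison of modes is a comparison of [gsinh] at two values of k. The
    transition function of the chain is given only through its rate at 0. A telescoping estimate
    takes the place of a differential equation: a step of the sampled chain does not increase the
    sup norm, so the one-step errors o(h) merely add up over t / h steps. A function in L^2 need not
    be integrable along the paths from every starting point, and the bound on translates loses a
    factor. Neither matters, because they only meet the approximation error: a split with weights 1
    + eta and 1 + 1 / eta keeps the constant sharp on the polynomial part. Expectations have real
    weights, so real and imaginary parts are treated separately, and a mode is a pair of cosine and
    sine coefficients for each velocity. *)

Section GeneralizedHyperbolic.
Context {R : realType}.
Implicit Types k t : R.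

(* cosh (sqrt k t) and sinh (sqrt k t) / sqrt k, continued analytically to k <= 0. *)
Definition gcosh k t : R :=
  if 0 < k then (expR (Num.sqrt k * t) + expR (- (Num.sqrt k * t))) / 2
  else if k < 0 then cos (Num.sqrt (- k) * t) else 1.

Definition gsinh k t : R :=
  if 0 < k then (expR (Num.sqrt k * t) - expR (- (Num.sqrt k * t))) / (2 * Num.sqrt k)
  else if k < 0 then sin (Num.sqrt (- k) * t) / Num.sqrt (- k) else t.

Lemma is_derive_scale (f : R -> R) (w t df : R) :
  is_derive (w * t) 1 f df -> is_derive t 1 (fun s => f (w * s)) (w * df).
Proof.
move=> fd; have wd : is_derive t 1 (w \*: (@id R)) w.
  by apply: is_derive_eq; rewrite /GRing.scale /= mulr1.
by rewrite mulrC; exact: (@is_derive1_comp _ f (w \*: (@id R))).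
Qed.

Lemma gcosh0 k : gcosh k 0 = 1.
Proof.
by rewrite /gcosh !mulr0 oppr0 expR0 cos0; case: ifP => _; [field|case: ifP].
Qed.

Lemma gsinh0 k : gsinh k 0 = 0.
Proof.
rewrite /gsinh !mulr0 oppr0 expR0 sin0 subrr !mul0r.
by case: ifP => // _; case: ifP.
Qed.

Lemma gsinhD k s t :
  gsinh k (s + t) = gsinh k s * gcosh k t + gcosh k s * gsinh k t.
Proof.
rewrite /gcosh /gsinh; case: ifPn => [k0|_].
  have w0 : Num.sqrt k != 0 by rewrite gt_eqF ?sqrtr_gt0.
  by rewrite mulrDr opprD !expRD; field.
case: ifPn => [k0|_]; last by rewrite mulr1 mul1r.
have w0 : Num.sqrt (- k) != 0 by rewrite gt_eqF ?sqrtr_gt0 ?oppr_gt0.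
by rewrite mulrDr sinD; field.
Qed.

Lemma gcoshD k s t :
  gcosh k (s + t) = gcosh k s * gcosh k t + k * gsinh k s * gsinh k t.
Proof.
rewrite /gcosh /gsinh; case: ifPn => [k0|k0].
  have w0 : Num.sqrt k != 0 by rewrite gt_eqF ?sqrtr_gt0.
  have -> : k = Num.sqrt k ^+ 2 by rewrite sqr_sqrtr ?ltW.
  rewrite sqrtr_sqr ger0_norm ?sqrtr_ge0//.
  by rewrite mulrDr opprD !expRD; field.
case: ifPn => [k1|k1].
  have w0 : Num.sqrt (- k) != 0 by rewrite gt_eqF ?sqrtr_gt0 ?oppr_gt0.
  have -> : k = - Num.sqrt (- k) ^+ 2 by rewrite sqr_sqrtr ?opprK// oppr_ge0 ltW.
  rewrite opprK sqrtr_sqr ger0_norm ?sqrtr_ge0//.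
  by rewrite mulrDr cosD; field.
have -> : k = 0 by apply/eqP; rewrite eq_le -!leNgt in k0 k1 *; rewrite k0 k1.
by rewrite !mul0r addr0 mul1r.
Qed.

(** The identity cosh^2 - sinh^2 = 1 in all three regimes; it eliminates [gcosh] from the norms of
    the modes. *)
Lemma gcosh2Bgsinh2 k t : gcosh k t ^+ 2 = 1 + k * gsinh k t ^+ 2.
Proof.
rewrite /gcosh /gsinh; case: ifPn => [k0|k0].
  have w0 : Num.sqrt k != 0 by rewrite gt_eqF ?sqrtr_gt0.
  have kE : k = Num.sqrt k ^+ 2 by rewrite sqr_sqrtr ?ltW.
  have e0 : expR (Num.sqrt k * t) != 0 by rewrite gt_eqF ?expR_gt0.
  by rewrite [X in 1 + X * _]kE expRN; field; rewrite w0.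
case: ifPn => [k1|k1].
  have w0 : Num.sqrt (- k) != 0 by rewrite gt_eqF ?sqrtr_gt0 ?oppr_gt0.
  have kE : k = - Num.sqrt (- k) ^+ 2 by rewrite sqr_sqrtr ?opprK// oppr_ge0 ltW.
  rewrite [X in 1 + X * _]kE exprMn exprVn mulrCA mulNr divff ?expf_neq0// mulrN1.
  by rewrite cos2sin2.
have -> : k = 0 by apply/eqP; rewrite eq_le -!leNgt in k0 k1 *; rewrite k0 k1.
by rewrite mul0r addr0 expr1n.
Qed.

Lemma is_derive_gcosh k t : is_derive t 1 (gcosh k) (k * gsinh k t).
Proof.
rewrite /gcosh /gsinh; case: ifPn => [k0|k0].
  have w0 : Num.sqrt k != 0 by rewrite gt_eqF ?sqrtr_gt0.
  have kE : k = Num.sqrt k ^+ 2 by rewrite sqr_sqrtr ?ltW.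
  rewrite [X in is_derive _ _ _ X](_ : _ = Num.sqrt k * ((expR (Num.sqrt k * t) - expR (- (Num.sqrt k * t))) / 2)); last first.
    by rewrite [X in X * _ = _]kE; field.
  rewrite (_ : (fun _ => _) = 2^-1 \*: ((fun s => expR (Num.sqrt k * s)) \+ (fun s => expR (- Num.sqrt k * s)))); last first.
    by apply/funext => s /=; rewrite mulNr mulrC.
  have d1 := is_derive_scale (is_derive_expR (Num.sqrt k * t)).
  have d2 := is_derive_scale (is_derive_expR (- Num.sqrt k * t)).
  apply: is_derive_eq; rewrite /GRing.scale /= !mulNr; by field.
case: ifPn => [k1|k1].
  have w0 : Num.sqrt (- k) != 0 by rewrite gt_eqF ?sqrtr_gt0 ?oppr_gt0.
  have kE : k = - Num.sqrt (- k) ^+ 2 by rewrite sqr_sqrtr ?opprK// oppr_ge0 ltW.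
  rewrite [X in is_derive _ _ _ X](_ : _ = Num.sqrt (- k) * - sin (Num.sqrt (- k) * t)); last first.
    by rewrite [X in X * _ = _]kE; field.
  apply: (is_derive_eq (is_derive_scale (is_derive_cos (Num.sqrt (- k) * t)))).
  by field.
have -> : k = 0 by apply/eqP; rewrite eq_le -!leNgt in k0 k1 *; rewrite k0 k1.
by rewrite mul0r; apply: is_derive_cst.
Qed.

Lemma is_derive_gsinh k t : is_derive t 1 (gsinh k) (gcosh k t).
Proof.
rewrite /gcosh /gsinh; case: ifPn => [k0|k0].
  have w0 : Num.sqrt k != 0 by rewrite gt_eqF ?sqrtr_gt0.
  rewrite (_ : (fun _ => _) = (2 * Num.sqrt k)^-1 \*: ((fun s => expR (Num.sqrt k * s)) \- (fun s => expR (- Num.sqrt k * s)))); last first.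
    by apply/funext => s /=; rewrite mulNr mulrC.
  have d1 := is_derive_scale (is_derive_expR (Num.sqrt k * t)).
  have d2 := is_derive_scale (is_derive_expR (- Num.sqrt k * t)).
  apply: is_derive_eq; rewrite /GRing.scale /= !mulNr; by field.
case: ifPn => [k1|k1].
  have w0 : Num.sqrt (- k) != 0 by rewrite gt_eqF ?sqrtr_gt0 ?oppr_gt0.
  rewrite (_ : (fun _ => _) = (Num.sqrt (- k))^-1 \*: (fun s => sin (Num.sqrt (- k) * s))); last first.
    by apply/funext => s /=; rewrite mulrC.
  have d1 := is_derive_scale (is_derive_sin (Num.sqrt (- k) * t)).
  apply: is_derive_eq; rewrite /GRing.scale /=; by field.
exact: is_derive_id.
Qed.

Lemma is_derive_continuous (f df : R -> R) :
  (forall t, is_derive t 1 f (df t)) -> continuous f.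
Proof.
move=> fd t; apply: differentiable_continuous.
by apply/derivable1_diffP; have [] := fd t.
Qed.

Lemma continuous_gcosh k : continuous (gcosh k).
Proof. exact: is_derive_continuous (is_derive_gcosh k). Qed.

Lemma continuous_gsinh k : continuous (gsinh k).
Proof. exact: is_derive_continuous (is_derive_gsinh k). Qed.

Lemma is_derive_ge0_le (f df : R -> R) (a b : R) : a <= b ->
  (forall t, is_derive t 1 f (df t)) ->
  (forall t, a < t < b -> 0 <= df t) -> f a <= f b.
Proof.
move=> ab fd df0; apply: (@ger0_derive1_ndecr _ f a b) => //.
- move=> x; rewrite in_itv/= => xab; rewrite derive1E.
  by rewrite (@derive_val _ _ _ _ _ _ _ (fd x)) df0.
- by apply: continuous_subspaceT; exact: is_derive_continuous fd.
Qed.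

Lemma gcosh_ge1 k t : 0 <= k -> 1 <= gcosh k t.
Proof.
move=> k0.
have : 1 <= gcosh k t ^+ 2.
  by rewrite gcosh2Bgsinh2 lerDl mulr_ge0// sqr_ge0.
have C0 : 0 <= gcosh k t.
  rewrite /gcosh; case: ifPn => _; first by rewrite divr_ge0 ?addr_ge0 ?expR_ge0.
  by rewrite ltNge k0.
by rewrite -[X in X <= _ -> _](expr1n R 2) ler_sqr ?nnegrE.
Qed.

(** If k' > 0, the exponentials 1 <= X <= Y satisfy Y + 1/Y - X - 1/X = (Y - X) (1 - 1/(XY)) >= 0.
    If k' <= 0, the left side is at most 1 and the right side at least 1. *)
Lemma norm_gcosh_le k k' t : 0 <= k -> k' <= k -> 0 <= t ->
  `|gcosh k' t| <= gcosh k t.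
Proof.
move=> k0 k'k t0.
have [k'0|k'0] := ltP 0 k'.
  rewrite ger0_norm; last by rewrite (le_trans ler01)// gcosh_ge1// ltW.
  have kk : 0 < k by exact: lt_le_trans k'k.
  rewrite /gcosh ifT// ifT// ler_pM2r ?invr_gt0// !expRN.
  set X := expR (_ k' * t); set Y := expR _.
  have X1 : 1 <= X by rewrite /X -expR0 ler_expR mulr_ge0 ?sqrtr_ge0.
  have XY : X <= Y by rewrite ler_expR ler_wpM2r// ler_wsqrtr.
  have X0 : 0 < X by exact: expR_gt0.
  have Y0 : 0 < Y by exact: expR_gt0.
  rewrite -subr_ge0 (_ : _ - _ = (Y - X) * (1 - (X * Y)^-1)); last first.
    by field; rewrite !gt_eqF.
  rewrite mulr_ge0 ?subr_ge0// invf_le1 ?mulr_gt0//.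
  by rewrite -[leLHS]mulr1 ler_pM// (le_trans X1).
apply: le_trans (gcosh_ge1 _ _) => //.
rewrite /gcosh ltNge k'0/=; case: ifP => _; first exact: cos_max.
by rewrite normr1.
Qed.

(** Integrates [norm_gcosh_le]: the sum and the difference of the two functions vanish at 0 and have
    nonnegative derivatives. With k = a^2 - 1 >= 0 this is the domination of the first mode. *)
Lemma norm_gsinh_le k k' t : 0 <= k -> k' <= k -> 0 <= t ->
  `|gsinh k' t| <= gsinh k t.
Proof.
move=> k0 k'k t0; rewrite ler_norml lerNl -subr_ge0 -[X in _ && X]subr_ge0.
have C1 s : 0 < s < t -> `|gcosh k' s| <= gcosh k s.
  by move=> /andP[s0 _]; rewrite norm_gcosh_le// ltW.
apply/andP; split.
  have := @is_derive_ge0_le (gsinh k \- - gsinh k') (fun t => gcosh k t - - gcosh k' t) 0 t t0.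
  rewrite /= /= !gsinh0 => H; apply: le_trans (H _ _).
  - by rewrite -[X in _ <= _ - X]/(- gsinh k' 0) gsinh0 oppr0 subrr.
  - move=> s; apply: is_deriveB; first exact: is_derive_gsinh.
    apply: is_deriveN; exact: is_derive_gsinh.
  - by move=> s /C1; rewrite ler_norml subr_ge0 lerNl => /andP[].
have := @is_derive_ge0_le (gsinh k \- gsinh k') (fun t => gcosh k t - gcosh k' t) 0 t t0.
rewrite /= !gsinh0 subrr => H; apply: H.
  by move=> s; apply: is_deriveB; exact: is_derive_gsinh.
by move=> s /C1; rewrite ler_norml subr_ge0 => /andP[].
Qed.

End GeneralizedHyperbolic.

(** * The norm of the first mode and its expansion at small times *)

Section Amplification.
Context {R : realType}.
Implicit Types z t a : R.

(** The exponential of arsinh z. *)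
Definition amp z : R := z + Num.sqrt (1 + z ^+ 2).

Lemma oneDsqr_gt0 z : 0 < 1 + z ^+ 2.
Proof. by rewrite ltr_pwDl// sqr_ge0. Qed.

Lemma sqrt_oneDsqr_gt z : `|z| < Num.sqrt (1 + z ^+ 2).
Proof. by rewrite -sqrtr_sqr ltr_sqrt ?oneDsqr_gt0// ltrDr. Qed.

Lemma amp_gt0 z : 0 < amp z.
Proof.
by rewrite /amp -ltrBlDl sub0r (le_lt_trans _ (sqrt_oneDsqr_gt z))// ler_normr lexx orbT.
Qed.

Lemma amp_le z z' : 0 <= z -> z <= z' -> amp z <= amp z'.
Proof.
move=> z0 zz'; rewrite lerD// ler_sqrt ?(ltW (oneDsqr_gt0 _))// lerD2l ler_sqr//.
by rewrite nnegrE (le_trans z0).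
Qed.

Lemma amp0 : amp 0 = 1.
Proof. by rewrite /amp expr0n addr0 sqrtr1 add0r. Qed.

Lemma amp_ge1 z : 0 <= z -> 1 <= amp z.
Proof. by move=> z0; rewrite -amp0 amp_le. Qed.

(** With r = sqrt (1 + z^2) one has (r + z) (r - z) = 1, hence (r + z)^2 = (r + z) / (r - z);
    dividing through by z gives the shape of the closed forms for a <= 1. *)
Lemma sqr_ampE z : 0 < z ->
  amp z ^+ 2 = 1 + 2 / (Num.sqrt (1 + 1 / z ^+ 2) - 1).
Proof.
move=> z0; have -> : 1 + 1 / z ^+ 2 = (1 + z ^+ 2) / z ^+ 2.
  by field; rewrite gt_eqF.
rewrite sqrtrM ?(ltW (oneDsqr_gt0 _))// sqrtrV ?sqr_ge0// sqrtr_sqr gtr0_norm//.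
rewrite /amp; set r := Num.sqrt _.
have rz : z < r by rewrite (le_lt_trans _ (sqrt_oneDsqr_gt z))// ler_norm.
have r2 : r ^+ 2 = 1 + z ^+ 2 by rewrite sqr_sqrtr// ltW// oneDsqr_gt0.
have -> : 1 + 2 / (r / z - 1) = (r + z) / (r - z).
  by field; rewrite (gt_eqF z0) subr_eq0 gt_eqF.
have rz0 : r - z != 0 by rewrite subr_eq0 gt_eqF.
apply: (mulIf rz0); rewrite divfK//.
have -> : (z + r) ^+ 2 * (r - z) = (r ^+ 2 - z ^+ 2) * (r + z) by ring.
by rewrite r2 addrK mul1r.
Qed.

Lemma is_derive_amp z : is_derive z 1 amp (amp z / Num.sqrt (1 + z ^+ 2)).
Proof.
have d1 : is_derive z 1 ((cst 1 : R -> R) + (@id R) ^+ 2) (2 * z).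
  have d0 := @is_deriveX _ _ (@id R) 2 z 1 _ (is_derive_id z 1).
  apply: (is_derive_eq (is_deriveD (is_derive_cst (1 : R) z 1) d0)).
  by rewrite add0r /GRing.scale /= mulr1 expr1 mulr_natl.
have d2 : is_derive (((cst 1 : R -> R) + (@id R) ^+ 2) z) 1 (@Num.sqrt R) (2 * Num.sqrt (1 + z ^+ 2))^-1.
  by apply: is_derive1_sqrt; exact: oneDsqr_gt0.
have d3 := is_derive1_comp d2 d1.
have d4 := is_deriveD (is_derive_id z 1) d3.
have s0 : Num.sqrt (1 + z ^+ 2) != 0 by rewrite gt_eqF// sqrtr_gt0 oneDsqr_gt0.
apply: (is_derive_eq d4); rewrite /amp; by field.
Qed.

Variable a : R.
Hypothesis a0 : 0 < a.
Let k := a ^+ 2 - 1.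
Let D t := 1 + (a * gsinh k t) ^+ 2.
(** There is no absolute value on [gsinh], which keeps the function differentiable; it is the norm
    of the first mode as long as [gsinh k t] is nonnegative. *)
Definition mode1_norm t : R := expR (- a * t) * amp (a * gsinh k t).

Lemma is_derive_mode1_norm t : is_derive t 1 mode1_norm
  (mode1_norm t * (a * (gcosh k t / Num.sqrt (D t) - 1))).
Proof.
have d1 := is_derive_scale (is_derive_expR (- a * t)).
have d2 : is_derive t 1 (a \*: gsinh k) (a * gcosh k t).
  by apply: is_deriveZ; exact: is_derive_gsinh.
have d3 := @is_derive1_comp _ amp (a \*: gsinh k) t _ _ (is_derive_amp (a * gsinh k t)) d2.
have s0 : Num.sqrt (D t) != 0 by rewrite gt_eqF// sqrtr_gt0 oneDsqr_gt0.
apply: (is_derive_eq (is_deriveM d1 d3)); rewrite /mode1_norm /GRing.scale /=.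
by rewrite -/(D t); field.
Qed.

(** Rationalization: the square of [gcosh k t] minus [D t] is (k - a^2) S^2 = - S^2. The logarithmic
    derivative of the norm is thus of order t^2, which is why the norm leaves 1 only at third
    order. *)
Lemma mode1_norm_slopeE t : 0 < gcosh k t ->
  gcosh k t / Num.sqrt (D t) - 1 =
  - gsinh k t ^+ 2 / (Num.sqrt (D t) * (gcosh k t + Num.sqrt (D t))).
Proof.
move=> C0.
have d0 : 0 < Num.sqrt (D t) by rewrite sqrtr_gt0 oneDsqr_gt0.
have Dd : Num.sqrt (D t) ^+ 2 = 1 + a ^+ 2 * gsinh k t ^+ 2.
  by rewrite sqr_sqrtr /D ?exprMn// addr_ge0// mulr_ge0// sqr_ge0.
have CC := gcosh2Bgsinh2 k t.
have -> : gcosh k t / Num.sqrt (D t) - 1 = (gcosh k t ^+ 2 - Num.sqrt (D t) ^+ 2) / (Num.sqrt (D t) * (gcosh k t + Num.sqrt (D t))).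
  move: (Num.sqrt (D t)) d0 => r d0; field; by rewrite (gt_eqF d0) gt_eqF// addr_gt0.
by congr (_ / _); rewrite Dd CC /k; ring.
Qed.

Lemma cvg_gsinh_div (k0 : R) : gsinh k0 t / t @[t --> 0^'+] --> (1 : R).
Proof.
apply: (@lhopital_at_right _ (gsinh k0) (gcosh k0) id (cst 1) 0 1 1) => //.
- by move=> x _; exact: is_derive_gsinh.
- by apply: cvg_at_right_filter; rewrite -[X in _ --> X](gsinh0 k0); exact: continuous_gsinh.
- by apply: cvg_at_right_filter; exact: cvg_id.
- by move=> x _; rewrite oner_neq0.
- rewrite (_ : (fun x => _) = gcosh k0); last by apply/funext => x; rewrite /= divr1.
  by apply: cvg_at_right_filter; rewrite -[X in _ --> X](gcosh0 k0); exact: continuous_gcosh.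
Qed.

(** L'Hopital's rule against t^3: by [mode1_norm_slopeE] the derivative is equivalent to - a t^2 /
    2, and division by 3 t^2 gives - a / 6. *)
Lemma mode1_norm_small_time :
  (mode1_norm t - (1 - a * t ^+ 3 / 6)) / t ^+ 3 @[t --> 0^'+] --> (0 : R).
Proof.
have F0 : mode1_norm 0 = 1 by rewrite /mode1_norm gsinh0 !mulr0 expR0 amp0 mulr1.
have cF : mode1_norm t @[t --> 0^'+] --> (1 : R).
  by apply: cvg_at_right_filter; rewrite -[X in _ --> X]F0;
    exact: (is_derive_continuous is_derive_mode1_norm).
have cC : gcosh k t @[t --> 0^'+] --> (1 : R).
  by apply: cvg_at_right_filter; rewrite -[X in _ --> X](gcosh0 k); exact: continuous_gcosh.
have cS : gsinh k t @[t --> 0^'+] --> (0 : R).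
  by apply: cvg_at_right_filter; rewrite -[X in _ --> X](gsinh0 k); exact: continuous_gsinh.
have cD : Num.sqrt (D t) @[t --> 0^'+] --> (1 : R).
  rewrite -[X in _ --> X]sqrtr1.
  apply: (@cvg_comp _ _ _ D (@Num.sqrt R)); last exact: sqrt_continuous.
  have -> : (1 : R) = 1 + (a * 0) * (a * 0) by rewrite mulr0 mulr0 addr0.
  rewrite (_ : D = fun t => 1 + (a * gsinh k t) * (a * gsinh k t)); last first.
    by apply/funext => t; rewrite -expr2.
  have caS : a * gsinh k t @[t --> 0^'+] --> a * 0.
    by apply: cvgM => //; exact: cvg_cst.
  by apply: cvgD; [exact: cvg_cst|exact: cvgM].
have : (mode1_norm t - 1) / t ^+ 3 @[t --> 0^'+] --> - (a / 6).
  apply: (@lhopital_at_right _ (fun t => mode1_norm t - 1)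
    (fun t => mode1_norm t * (a * (gcosh k t / Num.sqrt (D t) - 1)))
    (fun t => t ^+ 3) (fun t => 3 * t ^+ 2) 0 1).
  - exact: ltr01.
  - move=> x _; have d1 := is_deriveB (is_derive_mode1_norm x) (is_derive_cst (1 : R) x 1).
    by apply: (is_derive_eq d1); rewrite subr0.
  - move=> x _; have d1 := @is_deriveX _ _ (@id R) 3 x 1 _ (is_derive_id x 1).
    by apply: (is_derive_eq d1); rewrite /GRing.scale /= mulr1 mulr_natl.
  - by rewrite -[X in _ --> X](subrr 1); apply: cvgB => //; exact: cvg_cst.
  - apply: cvg_at_right_filter; rewrite -[X in _ --> X](_ : 0 ^+ 3 = 0 :> R); last by rewrite expr0n.
    exact: exprn_continuous.
  - by move=> x; rewrite in_itv/= => /andP[x0 _]; rewrite mulf_neq0 ?expf_neq0 ?gt_eqF// ltr0n.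
  have H : - (mode1_norm t * a / 3 * ((gsinh k t / t) * (gsinh k t / t)) * (Num.sqrt (D t) * (gcosh k t + Num.sqrt (D t)))^-1) @[t --> 0^'+] --> - (a / 6).
    have -> : a / 6 = 1 * a / 3 * (1 * 1) * (1 * (1 + 1))^-1 by field.
    apply: cvgN; apply: cvgM.
      apply: cvgM; last by apply: cvgM; exact: cvg_gsinh_div.
      by apply: cvgM; [apply: cvgM => //|]; exact: cvg_cst.
    by apply: cvgV; [by rewrite mul1r gt_eqF// addr_gt0|apply: cvgM => //; apply: cvgD].
  apply: cvg_trans H; apply: near_eq_cvg.
  have C0 : \forall t \near 0^'+, 0 < gcosh k t.
    by apply: cvgr_gt cC _ _; rewrite ltr01.
  near=> t.
  have t0 : 0 < t by [].
  have d0 : 0 < Num.sqrt (D t) by rewrite sqrtr_gt0 oneDsqr_gt0.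
  have Ct : 0 < gcosh k t by near: t.
  rewrite mode1_norm_slopeE//.
  by field; rewrite !gt_eqF//= addr_gt0.
have H2 : (cst (a / 6) : R -> R) t @[t --> (0 : R)^'+] --> a / 6 by exact: cvg_cst.
move=> H1.
have H3 : ((mode1_norm t - 1) / t ^+ 3 + a / 6) @[t --> (0 : R)^'+] --> - (a / 6) + a / 6.
  exact: cvgD.
rewrite addNr in H3.
apply: cvg_trans H3; apply: near_eq_cvg.
near=> t; have t0 : 0 < t by [].
by rewrite /=; field; rewrite gt_eqF.
Unshelve. all: by end_near.
Qed.

End Amplification.

(** * Closed forms, equivalents at large times, and comparison of oscillating modes *)

Section ClosedForms.
Context {R : realType}.
Implicit Types a t z : R.

Lemma amp_coth_form a t : 1 < a -> 0 < t ->
  let omega := Num.sqrt (a ^+ 2 - 1) in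
  let gamma := expR (- 2 * omega * t) in
  let c := (1 + gamma) / (1 - gamma) in
  mode1_norm a t = expR ((- a + Num.sqrt (a ^+ 2 - 1)) * t) *
    Num.sqrt (1 + 2 / (omega ^+ 2 * c
      + a * Num.sqrt (1 + omega ^+ 2 * c ^+ 2) - 1)).
Proof.
move=> a1 t0 omega gamma c.
have k0 : 0 < a ^+ 2 - 1 by rewrite subr_gt0 expr_gt1// ltW// (lt_trans ltr01).
have w0 : 0 < omega by rewrite sqrtr_gt0.
have w2 : omega ^+ 2 = a ^+ 2 - 1 by rewrite sqr_sqrtr// ltW.
have a0 : 0 < a by exact: lt_trans a1.
pose E := expR (omega * t).
have E0 : 0 < E by exact: expR_gt0.
have E1 : 1 < E by rewrite /E -expR0 ltr_expR mulr_gt0.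
have gE : gamma = (E ^+ 2)^-1.
  by rewrite /gamma /E -expRM_natl -expRN; congr expR; rewrite mulr_natl; ring.
pose S := gsinh (a ^+ 2 - 1) t; pose C := gcosh (a ^+ 2 - 1) t.
have SE : S = (E - E^-1) / (2 * omega) by rewrite /S /gsinh k0 expRN.
have CE : C = (E + E^-1) / 2 by rewrite /C /gcosh k0 expRN.
have S0 : 0 < S.
  rewrite SE divr_gt0 ?mulr_gt0// subr_gt0 (lt_trans _ E1)// invf_lt1//.
have C0 : 0 < C by rewrite CE divr_gt0// addr_gt0 ?invr_gt0.
have CS := gcosh2Bgsinh2 (a ^+ 2 - 1) t.
rewrite -/S -/C -w2 in CS.
have E2n : E ^+ 2 - 1 != 0 by rewrite subr_eq0 gt_eqF// expr_gt1// ltW.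
(* [c] is coth (omega t). *)
have cE : c = C / (omega * S).
  rewrite /c gE CE SE; field; rewrite E2n !gt_eqF//=.
pose d := Num.sqrt (1 + (a * S) ^+ 2).
have d2 : d ^+ 2 = 1 + a ^+ 2 * S ^+ 2 by rewrite sqr_sqrtr ?exprMn// -exprMn ltW// oneDsqr_gt0.
have daS : a * S < d.
  by rewrite (le_lt_trans _ (sqrt_oneDsqr_gt _))// ler_norm.
have d0 : 0 < d by rewrite (le_lt_trans _ daS)// mulr_ge0// ltW.
have rE : Num.sqrt (1 + omega ^+ 2 * c ^+ 2) = d / S.
  have -> : 1 + omega ^+ 2 * c ^+ 2 = (d / S) ^+ 2.
    have -> : 1 + omega ^+ 2 * c ^+ 2 = (S ^+ 2 + C ^+ 2) / S ^+ 2.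
      by rewrite cE; field; rewrite !gt_eqF.
    by rewrite exprMn exprVn d2 CS w2; congr (_ / _); ring.
  by rewrite sqrtr_sqr ger0_norm// divr_ge0// ltW.
rewrite rE cE.
(* Multiplying the inner fraction by S turns the radicand into (X + S) / (X - S). *)
pose X := omega * C + a * d.
have XS : 0 < X - S.
  have : a * (a * S) <= a * d by rewrite ler_wpM2l// ltW.
  have : S < a * (a * S) by rewrite mulrA ltr_pMl// mulr_egt1//.
  rewrite /X; have := mulr_gt0 w0 C0; lra.
have -> : 1 + 2 / (omega ^+ 2 * (C / (omega * S)) + a * (d / S) - 1) = (X + S) / (X - S).
  rewrite /X; field; rewrite -/X.
  by rewrite gt_eqF//= (gt_eqF S0) (gt_eqF w0).
(* Since C - omega S = e^(- omega t), [Q] is e^(- omega t) times the amplification, which is what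
   the square root must be. Its inverse is (C + omega S) (d - a S), and the identity [H] follows
   from d^2 - C^2 = S^2 and 1 + omega^2 = a^2. *)
pose Q := (C - omega * S) * (a * S + d).
have CwS : C - omega * S = E^-1 by rewrite CE SE; field; rewrite !gt_eqF.
have Q0 : 0 < Q by rewrite /Q CwS mulr_gt0 ?invr_gt0// addr_gt0// mulr_gt0.
have QE : (X + S) / (X - S) = Q ^+ 2.
  have XS0 : X - S != 0 by rewrite gt_eqF.
  apply: (mulIf XS0); rewrite divfK//.
  have H : (X + S) * ((C + omega * S) * (d - a * S)) = (X - S) * Q.
    apply/eqP; rewrite -subr_eq0; apply/eqP.
    transitivity (2 * S * (a * omega * (d ^+ 2 - C ^+ 2) - a * omega * S ^+ 2 + C * d * (1 + omega ^+ 2 - a ^+ 2))).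
      rewrite /X /Q; ring.
    by rewrite d2 CS w2; ring.
  have PQ : (C + omega * S) * (d - a * S) * Q = 1.
    transitivity ((C ^+ 2 - omega ^+ 2 * S ^+ 2) * (d ^+ 2 - a ^+ 2 * S ^+ 2)).
      by rewrite /Q; ring.
    by rewrite CS d2; ring.
  by rewrite -[LHS]mulr1 -PQ mulrA H; ring.
rewrite QE sqrtr_sqr ger0_norm ?ltW// /Q CwS mulrDl expRD -/E /mode1_norm /amp -/S -/d.
by rewrite -!mulrA mulVKf ?gt_eqF// mulrA.
Qed.

(** In the closed form, c tends to 1 and the radicand to 1 + 1 / omega^2 = (a / omega)^2; the
    constant of the equivalent is therefore a / omega. *)
Lemma amp_quotient_form a : 1 < a ->
  let omega := Num.sqrt (a ^+ 2 - 1) in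
  mode1_norm a t / (a / omega * expR (- (a - omega) * t)) @[t --> +oo%R] --> (1 : R).
Proof.
move=> a1 omega.
have k0 : 0 < a ^+ 2 - 1 by rewrite subr_gt0 expr_gt1// ltW// (lt_trans ltr01).
have w0 : 0 < omega by rewrite sqrtr_gt0.
have w2 : omega ^+ 2 = a ^+ 2 - 1 by rewrite sqr_sqrtr// ltW.
have a0 : 0 < a by exact: lt_trans a1.
pose G c := Num.sqrt (1 + 2 / (omega ^+ 2 * c + a * Num.sqrt (1 + omega ^+ 2 * c ^+ 2) - 1)) / (a / omega).
pose c t := (1 + expR (- 2 * omega * t)) / (1 - expR (- 2 * omega * t)) : R.
have cG : G x @[x --> (1 : R)] --> (1 : R).
  have r1 : Num.sqrt (1 + omega ^+ 2 * 1 ^+ 2) = a.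
    by rewrite expr1n mulr1 w2 addrC subrK sqrtr_sqr ger0_norm// ltW.
  have den1 : omega ^+ 2 * 1 + a * a - 1 = 2 * omega ^+ 2.
    by rewrite w2; ring.
  have G1 : G 1 = 1.
    rewrite /G r1 den1 (_ : 1 + _ = (a / omega) ^+ 2); last first.
      by rewrite exprMn exprVn w2; field; rewrite -w2 expf_neq0// gt_eqF.
    rewrite sqrtr_sqr ger0_norm ?divr_ge0 ?ltW// divff// mulf_neq0 ?invr_neq0// gt_eqF//.
  rewrite -[X in _ --> X]G1; apply: cvgM; last exact: cvg_cst.
  apply: (@cvg_comp _ _ _ (fun c => 1 + 2 / (omega ^+ 2 * c + a * Num.sqrt (1 + omega ^+ 2 * c ^+ 2) - 1)) (@Num.sqrt R)); last exact: sqrt_continuous.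
  apply: cvgD; first exact: cvg_cst.
  apply: cvgM; first exact: cvg_cst.
  apply: cvgV; first by rewrite r1 den1 mulf_neq0// ?expf_neq0// gt_eqF// ltr0n.
  apply: cvgB; last exact: cvg_cst.
  apply: cvgD; first by apply: cvgM; [exact: cvg_cst|exact: cvg_id].
  apply: cvgM; first exact: cvg_cst.
  apply: (@cvg_comp _ _ _ (fun c => 1 + omega ^+ 2 * c ^+ 2) (@Num.sqrt R)); last exact: sqrt_continuous.
  apply: cvgD; first exact: cvg_cst.
  apply: cvgM; first exact: cvg_cst.
  exact: exprn_continuous.
have cg : expR (- 2 * omega * t) @[t --> +oo%R] --> (0 : R).
  apply/cvgrPdist_lt => e e0; near=> t.
  rewrite sub0r normrN ger0_norm ?expR_ge0// -[e]lnK ?posrE// ltr_expR.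
  rewrite mulNr mulNr ltrNl -ltr_pdivrMl ?mulr_gt0//.
  by near: t; apply: nbhs_pinfty_gt; rewrite num_real.
have cc : c t @[t --> +oo%R] --> (1 : R).
  have -> : (1 : R) = (1 + 0) / (1 - 0) by rewrite addr0 subr0 divr1.
  apply: cvgM; first by apply: cvgD => //; exact: cvg_cst.
  apply: cvgV; first by rewrite subr0 oner_neq0.
  by apply: cvgB => //; exact: cvg_cst.
have := @cvg_comp _ _ _ c G _ _ _ cc cG.
apply: cvg_trans; apply: near_eq_cvg; near=> t.
have t0 : 0 < t by near: t; exact: nbhs_pinfty_gt.
rewrite amp_coth_form//= -/omega /G /c (_ : - (a - omega) = - a + omega); last by ring.
by field; rewrite !gt_eqF ?expR_gt0.
Unshelve. all: by end_near.
Qed.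

(** For a = 1 the function [gsinh] is t itself, and amp t / (2 t) = (1 + sqrt (1 + 1 / t^2)) / 2. *)
Lemma mode1_norm_critical_large_time :
  mode1_norm 1 t / (2 * t * expR (- t)) @[t --> +oo%R] --> (1 : R).
Proof.
have gE t : gsinh ((1 : R) ^+ 2 - 1) t = t by rewrite expr1n subrr /gsinh ltxx.
have cv : t^-1 @[t --> +oo%R] --> (0 : R).
  by apply/gtr0_cvgV0; [exact: nbhs_pinfty_gt|exact: cvg_id].
have : (1 + Num.sqrt (t^-1 * t^-1 + 1)) / 2 @[t --> +oo%R] --> (1 : R).
  have E : (1 + Num.sqrt (0 * 0 + 1)) / 2 = 1 :> R.
    by rewrite mul0r add0r sqrtr1 -[1 + 1]/(2%:R) divff// pnatr_eq0.
  rewrite -[X in _ --> X]E; apply: cvgM; last exact: cvg_cst.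
  apply: cvgD; first exact: cvg_cst.
  apply: (@cvg_comp _ _ _ (fun t => t^-1 * t^-1 + 1) (@Num.sqrt R)); last exact: sqrt_continuous.
  by apply: cvgD; [exact: cvgM|exact: cvg_cst].
apply: cvg_trans; apply: near_eq_cvg; near=> t.
have t0 : 0 < t by near: t; exact: nbhs_pinfty_gt.
rewrite /mode1_norm gE mul1r mulN1r /amp.
have -> : 1 + t ^+ 2 = t ^+ 2 * (t^-1 * t^-1 + 1) by field; rewrite gt_eqF.
rewrite sqrtrM ?sqr_ge0// sqrtr_sqr gtr0_norm//.
by field; rewrite !gt_eqF ?expR_gt0.
Unshelve. all: by end_near.
Qed.

(* The case nu = 2 sqrt (-k): beyond the first quarter period of the faster
   oscillation, its amplitude is already reached by the slower one. *)
Lemma norm_gsinh_le_oscillating (k k' t : R) : k < 0 -> k' <= k ->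
  0 <= t -> Num.sqrt (- k) * t <= pi / 2 -> `|gsinh k' t| <= gsinh k t.
Proof.
move=> k0 k'k t0 tpi.
have k'0 : k' < 0 by exact: le_lt_trans k0.
have u0 : 0 < Num.sqrt (- k) by rewrite sqrtr_gt0 oppr_gt0.
have u'0 : 0 < Num.sqrt (- k') by rewrite sqrtr_gt0 oppr_gt0.
have uu' : Num.sqrt (- k) <= Num.sqrt (- k') by rewrite ler_wsqrtr// lerN2.
have SE k1 s : k1 < 0 -> gsinh k1 s = sin (Num.sqrt (- k1) * s) / Num.sqrt (- k1).
  by move=> k10; rewrite /gsinh ltNge (ltW k10)/= k10.
have CE k1 s : k1 < 0 -> gcosh k1 s = cos (Num.sqrt (- k1) * s).
  by move=> k10; rewrite /gcosh ltNge (ltW k10)/= k10.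
(* Before the faster oscillation has completed a quarter period, cosine is decreasing on both
   arguments, so the derivatives compare and can be integrated. *)
have early s : 0 <= s -> Num.sqrt (- k') * s <= pi / 2 ->
    `|gsinh k' s| <= gsinh k s.
  move=> s0 spi.
  have S0 : 0 <= gsinh k' s.
    rewrite SE// divr_ge0 ?sin_ge0_pi ?(ltW u'0)// mulr_ge0 ?(ltW u'0)//=.
    by rewrite (le_trans spi)// ler_pdivrMr// ler_peMr ?pi_ge0// ler1n.
  rewrite ger0_norm// -subr_ge0.
  have := @is_derive_ge0_le _ (gsinh k \- gsinh k') (fun t => gcosh k t - gcosh k' t) 0 s s0.
  rewrite /= !gsinh0 subrr => H; apply: H.
    by move=> r; apply: is_deriveB; exact: is_derive_gsinh.
  move=> r /andP[r0 rs]; rewrite subr_ge0 !CE// leNgt ltr_cos -?leNgt.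
  - by rewrite ler_wpM2r// ltW.
  - rewrite in_itv/= mulr_ge0 ?(ltW u0) ?(ltW r0)//=.
    rewrite (@le_trans _ _ (Num.sqrt (- k') * s))//; first by rewrite ler_pM ?(ltW u0) ?(ltW r0) ?(ltW rs).
    by rewrite (le_trans spi)// ler_pdivrMr// ler_peMr ?pi_ge0// ler1n.
  - rewrite in_itv/= mulr_ge0 ?(ltW u'0) ?(ltW r0)//=.
    rewrite (@le_trans _ _ (Num.sqrt (- k') * s))//; first by rewrite ler_pM ?(ltW u'0) ?(ltW r0) ?(ltW rs).
    by rewrite (le_trans spi)// ler_pdivrMr// ler_peMr ?pi_ge0// ler1n.
have [/early->//|late] := leP (Num.sqrt (- k') * t) (pi / 2).
(* The first peak of the faster mode. Its value there bounds that mode at all times, and [gsinh k]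
   still increases from [s] to [t] because its phase stays below pi / 2. *)
pose s := pi / 2 / Num.sqrt (- k').
have s0 : 0 <= s by rewrite !divr_ge0 ?pi_ge0 ?(ltW u'0).
have us : Num.sqrt (- k') * s = pi / 2 by rewrite /s mulrC divfK// gt_eqF.
have st : s <= t by rewrite -(ler_pM2l u'0) us ltW.
apply: (@le_trans _ _ `|gsinh k' s|).
  rewrite !SE// us sin_pihalf !normrM ler_wpM2r// normr1; exact: sin_max.
apply: (le_trans (early _ _ _)) => //; first by rewrite us.
rewrite !SE// ler_pM2r ?invr_gt0// leNgt ltr_sin -?leNgt.
- by rewrite ler_pM2l.
- rewrite in_itv/= tpi andbT (@le_trans _ _ 0)// ?oppr_le0 ?divr_ge0 ?pi_ge0//.
  by rewrite mulr_ge0// ltW.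
- rewrite in_itv/= (@le_trans _ _ 0)// ?oppr_le0 ?divr_ge0 ?pi_ge0//=.
    by rewrite (le_trans _ tpi)// ler_pM2l.
  by rewrite mulr_ge0// ltW.
Qed.

End ClosedForms.

(** * Simultaneous recurrence *)

Section Recurrence.
Context {R : realType}.

(* Pigeonhole on the cells of a cubic grid of mesh at most e. *)
Lemma bounded_families_recur (M : nat) (v : nat -> nat -> R) (e : R) :
  (forall i q, `|v i q| <= 1) -> 0 < e ->
  exists q q', (q < q')%N /\ forall i, (i < M)%N -> `|v i q' - v i q| <= e.
Proof.
move=> v1 e0.
pose K := (Num.truncn (e^-1)).+1.
have K0 : 0 < K%:R :> R by rewrite ltr0n.
have Ke : K%:R^-1 <= e.
  by rewrite -[e]invrK lef_pV2 ?posrE ?invr_gt0// ltW// truncnS_gt.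
pose c i q := Num.truncn ((v i q + 1) * K%:R).
have v0 i q : 0 <= (v i q + 1) * K%:R.
  by rewrite mulr_ge0// -lerBlDr sub0r; have := v1 i q; rewrite ler_norml => /andP[].
have cK i q : (c i q < (2 * K).+1)%N.
  have /andP[cle _] := Num.Theory.truncn_itv (v0 i q).
  rewrite -(ltr_nat R) (le_lt_trans cle)//.
  rewrite -natr1 (@le_lt_trans _ _ ((2 * K)%:R))// ?ltrDl// natrM ler_pM2r//.
  by rewrite -lerBrDr (_ : 2 - 1 = 1 :> R); [have := v1 i q; rewrite ler_norml => /andP[]|ring].
(* Each of the M values, shifted into [0, 2], falls into one of 2 K + 1 cells; one index more than
   there are cell patterns forces a collision. *)
pose F (q : 'I_(#|{ffun 'I_M -> 'I_(2 * K).+1}|.+1)) : {ffun 'I_M -> 'I_(2 * K).+1} :=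
  [ffun i : 'I_M => Ordinal (cK i q)].
have : ~~ injectiveb F.
  apply/negP => /injectiveP/leq_card; rewrite card_ord ltnn//.
case/injectivePn => q [q' qq' Fqq'].
have close i (p p' : nat) : c i p = c i p' -> `|v i p' - v i p| <= e.
  move=> cc; apply: le_trans Ke.
  have := Num.Theory.truncn_itv (v0 i p); have := Num.Theory.truncn_itv (v0 i p').
  rewrite -/(c i p) -/(c i p') cc => /andP[h1 h2] /andP[h3 h4].
  rewrite -[leRHS]mul1r ler_pdivlMr// -(ger0_norm (ltW K0)) -normrM ler_norml.
  by rewrite -natr1 in h2 h4; lra.
have FE (i : 'I_M) : c i q = c i q'.
  by move/ffunP/(_ i): Fqq'; rewrite !ffunE => -[].
have [lt|lt|/val_inj E] := ltngtP (val q) (val q'); last by rewrite E eqxx in qq'.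
- by exists q, q'; split=> // i iM; exact: (close i q q' (FE (Ordinal iM))).
- by exists q', q; split=> // i iM; exact: (close i q' q (esym (FE (Ordinal iM)))).
Qed.

(* Two multiples of T have nearly equal phases in all modes of index below M, so
   that the sines are small at their difference; the other modes are small
   because of the factor 1 / sqrt (n ^ 2 - a ^ 2). *)
Lemma gsinh_simultaneously_small (a e T : R) : 0 < a < 1 -> 0 < e -> 0 < T ->
  exists2 t, T <= t & forall n, (0 < n)%N -> `|gsinh (a ^+ 2 - n%:R ^+ 2) t| <= e.
Proof.
move=> /andP[a0 a1] e0 T0.
pose w n : R := Num.sqrt (n%:R ^+ 2 - a ^+ 2).
have n1 n : (0 < n)%N -> 1 <= n%:R :> R by move=> n0; rewrite ler1n.
have k0 n : (0 < n)%N -> 0 < n%:R ^+ 2 - a ^+ 2.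
  by move=> n0; rewrite subr_gt0 ltr_sqr ?nnegrE ?(ltW a0)// (lt_le_trans a1)// n1.
have w0 n : (0 < n)%N -> 0 < w n by move=> n0; rewrite sqrtr_gt0 k0.
have SE n t : (0 < n)%N -> gsinh (a ^+ 2 - n%:R ^+ 2) t = sin (w n * t) / w n.
  move=> n0; have kn : a ^+ 2 - n%:R ^+ 2 < 0 by rewrite -opprB oppr_lt0 k0.
  by rewrite /gsinh ltNge (ltW kn)/= kn opprB.
have ww n : (0 < n)%N -> w 1%N <= w n.
  move=> n0; rewrite ler_wsqrtr// lerD2r ler_sqr ?nnegrE//.
  by rewrite ler_nat.
(* From this index on, n^2 - a^2 >= 1 / e^2, so the factor 1 / w n alone is at most e. *)
pose M := (Num.truncn (e^-1 ^+ 2 + a ^+ 2)).+1.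
have Me n : (M <= n)%N -> e^-1 <= w n.
  move=> Mn; rewrite -[leLHS]gtr0_norm ?invr_gt0// -sqrtr_sqr ler_wsqrtr// lerBrDr.
  apply: le_trans (ltW (truncnS_gt _)) _; rewrite -/M.
  have M1 : (0 < n)%N by exact: leq_trans Mn.
  rewrite (@le_trans _ _ n%:R) ?ler_nat// expr2 ler_peMl//; exact: n1.
(* Even indices carry the cosine and odd ones the sine of mode i / 2: 2 M real numbers record the
   phases of the first M modes at time q T. *)
pose v i q : R := if odd i then sin (w i./2 * (q%:R * T)) else cos (w i./2 * (q%:R * T)).
have v1 i q : `|v i q| <= 1 by rewrite /v; case: ifP => _; [exact: sin_max|exact: cos_max].
(* Two products, each at most d, will add up to e times the smallest frequency, and division by w n
   then leaves at most e. *)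
pose d := e * w 1%N / 2.
have d0 : 0 < d by rewrite divr_gt0// mulr_gt0// w0.
have [q [q' [qq' H]]] := bounded_families_recur (M.*2) v1 d0.
exists ((q' - q)%N%:R * T); first by rewrite ler_peMl ?(ltW T0)// ler1n subn_gt0.
move=> n n0; rewrite SE//.
have wn := w0 n n0.
rewrite normrM [X in _ * X]ger0_norm ?invr_ge0 ?(ltW wn)// ler_pdivrMr//.
have [Mn|nM] := leqP M n.
  rewrite (le_trans (sin_max _))// mulrC -ler_pdivrMr// mul1r.
  exact: Me.
have Hc := H n.*2; have Hs := H n.*2.+1.
rewrite /v odd_double doubleK in Hc.
rewrite /v /= odd_double/= uphalf_double in Hs.
have {}Hc := Hc _; have {}Hs := Hs _.
have -> : w n * ((q' - q)%N%:R * T) = w n * (q'%:R * T) - w n * (q%:R * T).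
  by rewrite natrB ?(ltnW qq')//; ring.
rewrite sinB; set x' := w n * (q'%:R * T); set x := w n * (q%:R * T).
have -> : sin x' * cos x - cos x' * sin x = (sin x' - sin x) * cos x - (cos x' - cos x) * sin x by ring.
rewrite (le_trans (ler_normB _ _))// !normrM.
have b1 : `|sin x' - sin x| * `|cos x| <= d.
  rewrite -[leRHS]mulr1 ler_pM// ?cos_max//; by apply: Hs; rewrite ltn_Sdouble.
have b2 : `|cos x' - cos x| * `|sin x| <= d.
  rewrite -[leRHS]mulr1 ler_pM// ?sin_max//; by apply: Hc; rewrite ltn_double.
apply: (le_trans (lerD b1 b2)).
rewrite /d -splitr ler_pM2l//; exact: ww.
Qed.

End Recurrence.

(** * The flow on a Fourier mode *)

Section Mode.
Context {R : realType}.
Variables (a : R) (n : nat).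
Implicit Types (v : bool -> R * R) (y : bool) (x t h : R).

Local Notation k := (a ^+ 2 - n%:R ^+ 2).

Definition wave v y x : R := (v y).1 * cos (n%:R * x) + (v y).2 * sin (n%:R * x).

(** n times this function is the derivative of [wave v y] in x. *)
Definition wave' v y x : R := (v y).2 * cos (n%:R * x) - (v y).1 * sin (n%:R * x).

(* exp (t L_a) on the n-th Fourier mode; (cosine, sine) coefficients. *)
Definition mode_flow t v : bool -> R * R := fun y =>
  (expR (- a * t) * (gcosh k t * (v y).1 + sgn y * n%:R * gsinh k t * (v y).2
     + a * gsinh k t * (v (~~ y)).1),
   expR (- a * t) * (gcosh k t * (v y).2 - sgn y * n%:R * gsinh k t * (v y).1
     + a * gsinh k t * (v (~~ y)).2)).

Definition coef_norm v : R :=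
  (`|(v true).1| + `|(v true).2|) + (`|(v false).1| + `|(v false).2|).

Lemma coef_normE y v : coef_norm v =
  (`|(v y).1| + `|(v y).2|) + (`|(v (~~ y)).1| + `|(v (~~ y)).2|).
Proof. by case: y; rewrite // addrC. Qed.

Lemma sqr_sgn y : sgn y * sgn y = 1 :> R.
Proof. by rewrite /sgn -expr2 sqrr_sign. Qed.

Lemma sgn_neg y : sgn (~~ y) = - sgn y :> R.
Proof. by rewrite /sgn signrN. Qed.

Lemma norm_sgn y : `|sgn y| = 1 :> R.
Proof. by rewrite /sgn normr_sign. Qed.

(** Read on functions, the flow is e^(-at) (C f + S M f), where M f = y f' + a f (., -y) is L_a + a.
    The cross terms of M^2 cancel because y changes sign, so M^2 acts as a^2 - n^2. *)
Lemma wave_flow t v y x : wave (mode_flow t v) y x =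
  expR (- a * t) * (gcosh k t * wave v y x + sgn y * n%:R * gsinh k t * wave' v y x
     + a * gsinh k t * wave v (~~ y) x).
Proof. by rewrite /wave /wave' /=; ring. Qed.

Lemma mode_flowD s t v : mode_flow (s + t) v = mode_flow t (mode_flow s v).
Proof.
apply/funext => y; rewrite /mode_flow /= negbK gsinhD gcoshD (mulrDr (- a) s t) expRD.
have ss := sqr_sgn y; rewrite sgn_neg.
by congr pair => /=; ring: ss.
Qed.

Lemma mode_flow0 v : mode_flow 0 v = v.
Proof.
apply/funext => y; rewrite /mode_flow gsinh0 gcosh0 mulr0 expR0.
by rewrite !(mulr0, mul0r, addr0, subr0, mul1r) -surjective_pairing.
Qed.

Lemma wave_shift h v y b x : wave v y (x + h * sgn b) =
  cos (n%:R * h) * wave v y x + sgn b * sin (n%:R * h) * wave' v y x.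
Proof.
rewrite /wave /wave' mulrDr cosD sinD; case: b; rewrite /sgn ?expr1 ?expr0.
  by rewrite mulrN1 mulrN cosN sinN; ring.
by rewrite mulr1; ring.
Qed.

Lemma norm_wave v y x : `|wave v y x| <= `|(v y).1| + `|(v y).2|.
Proof.
rewrite (le_trans (ler_normD _ _))// !normrM lerD//.
  by rewrite ler_piMr// cos_max.
by rewrite ler_piMr// sin_max.
Qed.

Lemma norm_wave' v y x : `|wave' v y x| <= `|(v y).1| + `|(v y).2|.
Proof.
rewrite (le_trans (ler_normB _ _))// !normrM addrC lerD//.
  by rewrite ler_piMr// sin_max.
by rewrite ler_piMr// cos_max.
Qed.

Hypothesis a0 : 0 < a.

(** As k <= a^2, the functions C and S are dominated by cosh (a t) and sinh (a t) / a, whose growth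
    e^(-at) absorbs. A bound uniform in t is what the error estimate over many steps requires. *)
Lemma mode_flow_bounded v : exists2 M, 0 <= M &
  forall t, 0 <= t -> coef_norm (mode_flow t v) <= M.
Proof.
have ka : k <= a ^+ 2 by rewrite lerBlDr lerDl sqr_ge0.
have E1 t : 0 <= t -> expR (- (a * t)) <= expR (a * t).
  by move=> t0; rewrite ler_expR ge0_cp// mulr_ge0// ltW.
have EE t : expR (- a * t) * expR (a * t) = 1 by rewrite -expRD mulNr addNr expR0.
have a2 : 0 < a ^+ 2 by rewrite exprn_gt0.
have sa : Num.sqrt (a ^+ 2) = a by rewrite sqrtr_sqr gtr0_norm.
have bC t : 0 <= t -> expR (- a * t) * `|gcosh k t| <= 1.
  move=> t0; rewrite -[leRHS](EE t) ler_wpM2l ?expR_ge0//.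
  rewrite (le_trans (norm_gcosh_le (ltW a2) ka t0))// /gcosh a2 sa.
  rewrite ler_pdivrMr// mulr_natr mulr2n lerD2l; exact: E1.
have bS t : 0 <= t -> expR (- a * t) * `|gsinh k t| <= a^-1.
  move=> t0; rewrite -[leRHS]mul1r -[X in _ <= X * _](EE t) -mulrA ler_wpM2l ?expR_ge0//.
  rewrite (le_trans (norm_gsinh_le (ltW a2) ka t0))// /gsinh a2 sa.
  rewrite ler_pdivrMr ?mulr_gt0// (_ : _ / a * _ = expR (a * t) *+ 2); last first.
    by rewrite -mulr_natr; field; rewrite gt_eqF.
  by rewrite mulr2n lerD2l; have := expR_ge0 (-(a*t)); have := expR_ge0 (a*t); lra.
pose B (y : bool) : R := `|(v y).1| + `|(v y).2|.
have B0 y : 0 <= B y by rewrite addr_ge0.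
pose c := 1 + (n%:R / a + 1).
exists (4 * c * (B true + B false)).
  by rewrite !mulr_ge0 ?addr_ge0 ?divr_ge0 ?(ltW a0).
move=> t t0.
have bnd y s (u1 u2 u3 : R) : `|s| = 1 -> `|u1| <= B y -> `|u2| <= B y -> `|u3| <= B (~~ y) ->
   `|expR (- a * t) * (gcosh k t * u1 + s * n%:R * gsinh k t * u2 + a * gsinh k t * u3)| <=
   c * (B true + B false).
  move=> s1 h1 h2 h3.
  rewrite normrM [X in X * _]ger0_norm ?expR_ge0//.
  apply: (@le_trans _ _ (expR (- a * t) * `|gcosh k t| * `|u1| + n%:R * (expR (- a * t) * `|gsinh k t|) * `|u2| + a * (expR (- a * t) * `|gsinh k t|) * `|u3|)).
    rewrite -!mulrA ![_ * (expR _ * _)]mulrCA -!mulrDr ler_wpM2l ?expR_ge0//.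
    rewrite (le_trans (ler_normD _ _))// lerD//; last by rewrite !normrM (gtr0_norm a0).
    by rewrite (le_trans (ler_normD _ _))// !normrM s1 mul1r normr_nat.
  have BB : B y + B (~~ y) = B true + B false by case: (y) => //=; rewrite addrC.
  rewrite -BB.
  have g1 : expR (- a * t) * `|gcosh k t| * `|u1| <= B y.
    by rewrite -[leRHS]mul1r ler_pM ?mulr_ge0 ?expR_ge0// bC.
  have g2 : n%:R * (expR (- a * t) * `|gsinh k t|) * `|u2| <= n%:R / a * B y.
    by rewrite ler_pM ?mulr_ge0 ?expR_ge0// ler_wpM2l// bS.
  have g3 : a * (expR (- a * t) * `|gsinh k t|) * `|u3| <= B (~~ y).
    rewrite -[leRHS]mul1r ler_pM ?mulr_ge0 ?expR_ge0 ?(ltW a0)//.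
    by rewrite mulrC -ler_pdivlMr// div1r bS.
  have g4 : 0 <= n%:R / a * B (~~ y) by rewrite !mulr_ge0 ?invr_ge0 ?(ltW a0).
  have := B0 y; have := B0 (~~ y); rewrite /c; lra.
have B1 y : `|(v y).1| <= B y by rewrite lerDl.
have B2 y : `|(v y).2| <= B y by rewrite lerDr.
have q y : `|(mode_flow t v y).1| <= c * (B true + B false) /\ `|(mode_flow t v y).2| <= c * (B true + B false).
  split; first exact: (bnd y (sgn y) _ _ _ (norm_sgn y) (B1 y) (B2 y) (B1 (~~ y))).
  have s1 : `|- sgn y| = 1 :> R by rewrite normrN norm_sgn.
  have := bnd y (- sgn y) _ _ _ s1 (B2 y) (B1 y) (B2 (~~ y)).
  have -> // : - sgn y * n%:R * gsinh k t * (v y).1 = - (sgn y * n%:R * gsinh k t * (v y).1).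
  by rewrite !mulNr.
have [q1 q2] := q true; have [q3 q4] := q false.
rewrite /coef_norm -mulrA; lra.
Qed.

End Mode.

Lemma is_derive_slope_right {R : realType} (f : R -> R) (l : R) :
  is_derive (0 : R) 1 f l -> (f h - f 0) / h @[h --> 0^'+] --> l.
Proof.
case=> df <-.
have H : h^-1 *: ((f \o shift 0) (h *: (1 : R)) - f 0) @[h --> 0^'] --> 'D_1 f 0 by [].
have := cvg_dnbhs_at_right H.
apply: cvg_trans; apply: near_eq_cvg; near=> h.
by rewrite /= /GRing.scale /= addr0 mulr1 mulrC.
Unshelve. all: by end_near.
Qed.

(** * One step of the sampled chain against the flow of a mode *)

Section TwoStateKernel.
Context {R : realType}.
Variables (a : R) (a0 : 0 < a) (p : R -> bool -> bool -> R).
Hypothesis p_ge0 : forall h y b, 0 <= h -> 0 <= p h y b.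
Hypothesis p_sum : forall h y, 0 <= h -> p h y y + p h y (~~ y) = 1.
Hypothesis p_rate : forall y, p h y (~~ y) / h @[h --> 0^'+] --> a.

(** The displacement uses the velocity at the end of the step, so that iterating the step produces
    Riemann sums at right endpoints. *)
Definition kernel_step h (F : bool -> R -> R) : bool -> R -> R := fun y x =>
  p h y y * F y (x + h * sgn y) + p h y (~~ y) * F (~~ y) (x + h * sgn (~~ y)).

Lemma norm_kernel_step h F B : 0 <= h -> (forall y x, `|F y x| <= B) ->
  forall y x, `|kernel_step h F y x| <= B.
Proof.
move=> h0 FB y x; rewrite (le_trans (ler_normD _ _))// !normrM.
rewrite !(ger0_norm (p_ge0 _ _ h0)) -[leRHS]mul1r -(p_sum y h0) mulrDl.
by rewrite lerD// ler_wpM2l// p_ge0.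
Qed.

Lemma kernel_stepB h F G : kernel_step h (fun y x => F y x - G y x) =
  fun y x => kernel_step h F y x - kernel_step h G y x.
Proof. by apply/funext => y; apply/funext => x; rewrite /kernel_step; ring. Qed.

Variable n : nat.
Local Notation k := (a ^+ 2 - n%:R ^+ 2).

(** Both the step and the flow send a wave to a combination of [wave] and [wave'] in the states y
    and -y. These are the differences of the four coefficients; the flow has none on [wave'] in the
    state -y. *)
Definition step_defect h y : R :=
  `|p h y y * cos (n%:R * h) - expR (- a * h) * gcosh k h| +
  `|p h y y * sin (n%:R * h) - expR (- a * h) * (n%:R * gsinh k h)| +
  `|p h y (~~ y) * cos (n%:R * h) - expR (- a * h) * (a * gsinh k h)| +
  `|p h y (~~ y) * sin (n%:R * h)|.

Lemma kernel_step_wave h v y x :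
  `|kernel_step h (wave n v) y x - wave n (mode_flow a n h v) y x| <=
  step_defect h y * coef_norm v.
Proof.
rewrite wave_flow /kernel_step !wave_shift sgn_neg.
set c := cos _; set s := sin _; set E := expR _; set C := gcosh _ _; set S := gsinh _ _.
set q := p h y y; set q' := p h y (~~ y).
set w1 := wave n v y x; set w1' := wave' n v y x.
set w2 := wave n v (~~ y) x; set w2' := wave' n v (~~ y) x.
have -> : q * (c * w1 + sgn y * s * w1') + q' * (c * w2 + - sgn y * s * w2') - E * (C * w1 + sgn y * n%:R * S * w1' + a * S * w2) =
  (q * c - E * C) * w1 + sgn y * (q * s - E * (n%:R * S)) * w1' + (q' * c - E * (a * S)) * w2 + - (sgn y * (q' * s) * w2') by ring.
have nn := coef_normE y v.
have N1 : 0 <= `|(v y).1| + `|(v y).2| by rewrite addr_ge0.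
have N2 : 0 <= `|(v (~~ y)).1| + `|(v (~~ y)).2| by rewrite addr_ge0.
have u1 : `|w1| <= coef_norm v by rewrite (le_trans (norm_wave _ _ _ _))// nn lerDl.
have u1' : `|w1'| <= coef_norm v by rewrite (le_trans (norm_wave' _ _ _ _))// nn lerDl.
have u2 : `|w2| <= coef_norm v by rewrite (le_trans (norm_wave _ _ _ _))// nn lerDr.
have u2' : `|w2'| <= coef_norm v by rewrite (le_trans (norm_wave' _ _ _ _))// nn lerDr.
rewrite /step_defect -/c -/s -/E -/C -/S -/q -/q'.
have T4 (x1 x2 x3 x4 : R) : `|x1 + x2 + x3 + x4| <= `|x1| + `|x2| + `|x3| + `|x4|.
  by do 2! rewrite (le_trans (ler_normD _ _))// lerD//; exact: ler_normD.
have e4 : `|- (sgn y * (q' * s) * w2')| <= `|q' * s| * coef_norm v.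
  by rewrite normrN !normrM norm_sgn mul1r ler_wpM2l// mulr_ge0.
have e3 : `|(q' * c - E * (a * S)) * w2| <= `|q' * c - E * (a * S)| * coef_norm v.
  by rewrite normrM ler_wpM2l.
have e2 : `|sgn y * (q * s - E * (n%:R * S)) * w1'| <= `|q * s - E * (n%:R * S)| * coef_norm v.
  by rewrite !normrM norm_sgn mul1r ler_wpM2l.
have e1 : `|(q * c - E * C) * w1| <= `|q * c - E * C| * coef_norm v.
  by rewrite normrM ler_wpM2l.
apply: le_trans (T4 _ _ _ _) _; apply: le_trans (lerD (lerD (lerD e1 e2) e3) e4) _.
by rewrite -!mulrDl.
Qed.

(** Telescoping: the error already made passes through one more step without growing, and the new
    error is the defect times the size of the flowed coefficients, at most [M]. *)
Lemma iter_kernel_step_wave N h v M : 0 <= h ->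
  (forall t, 0 <= t -> coef_norm (mode_flow a n t v) <= M) ->
  forall y x, `|iter N (kernel_step h) (wave n v) y x - wave n (mode_flow a n (N%:R * h) v) y x| <=
  N%:R * (step_defect h true + step_defect h false) * M.
Proof.
move=> h0 vM.
have D0 y : 0 <= step_defect h y by rewrite !addr_ge0.
elim: N => [|N IH] y x.
  by rewrite /= mul0r mode_flow0 subrr normr0 !mul0r.
have Nh : 0 <= N%:R * h by rewrite mulr_ge0.
rewrite iterS.
set F := iter N _ _ in IH *.
pose G := wave n (mode_flow a n (N%:R * h) v).
have -> : N.+1%:R * h = N%:R * h + h by rewrite -natr1 mulrDl mul1r.
rewrite mode_flowD.
set G' := wave n _ y x.
have -> : kernel_step h F y x - G' =
   kernel_step h (fun y x => F y x - G y x) y x + (kernel_step h G y x - G').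
  by rewrite kernel_stepB; ring.
rewrite (le_trans (ler_normD _ _))// -natr1 mulrDl mulrDl lerD//.
  exact: norm_kernel_step.
rewrite mul1r (le_trans (kernel_step_wave _ _ _ _))// ler_pM ?addr_ge0//; last exact: vM.
by case: (y); rewrite ?lerDl ?lerDr.
Qed.

(** Since the jump probability is a h + o(h) and the other one is its complement, in each of the
    first three terms the two products agree at 0 to first order; the last term is a product of two
    quantities of order h. *)
Lemma step_defect_negligible y : step_defect h y / h @[h --> 0^'+] --> (0 : R).
Proof.
have right0 (f : R -> R) l : continuous f -> f 0 = l -> f h @[h --> 0^'+] --> l.
  by move=> cf <-; apply: cvg_at_right_filter; exact: cf.
have dE : is_derive (0 : R) 1 (fun h => expR (- a * h)) (- a).
  apply: (is_derive_eq (is_derive_scale (is_derive_expR (- a * 0)))).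
  by rewrite mulr0 expR0 mulr1.
have dcos : is_derive (0 : R) 1 (fun h => cos (n%:R * h)) 0.
  apply: (is_derive_eq (is_derive_scale (is_derive_cos (n%:R * 0)))).
  by rewrite mulr0 sin0 oppr0 mulr0.
have dsin : is_derive (0 : R) 1 (fun h => sin (n%:R * h)) n%:R.
  apply: (is_derive_eq (is_derive_scale (is_derive_sin (n%:R * 0)))).
  by rewrite mulr0 cos0 mulr1.
have dC := is_derive_gcosh k 0; rewrite gsinh0 mulr0 in dC.
have dS := is_derive_gsinh k 0; rewrite gcosh0 in dS.
have {}sE := is_derive_slope_right dE; rewrite mulr0 expR0 in sE.
have {}scos := is_derive_slope_right dcos; rewrite mulr0 cos0 in scos.
have {}ssin := is_derive_slope_right dsin; rewrite mulr0 sin0 in ssin.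
have {}sC := is_derive_slope_right dC; rewrite gcosh0 in sC.
have {}sS := is_derive_slope_right dS; rewrite gsinh0 in sS.
have clin (c : R) : continuous (fun h : R => c * h).
  by move=> h; apply: cvgM; [exact: cvg_cst|exact: cvg_id].
have ccos : cos (n%:R * h) @[h --> 0^'+] --> (1 : R).
  apply: right0; last by rewrite mulr0 cos0.
  by move=> h; apply: continuous_comp; [exact: clin|exact: continuous_cos].
have csin : sin (n%:R * h) @[h --> 0^'+] --> (0 : R).
  apply: right0; last by rewrite mulr0 sin0.
  by move=> h; apply: continuous_comp; [exact: clin|exact: continuous_sin].
have cE : expR (- a * h) @[h --> 0^'+] --> (1 : R).
  apply: right0; last by rewrite mulr0 expR0.
  by move=> h; apply: continuous_comp; [exact: clin|exact: continuous_expR].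
have cC : gcosh k h @[h --> 0^'+] --> (1 : R).
  by apply: right0; [exact: continuous_gcosh|exact: gcosh0].
have cid : h @[h --> 0^'+] --> (0 : R).
  by apply: cvg_at_right_filter; exact: cvg_id.
have cq := p_rate y.
have H1 : - (p h y (~~ y) / h) * cos (n%:R * h) + (cos (n%:R * h) - 1) / h
   - ((expR (- a * h) - 1) / h * gcosh k h + (gcosh k h - 1) / h) @[h --> 0^'+] --> - a * 1 + 0 - (- a * 1 + 0).
  apply: cvgB; [apply: (cvgD _ scos)|apply: (cvgD _ sC)]; apply: cvgM => //; exact: cvgN.
rewrite (_ : - a * 1 + 0 - (- a * 1 + 0) = 0) in H1; last by ring.
have H2 : (1 - p h y (~~ y) / h * h) * ((sin (n%:R * h) - 0) / h)
   - expR (- a * h) * (n%:R * ((gsinh k h - 0) / h)) @[h --> 0^'+] --> (1 - a * 0) * n%:R - 1 * (n%:R * 1).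
  apply: cvgB; apply: cvgM => //.
    by apply: cvgB; [exact: cvg_cst|exact: cvgM].
  by apply: cvgM => //; exact: cvg_cst.
rewrite (_ : (1 - a * 0) * n%:R - 1 * (n%:R * 1) = 0) in H2; last by ring.
have H3 : p h y (~~ y) / h * cos (n%:R * h) - expR (- a * h) * (a * ((gsinh k h - 0) / h))
    @[h --> 0^'+] --> a * 1 - 1 * (a * 1).
  apply: cvgB; apply: cvgM => //.
  by apply: cvgM => //; exact: cvg_cst.
rewrite (_ : a * 1 - 1 * (a * 1) = 0) in H3; last by ring.
have H4 : p h y (~~ y) / h * sin (n%:R * h) @[h --> 0^'+] --> a * 0.
  exact: cvgM.
rewrite mulr0 in H4.
have L (f1 f2 f3 f4 : R -> R) : f1 h @[h --> 0^'+] --> (0 : R) ->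
    f2 h @[h --> 0^'+] --> (0 : R) -> f3 h @[h --> 0^'+] --> (0 : R) ->
    f4 h @[h --> 0^'+] --> (0 : R) ->
    `|f1 h| + `|f2 h| + `|f3 h| + `|f4 h| @[h --> 0^'+] --> (0 : R).
  have N0 (f : R -> R) : f h @[h --> 0^'+] --> (0 : R) -> `|f h| @[h --> 0^'+] --> (0 : R).
    by move/cvg_norm; rewrite normr0.
  move=> /N0 h1 /N0 h2 /N0 h3 /N0 h4.
  have : `|f1 h| + `|f2 h| + `|f3 h| + `|f4 h| @[h --> 0^'+] --> (0 : R) + 0 + 0 + 0.
    by apply: (cvgD _ h4); apply: (cvgD _ h3); exact: (cvgD h1 h2).
  by rewrite !addr0.
have H := L _ _ _ _ H1 H2 H3 H4.
apply: cvg_trans H; apply: near_eq_cvg; near=> h.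
have h0 : 0 < h by [].
have nd (u : R) : `|u| / h = `|u / h|.
  by rewrite normrM [X in _ = _ * X]ger0_norm// invr_ge0 ltW.
have e4 (x1 x2 x3 x4 : R) : (x1 + x2 + x3 + x4) / h = x1 / h + x2 / h + x3 / h + x4 / h by ring.
rewrite /step_defect e4 !nd.
have -> : p h y y = 1 - p h y (~~ y) by rewrite -(p_sum y (ltW h0)) addrK.
have hn0 : h != 0 by rewrite gt_eqF.
congr (_ + _ + _ + _); congr (`|_|); by field.
Unshelve. all: by end_near.
Qed.

End TwoStateKernel.

(** * The sampled chain and its continuous limit *)

Section BoundedIntegral.
Context d (T : measurableType d) {R : realType}.

Lemma finite_bounded_integrable (mu : {measure set T -> \bar R}) (f : T -> R)
    (K : R) (D : set T) : measurable D -> (mu D < +oo)%E ->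
  measurable_fun D f -> (forall w, `|f w| <= K) -> mu.-integrable D (EFin \o f).
Proof.
move=> mD Dfin mf fK; apply: measurable_bounded_integrable => //.
exists K; split; first exact: num_real.
by move=> M KM w _ /=; rewrite (le_trans (fK w))// ltW.
Qed.

Lemma bounded_integrable (P : probability T R) (f : T -> R) (K : R) (D : set T) :
  measurable D -> measurable_fun D f -> (forall w, `|f w| <= K) ->
  P.-integrable D (EFin \o f).
Proof.
move=> mD mf fK; apply: (finite_bounded_integrable mD _ mf fK).
by rewrite (le_lt_trans (probability_le1 _ mD))// ltry.
Qed.

Lemma measurable_bool_case (g : T -> bool) (f : bool -> T -> R) :
  measurable_fun setT g -> (forall b, measurable_fun setT (f b)) ->
  measurable_fun setT (fun w => f (g w) w).
Proof.
move=> mg mf.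
rewrite (_ : (fun _ => _) = fun w => if g w then f true w else f false w).
  by apply: measurable_fun_ifT.
by apply/funext => w; case: (g w).
Qed.

End BoundedIntegral.

Section Paths.
Context {R : realType} d (Omega : measurableType d).
Variables (Pr : bool -> probability Omega R) (Y : R -> Omega -> bool).
Variable p : R -> bool -> bool -> R.
Hypothesis mY : forall t, 0 <= t -> measurable_fun setT (Y t).
Hypothesis fdd : forall (n : nat) (t : nat -> R) (s : nat -> bool),
  t 0%N = 0 -> (forall i, (i < n)%N -> t i <= t i.+1) ->
  Pr (s 0%N) [set w | forall i, (i <= n)%N -> Y (t i) w = s i] =
  (\prod_(i < n) p (t i.+1 - t i) (s i) (s i.+1))%:E.

Lemma measurable_state t b : 0 <= t -> measurable (Y t @^-1` [set b]).
Proof. by move=> t0; rewrite -[X in measurable X]setTI; exact: mY. Qed.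

Definition cylinder h m (s : nat -> bool) : set Omega :=
  [set w | forall i, (i <= m)%N -> Y (i%:R * h) w = s i].

Lemma cylinder0 h s : cylinder h 0 s = Y 0 @^-1` [set s 0%N].
Proof.
apply/seteqP; split => w /=; first by move/(_ 0%N (leqnn _)); rewrite mul0r.
by move=> ws i; rewrite leqn0 => /eqP ->; rewrite mul0r.
Qed.

Lemma cylinderS h m s :
  cylinder h m.+1 s = cylinder h m s `&` Y (m.+1%:R * h) @^-1` [set s m.+1].
Proof.
apply/seteqP; split => w /=.
  by move=> ws; split => [i im|]; apply: ws => //; exact: leqW.
by move=> [ws wm] i; rewrite leq_eqVlt ltnS => /predU1P[->//|]; exact: ws.
Qed.

Lemma measurable_cylinder h m s : 0 <= h -> measurable (cylinder h m s).
Proof.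
move=> h0; elim: m => [|m IH]; first by rewrite cylinder0; exact: measurable_state.
rewrite cylinderS; apply: measurableI => //; apply: measurable_state.
by rewrite mulr_ge0.
Qed.

Lemma cylinder_prob h m s : 0 <= h ->
  Pr (s 0%N) (cylinder h m s) = (\prod_(i < m) p h (s i) (s i.+1))%:E.
Proof.
move=> h0; rewrite (fdd (t := fun i => i%:R * h)) ?mul0r//.
  by congr (_%:E); apply: eq_bigr => i _; rewrite -mulrBl -natr1 addrAC subrr add0r mul1r.
by move=> i _; rewrite ler_wpM2r// ler_nat.
Qed.

Lemma start_prob y : Pr y (Y 0 @^-1` [set y]) = 1%E.
Proof. by rewrite -(cylinder0 0 (fun=> y)) (cylinder_prob _ (fun=> y)) ?big_ord0. Qed.

(** Nothing is assumed of [p] beyond the finite-dimensional laws and the rate, so positivity and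
    total mass are read off the probabilities of one-step cylinders. *)
Lemma transition_ge0 h y b : 0 <= h -> 0 <= p h y b.
Proof.
move=> h0; have := cylinder_prob 1 (fun i => if i == 0%N then y else b) h0.
by rewrite big_ord_recl big_ord0 mulr1/= -lee_fin => <-; exact: measure_ge0.
Qed.

Lemma transition_sum h y : 0 <= h -> p h y y + p h y (~~ y) = 1.
Proof.
move=> h0; pose s b := fun i : nat => if i == 0%N then y else b.
have H b : Pr y (cylinder h 1 (s b)) = (p h y b)%:E.
  by rewrite (cylinder_prob 1 (s b) h0) big_ord_recl big_ord0 mulr1.
apply: EFin_inj; rewrite EFinD -!H -measureU; last 3 first.
- exact: measurable_cylinder.
- exact: measurable_cylinder.
- apply/seteqP; split => // w [/= /(_ 1%N (leqnn _)) + /(_ 1%N (leqnn _))].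
  by rewrite /s /= => -> ; case: (y).
rewrite -(start_prob y); congr (Pr y _); apply/seteqP; split => w /=.
  by move=> [] /(_ 0%N isT); rewrite mul0r.
move=> wy; have [E|E] := eqVneq (Y (1%:R * h) w) y; [left|right] => -[|[|//]] _.
- by rewrite mul0r.
- by rewrite E.
- by rewrite mul0r.
- by move: E; rewrite /s/=; case: (Y _ w) (y) => -[].
Qed.

Variables (h : R) (F : bool -> R -> R) (K : R).
Hypothesis h0 : 0 <= h.
Hypothesis mF : forall b, measurable_fun setT (F b).
Hypothesis FK : forall b x, `|F b x| <= K.

(** Displacement of the sampled chain between the times m h and (m + r) h; the offset m makes the
    induction of [cylinder_expectation] possible. *)
Definition discrete_walk m r (w : Omega) : R :=
  h * \sum_(i < r) sgn (Y ((m + i).+1%:R * h) w).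

Lemma measurable_sgn t : 0 <= t -> measurable_fun setT (fun w => sgn (Y t w) : R).
Proof.
move=> t0; apply: (@measurable_bool_case _ _ R (Y t) (fun b _ => sgn b)).
- exact: mY.
- by move=> b; exact: measurable_cst.
Qed.

Lemma measurable_discrete_walk m r : measurable_fun setT (discrete_walk m r).
Proof.
apply: measurable_funM; first exact: measurable_cst.
by apply: measurable_sum => i; apply: measurable_sgn; rewrite mulr_ge0.
Qed.

Lemma measurable_observable t (x : R) (g : Omega -> R) : 0 <= t ->
  measurable_fun setT g ->
  measurable_fun setT (fun w => F (Y t w) (x + g w)).
Proof.
move=> t0 mg; apply: (@measurable_bool_case _ _ R (Y t) (fun b w => F b (x + g w))).
  exact: mY.
move=> b; apply: measurableT_comp; first exact: mF.
by apply: measurable_funD => //; exact: measurable_cst.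
Qed.

(** The Markov property without conditional expectations: by induction on the number r of remaining
    steps, for every past of length m, the cylinder is cut according to the next state, and each
    piece is a cylinder with a longer past. *)
Lemma cylinder_expectation r : forall m s x,
  Rintegral (Pr (s 0%N)) (cylinder h m s)
    (fun w => F (Y ((m + r)%:R * h) w) (x + discrete_walk m r w)) =
  (\prod_(i < m) p h (s i) (s i.+1)) * iter r (kernel_step p h) F (s m) x.
Proof.
have h1 n : 0 <= n%:R * h by rewrite mulr_ge0.
elim: r => [|r IH] m s x.
  transitivity (Rintegral (Pr (s 0%N)) (cylinder h m s) (fun=> F (s m) x)).
    apply: eq_Rintegral => w; rewrite inE => /(_ m (leqnn _)).
    by rewrite addn0 => ->; rewrite /discrete_walk big_ord0 mulr0 addr0.
  rewrite Rintegral_cst; last exact: measurable_cylinder.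
  rewrite mulrC; congr (_ * _).
  exact: (congr1 fine (cylinder_prob m s h0)).
(* The past [s] prolonged by the state [b] at step m + 1. *)
pose s' b := fun i => if (i <= m)%N then s i else b.
have s'0 b : s' b 0%N = s 0%N by [].
have cs b : cylinder h m.+1 (s' b) = cylinder h m s `&` Y (m.+1%:R * h) @^-1` [set b].
  rewrite cylinderS /s' ltnn; congr (_ `&` _); apply/seteqP; split => w ws i im; have := ws i im; by rewrite im.
have -> : cylinder h m s = cylinder h m.+1 (s' true) `|` cylinder h m.+1 (s' false).
  rewrite !cs -setIUr; apply/seteqP; split => w; last by case.
  by move=> ws; split => //=; case: (Y _ w); [left|right].
have mY1 := measurable_observable x (h1 (m + r.+1)%N) (measurable_discrete_walk m r.+1).
rewrite Rintegral_setU; last 4 first.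
- exact: measurable_cylinder.
- exact: measurable_cylinder.
- apply: bounded_integrable => //; first by apply: measurableU; exact: measurable_cylinder.
    exact: measurable_funTS.
- apply/disj_setPS => w; rewrite !cs /= => -[[_ ->] [_]]; by [].
have piece b : Rintegral (Pr (s 0%N)) (cylinder h m.+1 (s' b))
    (fun w => F (Y ((m + r.+1)%:R * h) w) (x + discrete_walk m r.+1 w)) =
  \prod_(i < m) p h (s i) (s i.+1) * (p h (s m) b * iter r (kernel_step p h) F b (x + h * sgn b)).
  rewrite -(s'0 b).
  transitivity (Rintegral (Pr (s' b 0%N)) (cylinder h m.+1 (s' b))
    (fun w => F (Y ((m.+1 + r)%:R * h) w) (x + h * sgn b + discrete_walk m.+1 r w))).
    apply: eq_Rintegral => w; rewrite inE cs => -[_ /= wb].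
    rewrite addnS -addSn; congr (F _ _).
    rewrite /discrete_walk big_ord_recl addn0 wb mulrDr addrA.
    by congr (_ + _ * _); apply: eq_bigr => i _; rewrite addnS -addSn.
  rewrite IH big_ord_recr/= /s' leqnn ltnn mulrA.
  congr (_ * _ * _); apply: eq_bigr => i _.
  by rewrite (ltnW (ltn_ord i)) (ltn_ord i).
rewrite !piece -mulrDr; congr (_ * _); rewrite iterS /kernel_step.
by case: (s m) => //=; rewrite addrC.
Qed.

(** The cylinder of length 0 has probability 1, so its complement contributes nothing. *)
Lemma discrete_expectation r y x :
  Rintegral (Pr y) setT (fun w => F (Y (r%:R * h) w) (x + discrete_walk 0 r w)) =
  iter r (kernel_step p h) F y x.
Proof.
have rh : 0 <= r%:R * h by rewrite mulr_ge0.
have := cylinder_expectation r 0 (fun=> y) x.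
rewrite big_ord0 mul1r add0n => <-.
have mO := measurable_observable x rh (measurable_discrete_walk 0 r).
have mC := measurable_cylinder 0 (fun=> y) h0.
rewrite -[in LHS](setUv (cylinder h 0 (fun=> y))).
have iO D : measurable D -> (Pr y).-integrable D
   (EFin \o (fun w => F (Y (r%:R * h) w) (x + discrete_walk 0 r w))).
  move=> mD; apply: bounded_integrable => //; exact: measurable_funTS.
rewrite Rintegral_setU//; last 3 first.
- exact: measurableC.
- by apply: iO; rewrite setUv.
- by apply/disj_setPS; rewrite setICr.
rewrite [X in _ + X](_ : _ = 0) ?addr0//.
have N0 : Pr y (~` cylinder h 0 (fun=> y)) = 0%E.
  by rewrite probability_setC// cylinder0 start_prob subee.
rewrite /Rintegral null_set_integral//; first exact: measurableC.
exact: (measurable_int (Pr y) (iO _ (measurableC mC))).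
Qed.

End Paths.

(** * Riemann sums of the velocity along a right-continuous path *)

Section Occupation.
Context {R : realType}.
Local Notation leb := (@lebesgue_measure R).

Lemma itvoc_measure (a b : R) : a <= b -> leb `]a, b] = (b - a)%:E.
Proof.
move=> ab; rewrite lebesgue_measure_itv/= lte_fin.
by move: ab; rewrite le_eqVlt => /predU1P[->|->]; rewrite ?ltxx ?subrr.
Qed.

Lemma itvoc_measure_lty (a b : R) : a <= b -> (leb `]a, b] < +oo)%E.
Proof. by move=> ab; rewrite itvoc_measure// ltry. Qed.

Lemma mesh_cell (s h : R) : 0 < s -> 0 < h ->
  exists k : nat, k%:R * h < s <= k.+1%:R * h.
Proof.
move=> s0 h0.
have ex : exists m : nat, s <= m%:R * h.
  exists (Num.truncn (s / h)).+1; rewrite -ler_pdivrMr// ltW//; exact: truncnS_gt.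
case: (ex_minnP ex) => -[|k] sk kmin.
  by rewrite mul0r leNgt s0 in sk.
exists k; rewrite sk andbT ltNge; apply/negP => /kmin.
by rewrite ltnn.
Qed.

Lemma mesh_cell_uniq (s h : R) (i k : nat) : 0 < h ->
  k%:R * h < s <= k.+1%:R * h -> i%:R * h < s <= i.+1%:R * h -> i = k.
Proof.
move=> h0 /andP[k1 k2] /andP[i1 i2]; apply/eqP; rewrite eqn_leq.
have := lt_le_trans i1 k2; have := lt_le_trans k1 i2.
by rewrite !ltr_pM2r// !ltr_nat !ltnS => -> ->.
Qed.

Variables (f : R -> bool) (t : R).
Hypothesis t0 : 0 < t.
Hypothesis rcf : forall s, 0 <= s -> \forall u \near s^'+, f u = f s.

Let step N := t / N.+1%:R.

Let step_gt0 N : 0 < step N.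
Proof. by rewrite divr_gt0// ltr0n. Qed.

Let cell N k : set R := `](k%:R * step N), (k.+1%:R * step N)].

Definition riemann_step N (s : R) : R :=
  \sum_(k < N.+1) sgn (f (k.+1%:R * step N)) * \1_(cell N k) s.

Let cell_meas N k : measurable (cell N k).
Proof. exact: measurable_itv. Qed.

Lemma measurable_riemann_step N : measurable_fun setT (riemann_step N).
Proof.
apply: measurable_sum => k; apply: measurable_funM; first exact: measurable_cst.
exact: measurable_indic.
Qed.

Lemma riemann_stepE N s k : k%:R * step N < s <= k.+1%:R * step N ->
  (k < N.+1)%N -> riemann_step N s = sgn (f (k.+1%:R * step N)).
Proof.
move=> sk kN; rewrite /riemann_step (bigD1 (Ordinal kN))//= big1 ?addr0.
  by rewrite indicE mem_set ?mulr1//= in_itv.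
move=> i ik; rewrite indicE memNset ?mulr0// /cell /= in_itv /=; apply/negP.
apply: contra ik => si; apply/eqP/val_inj.
exact: (mesh_cell_uniq (step_gt0 N) sk si).
Qed.

Lemma cell_of N s : 0 < s <= t -> exists2 k : nat,
  (k < N.+1)%N & k%:R * step N < s <= k.+1%:R * step N.
Proof.
move=> /andP[s0 st]; have [k /andP[k1 k2]] := mesh_cell s0 (step_gt0 N).
exists k; last by rewrite k1.
have := lt_le_trans k1 st; rewrite /step mulrA ltr_pdivrMr ?ltr0n//.
by rewrite mulrC ltr_pM2l// ltr_nat.
Qed.

Lemma norm_riemann_step N s : 0 < s <= t -> `|riemann_step N s| <= 1.
Proof.
move=> st; have [k kN sk] := cell_of N st.
by rewrite (riemann_stepE sk kN) norm_sgn.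
Qed.

(** The sample attached to [s] is taken at the right end of its cell, hence at or after [s] and at
    distance less than the mesh: right continuity is exactly what is needed. *)
Lemma cvg_riemann_step s : 0 < s <= t ->
  riemann_step N s @[N --> \oo] --> (sgn (f s) : R).
Proof.
move=> st; have s0 : 0 < s by case/andP: st.
have /= := rcf (ltW s0); rewrite /at_right/= => -[e /= e0 He].
apply/cvgrPdist_lt => eps eps0; near=> N.
suff -> : riemann_step N s = sgn (f s) by rewrite subrr normr0.
have [k kN sk] := cell_of N st.
rewrite (riemann_stepE sk kN); congr sgn.
case/andP: sk => k1; rewrite le_eqVlt => /predU1P[<-//|k2].
apply: He => //=; rewrite distrC gtr0_norm ?subr_gt0//.
have : step N < e.
  rewrite /step ltr_pdivrMr ?ltr0n// mulrC -ltr_pdivrMr//.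
  near: N; exists (Num.truncn (t / e)) => //= N tN.
  by rewrite (lt_le_trans (truncnS_gt _))// ler_nat.
have : k.+1%:R * step N = k%:R * step N + step N by rewrite -natr1 mulrDl mul1r.
lra.
Unshelve. all: by end_near.
Qed.

Lemma measurable_path : measurable_fun `]0, t] (fun s => sgn (f s) : R).
Proof.
apply: (@measurable_fun_cvg _ _ _ `]0, t]%classic riemann_step) => //.
- by move=> N; apply: measurable_funTS; exact: measurable_riemann_step.
- by move=> s /=; rewrite in_itv; exact: cvg_riemann_step.
Qed.

Lemma path_integrable : leb.-integrable `]0, t] (EFin \o (fun s => sgn (f s) : R)).
Proof.
apply: (@finite_bounded_integrable _ _ _ _ _ 1).
- exact: measurable_itv.
- exact/itvoc_measure_lty/ltW.
- exact: measurable_path.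
- by move=> w; rewrite norm_sgn.
Qed.

Lemma integral_riemann_step N :
  Rintegral leb `]0, t] (riemann_step N) =
  step N * \sum_(k < N.+1) sgn (f (k.+1%:R * step N)).
Proof.
have mI : measurable (`]0, t]%classic : set (measurableTypeR R)) by exact: measurable_itv.
have Ifin : (leb `]0%R, t] < +oo)%E by exact/itvoc_measure_lty/ltW.
have ib (g : R -> R) (K : R) : measurable_fun setT g -> (forall w, `|g w| <= K) ->
    leb.-integrable `]0, t] (EFin \o g).
  by move=> mg gK; apply: (@finite_bounded_integrable _ _ _ leb g K _ mI Ifin _ gK); exact: measurable_funTS.
have i1 k : leb.-integrable `]0, t] (EFin \o (\1_(cell N k) : R -> R)).
  apply: (ib _ 1); first exact: measurable_indic.
  by move=> w; rewrite indicE; case: (_ \in _); rewrite ?normr1 ?normr0.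
have ci k : (k < N.+1)%N -> Rintegral leb `]0, t] (\1_(cell N k)) = step N.
  move=> kN; transitivity (fine (leb (cell N k `&` `]0, t]%classic))).
    have E := @integral_indic _ _ _ leb _ mI (cell N k) (cell_meas N k).
    exact: (congr1 fine E).
  rewrite setIidl.
    rewrite /cell itvoc_measure.
      by rewrite /= -mulrBl -natr1 addrAC subrr add0r mul1r.
    by rewrite ler_pM2r// ler_nat.
  move=> s; rewrite /cell /= !in_itv/= => /andP[s1 s2]; apply/andP; split.
    by rewrite (le_lt_trans _ s1)// mulr_ge0// ltW.
  apply: (le_trans s2); rewrite /step mulrA ler_pdivrMr ?ltr0n// mulrC ler_pM2l//.
  by rewrite ler_nat.
rewrite mulr_sumr /riemann_step.
suff H m : (m <= N.+1)%N -> leb.-integrable `]0, t] (EFin \o (fun s => \sum_(k < m) sgn (f (k.+1%:R * step N)) * \1_(cell N k) s : R)) /\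
   Rintegral leb `]0, t] (fun s => \sum_(k < m) sgn (f (k.+1%:R * step N)) * \1_(cell N k) s) =
   \sum_(k < m) step N * sgn (f (k.+1%:R * step N)) by have [_ ->] := H N.+1 (leqnn _).
elim: m => [_|m IH mN].
  rewrite big_ord0; split.
    rewrite (_ : (fun s => _) = cst 0); last by apply/funext => s; rewrite big_ord0.
    by apply: (ib _ 0) => [|w]; [exact: measurable_cst|rewrite normr0].
  by under eq_Rintegral do rewrite big_ord0; rewrite Rintegral_cst// mul0r.
have [IH1 IH2] := IH (ltnW mN).
have im : leb.-integrable `]0, t] (EFin \o (fun s => sgn (f (m.+1%:R * step N)) * \1_(cell N m) s : R)).
  apply: (ib _ 1).
    by apply: measurable_funM; [exact: measurable_cst|exact: measurable_indic].
  by move=> w; rewrite normrM norm_sgn mul1r indicE; case: (_ \in _); rewrite ?normr1 ?normr0.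
split.
  have := integrableD mI IH1 im; congr (leb.-integrable _ _).
  by apply/funext => s /=; rewrite big_ord_recr.
rewrite big_ord_recr/= -IH2.
transitivity (Rintegral leb `]0, t] (fun s =>
    \sum_(k < m) sgn (f (k.+1%:R * step N)) * \1_(cell N k) s +
    sgn (f (m.+1%:R * step N)) * \1_(cell N m) s)).
  by apply: eq_Rintegral => s _; rewrite big_ord_recr.
by rewrite RintegralD// RintegralZl// ci// [step N * _]mulrC.
Qed.

Lemma riemann_sum_cvg :
  step N * \sum_(k < N.+1) sgn (f (k.+1%:R * step N)) @[N --> \oo] -->
  Rintegral leb `[0, t] (fun s => sgn (f s)).
Proof.
(* The origin belongs to no cell, and dropping it does not change the integral. *)
rewrite -Rintegral_itv_obnd_cbnd; last exact: path_integrable.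
under eq_fun do rewrite -integral_riemann_step.
have mI : measurable (`]0, t]%classic : set (measurableTypeR R)) by exact: measurable_itv.
have Ifin : (leb `]0%R, t] < +oo)%E by exact/itvoc_measure_lty/ltW.
have fin := integrable_fin_num mI path_integrable.
apply: fine_cvg; rewrite (fineK fin).
have [] := @dominated_convergence _ _ _ leb _ mI (fun N s => (riemann_step N s)%:E)
  (EFin \o (fun s => sgn (f s))) (EFin \o (fun=> 1)).
- by move=> N; apply/measurable_EFinP/measurable_funTS; exact: measurable_riemann_step.
- by apply/measurable_EFinP; exact: measurable_path.
- apply: aeW => s /=; rewrite in_itv => st.
  by apply: cvg_EFin; [exact: nearW|exact: cvg_riemann_step].
- by apply: (@finite_bounded_integrable _ _ _ leb _ 1) => // w; rewrite normr1.
- by apply: aeW => s N /=; rewrite in_itv lee_fin; exact: norm_riemann_step.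
- by [].
Qed.

End Occupation.

(** * Passage to continuous time *)

Section FlipChain.
Context {R : realType} d (Omega : measurableType d).
Variables (Pr : bool -> probability Omega R) (Y : R -> Omega -> bool).
Variable a : R.
Hypothesis a0 : 0 < a.
Hypothesis hY : flip_chain Pr Y a.
Local Notation leb := (@lebesgue_measure R).

(** The increment X_t - X_0: time spent with velocity 1 minus time spent with velocity -1. *)
Definition occupation t (w : Omega) : R :=
  Rintegral leb `[0, t] (fun s => sgn (Y s w)).

Lemma occupation_cvg t w : 0 < t ->
  discrete_walk Y (t / N.+1%:R) 0 N.+1 w @[N --> \oo] --> occupation t w.
Proof.
by move=> t0; exact: (riemann_sum_cvg t0 (flip_right_continuous hY w)).
Qed.

Lemma occupation0 w : occupation 0 w = 0.
Proof. by rewrite /occupation set_itv1 Rintegral_set1. Qed.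

Lemma measurable_occupation t : 0 <= t -> measurable_fun setT (occupation t).
Proof.
rewrite le_eqVlt => /predU1P[<-|t0].
  rewrite (_ : occupation 0 = cst 0); first exact: measurable_cst.
  by apply/funext => w; exact: occupation0.
apply: (@measurable_fun_cvg _ _ _ setT (fun N => discrete_walk Y (t / N.+1%:R) 0 N.+1)) => //.
  move=> N; apply: measurable_discrete_walk; first exact: flip_measurable hY.
  by rewrite divr_ge0// ltW.
by move=> w _; exact: occupation_cvg.
Qed.

Lemma continuous_wave n (v : bool -> R * R) y : continuous (wave n v y).
Proof.
have cl : continuous (fun x : R => n%:R * x).
  by move=> x; apply: cvgM; [exact: cvg_cst|exact: cvg_id].
move=> x; apply: cvgD; apply: cvgM; try exact: cvg_cst.
  by apply: continuous_comp; [exact: cl|exact: continuous_cos].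
by apply: continuous_comp; [exact: cl|exact: continuous_sin].
Qed.

Lemma wave_bound n (v : bool -> R * R) y x : `|wave n v y x| <= coef_norm v.
Proof.
by rewrite (le_trans (norm_wave _ _ _ _))// (coef_normE y) lerDl addr_ge0.
Qed.

Lemma measurable_wave n (v : bool -> R * R) y : measurable_fun setT (wave n v y).
Proof. apply: continuous_measurable_fun; exact: continuous_wave. Qed.

(** With h = t / (N + 1) the accumulated error is (N + 1) times the defect, that is t times defect /
    h, up to the constant [M]. *)
Lemma iter_wave_cvg p n v t y x : 0 < t ->
  (forall h y b, 0 <= h -> 0 <= p h y b) ->
  (forall h y, 0 <= h -> p h y y + p h y (~~ y) = 1) ->
  (forall y, p h y (~~ y) / h @[h --> 0^'+] --> a) ->
  iter N.+1 (kernel_step p (t / N.+1%:R)) (wave n v) y x @[N --> \oo] -->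
  wave n (mode_flow a n t v) y x.
Proof.
move=> t0 p0 p1 pr.
have [M M0 vM] := mode_flow_bounded n a0 v.
pose D h := step_defect a p n h true + step_defect a p n h false.
have cD : (D h / h) * M * t @[h --> 0^'+] --> (0 : R).
  have : (D h / h) * M * t @[h --> 0^'+] --> (0 + 0) * M * t.
    apply: cvgM; last exact: cvg_cst.
    apply: cvgM; last exact: cvg_cst.
    rewrite (_ : (fun _ => _) = fun h => step_defect a p n h true / h + step_defect a p n h false / h); last first.
      by apply/funext => h; rewrite /D mulrDl.
    by apply: cvgD; exact: step_defect_negligible.
  by rewrite addr0 !mul0r.
have ht N : 0 < t / N.+1%:R by rewrite divr_gt0// ltr0n.
have c0 : t / N.+1%:R @[N --> \oo] --> (0 : R).
  by rewrite -[X in _ --> X](mulr0 t); apply: cvgM; [exact: cvg_cst|exact: cvg_harmonic].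
apply/cvgrPdist_le => e e0.
have /cvgrPdist_le/(_ e e0) := (cvg_at_rightP _ _ _).1 cD _ (conj ht c0).
apply: filterS => N /=; rewrite sub0r normrN => HN.
rewrite distrC -[X in mode_flow a n X v](_ : N.+1%:R * (t / N.+1%:R) = t); last first.
  by rewrite mulrC divfK.
apply: le_trans (iter_kernel_step_wave p0 p1 N.+1 (ltW (ht N)) vM y x) _.
apply: le_trans HN; apply: le_trans (ler_norm _).
rewrite le_eqVlt; apply/orP; left; apply/eqP; rewrite /D; field.
by rewrite (gt_eqF t0) nat1r pnatr_eq0.
Qed.

(** Both sides are limits of the same discrete expectations: one by the kernel estimate, the other
    by dominated convergence, since waves are bounded and continuous. *)
Lemma wave_expectation n v t y x : 0 <= t ->
  Rintegral (Pr y) setT (fun w => wave n v (Y t w) (x + occupation t w)) =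
  wave n (mode_flow a n t v) y x.
Proof.
have [p [fdd prate]] := flip_transition hY.
have mY := flip_measurable hY.
have fdd' m (s : nat -> R) b : s 0%N = 0 -> (forall i, (i < m)%N -> s i <= s i.+1) ->
    Pr (b 0%N) [set w | forall i, (i <= m)%N -> Y (s i) w = b i] =
    (\prod_(i < m) p (s i.+1 - s i) (b i) (b i.+1))%:E by exact: fdd.
rewrite le_eqVlt => /predU1P[<-|t0].
  rewrite mode_flow0 -[RHS](discrete_expectation mY fdd' (lexx 0) (measurable_wave n v) (wave_bound n v) 0 y x).
  apply: eq_Rintegral => w _.
  by rewrite occupation0 mul0r /discrete_walk mul0r.
have c1 := @iter_wave_cvg p n v t y x t0 (transition_ge0 fdd') (transition_sum mY fdd') prate.
have mO : measurable_fun setT (fun w => wave n v (Y t w) (x + occupation t w)).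
  apply: measurable_observable => //; [exact: measurable_wave|exact: ltW|].
  by apply: measurable_occupation; exact: ltW.
have ht N : 0 <= t / N.+1%:R by rewrite divr_ge0// ltW.
have tN N : N.+1%:R * (t / N.+1%:R) = t by rewrite mulrC divfK.
have c2 : Rintegral (Pr y) setT (fun w => wave n v (Y t w) (x + discrete_walk Y (t / N.+1%:R) 0 N.+1 w)) @[N --> \oo] -->
   Rintegral (Pr y) setT (fun w => wave n v (Y t w) (x + occupation t w)).
  have iO : (Pr y).-integrable setT (EFin \o (fun w => wave n v (Y t w) (x + occupation t w))).
    by apply: bounded_integrable mO _ => //; move=> w; exact: wave_bound.
  have fin := integrable_fin_num measurableT iO.
  apply: fine_cvg; rewrite (fineK fin).
  have [] := @dominated_convergence _ _ _ (Pr y) _ measurableT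
    (fun N w => (wave n v (Y t w) (x + discrete_walk Y (t / N.+1%:R) 0 N.+1 w))%:E)
    (EFin \o (fun w => wave n v (Y t w) (x + occupation t w))) (EFin \o (fun=> coef_norm v)).
  - move=> N; apply/measurable_EFinP; apply: measurable_observable => //.
    + exact: measurable_wave.
    + exact: ltW.
    + exact: measurable_discrete_walk.
  - exact/measurable_EFinP.
  - apply: aeW => w _; apply: cvg_EFin; first exact: nearW.
    apply: (@cvg_comp _ _ _ (fun N => x + discrete_walk Y (t / N.+1%:R) 0 N.+1 w) (wave n v (Y t w)) _ (nbhs (x + occupation t w))).
      by apply: cvgD; [exact: cvg_cst|exact: occupation_cvg].
    exact: continuous_wave.
  - by apply: (@bounded_integrable _ _ _ _ _ (coef_norm v)) => // w; rewrite ger0_norm// !addr_ge0.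
  - by apply: aeW => w N _; rewrite lee_fin; exact: wave_bound.
  - by [].
rewrite (_ : (fun _ => _) = fun N => iter N.+1 (kernel_step p (t / N.+1%:R)) (wave n v) y x) in c2.
  exact: (cvg_unique _ c2 c1).
apply/funext => N.
by rewrite -(discrete_expectation mY fdd' (ht N) (measurable_wave n v) (wave_bound n v)) tN.
Qed.

End FlipChain.

(** * Density of trigonometric polynomials *)

Section TrigPoly.
Context {R : realType}.
Implicit Types f g : R -> R.

Inductive trig_poly : (R -> R) -> Prop :=
| trig_poly_cos (n : nat) : trig_poly (fun x => cos (n%:R * x))
| trig_poly_sin (n : nat) : trig_poly (fun x => sin (n%:R * x))
| trig_polyD f g : trig_poly f -> trig_poly g -> trig_poly (fun x => f x + g x)
| trig_polyZ (c : R) f : trig_poly f -> trig_poly (fun x => c * f x).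

Lemma trig_poly_ext f g : f =1 g -> trig_poly f -> trig_poly g.
Proof. by move=> /funext ->. Qed.

Lemma trig_poly_cst (c : R) : trig_poly (fun=> c).
Proof.
apply: trig_poly_ext (trig_polyZ c (trig_poly_cos 0)) => x.
by rewrite mul0r cos0 mulr1.
Qed.

Lemma trig_polyB f g : trig_poly f -> trig_poly g -> trig_poly (fun x => f x - g x).
Proof.
move=> hf hg; apply: trig_poly_ext (trig_polyD hf (trig_polyZ (-1) hg)) => x.
by rewrite mulN1r.
Qed.

Lemma trig_poly_cosB (m n : nat) : trig_poly (fun x => cos ((m%:R - n%:R) * x)).
Proof.
have [nm|/ltnW mn] := leqP n m.
  by apply: trig_poly_ext (trig_poly_cos (m - n)) => x; rewrite natrB.
apply: trig_poly_ext (trig_poly_cos (n - m)) => x.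
by rewrite natrB// -cosN -mulNr opprB.
Qed.

Lemma trig_poly_sinB (m n : nat) : trig_poly (fun x => sin ((m%:R - n%:R) * x)).
Proof.
have [nm|/ltnW mn] := leqP n m.
  by apply: trig_poly_ext (trig_poly_sin (m - n)) => x; rewrite natrB.
apply: trig_poly_ext (trig_polyZ (-1) (trig_poly_sin (n - m))) => x.
by rewrite natrB// mulN1r -sinN -mulNr opprB.
Qed.

Lemma trig_poly_mul_cos (m : nat) g : trig_poly g -> trig_poly (fun x => cos (m%:R * x) * g x).
Proof.
elim=> {g} [n|n|f g _ hf _ hg|c f _ hf].
- apply: trig_poly_ext (trig_polyZ (2^-1) (trig_polyD (trig_poly_cos (m + n)) (trig_poly_cosB m n))) => x.
  by rewrite natrD mulrDl mulrBl cosD cosB; field.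
- apply: trig_poly_ext (trig_polyZ (2^-1) (trig_polyB (trig_poly_sin (m + n)) (trig_poly_sinB m n))) => x.
  by rewrite natrD mulrDl mulrBl sinD sinB; field.
- by apply: trig_poly_ext (trig_polyD hf hg) => x; ring.
- by apply: trig_poly_ext (trig_polyZ c hf) => x; ring.
Qed.

Lemma trig_poly_mul_sin (m : nat) g : trig_poly g -> trig_poly (fun x => sin (m%:R * x) * g x).
Proof.
elim=> {g} [n|n|f g _ hf _ hg|c f _ hf].
- apply: trig_poly_ext (trig_polyZ (2^-1) (trig_polyD (trig_poly_sin (m + n)) (trig_poly_sinB m n))) => x.
  by rewrite natrD mulrDl mulrBl sinD sinB; field.
- apply: trig_poly_ext (trig_polyZ (2^-1) (trig_polyB (trig_poly_cosB m n) (trig_poly_cos (m + n)))) => x.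
  by rewrite natrD (mulrBl x m%:R) (mulrDl m%:R) cosB cosD; field.
- by apply: trig_poly_ext (trig_polyD hf hg) => x; ring.
- by apply: trig_poly_ext (trig_polyZ c hf) => x; ring.
Qed.

Lemma trig_polyM f g : trig_poly f -> trig_poly g -> trig_poly (fun x => f x * g x).
Proof.
move=> + hg; elim=> {f} [n|n|f1 f2 _ hf1 _ hf2|c f _ hf].
- exact: trig_poly_mul_cos.
- exact: trig_poly_mul_sin.
- by apply: trig_poly_ext (trig_polyD hf1 hf2) => x; ring.
- by apply: trig_poly_ext (trig_polyZ c hf) => x; ring.
Qed.

Lemma trig_polyX f n : trig_poly f -> trig_poly (fun x => f x ^+ n).
Proof.
move=> hf; elim: n => [|n IH]; first exact: trig_poly_cst.
by apply: trig_poly_ext (trig_polyM hf IH) => x; rewrite exprS.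
Qed.

Lemma trig_poly_continuous f : trig_poly f -> continuous f.
Proof.
have cl (n : nat) : continuous (fun x : R => n%:R * x).
  by move=> x; apply: cvgM; [exact: cvg_cst|exact: cvg_id].
elim=> {f} [n|n|f g _ hf _ hg|c f _ hf] x.
- by apply: continuous_comp; [exact: cl|exact: continuous_cos].
- by apply: continuous_comp; [exact: cl|exact: continuous_sin].
- by apply: cvgD; [exact: hf|exact: hg].
- by apply: cvgM; [exact: cvg_cst|exact: hf].
Qed.

Lemma trig_poly_measurable f : trig_poly f -> measurable_fun setT f.
Proof. by move=> /trig_poly_continuous; exact: continuous_measurable_fun. Qed.

Lemma trig_poly_bounded f : trig_poly f -> exists K, forall x, `|f x| <= K.
Proof.
elim=> {f} [n|n|f g _ [K hK] _ [L hL]|c f _ [K hK]].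
- by exists 1 => x; exact: cos_max.
- by exists 1 => x; exact: sin_max.
- by exists (K + L) => x; rewrite (le_trans (ler_normD _ _))// lerD.
- by exists (`|c| * K) => x; rewrite normrM ler_wpM2l.
Qed.

(** The expansion is asserted for every length beyond N, padded with zeros, so that two polynomials
    can be expanded over a common range. *)
Lemma trig_poly_sumE f : trig_poly f ->
  exists N (c : nat -> R * R), (forall n, (N <= n)%N -> c n = 0) /\
  forall M, (N <= M)%N -> forall x,
    f x = \sum_(n < M) ((c n).1 * cos (n%:R * x) + (c n).2 * sin (n%:R * x)).
Proof.
have single (m : nat) (q : R * R) M x : (m < M)%N ->
  \sum_(n < M) ((if n == m :> nat then q else 0).1 * cos (n%:R * x) +
    (if n == m :> nat then q else 0).2 * sin (n%:R * x)) =
  q.1 * cos (m%:R * x) + q.2 * sin (m%:R * x).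
  move=> mM; rewrite (bigD1 (Ordinal mM))//= eqxx big1 ?addr0//.
  by move=> i; rewrite -val_eqE/= => /negbTE ->; rewrite !mul0r addr0.
elim=> {f} [m|m|f g _ [N1 [c1 [z1 h1]]] _ [N2 [c2 [z2 h2]]]|k f _ [N [c [z h]]]].
- exists m.+1, (fun n => if n == m then (1, 0) else 0); split.
    by move=> n mn; rewrite gtn_eqF.
  by move=> M mM x; rewrite single// mul1r mul0r addr0.
- exists m.+1, (fun n => if n == m then (0, 1) else 0); split.
    by move=> n mn; rewrite gtn_eqF.
  by move=> M mM x; rewrite single// mul1r mul0r add0r.
- exists (maxn N1 N2), (fun n => ((c1 n).1 + (c2 n).1, (c1 n).2 + (c2 n).2)); split.
    by move=> n; rewrite geq_max => /andP[/z1 -> /z2 ->]; rewrite !addr0.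
  move=> M; rewrite geq_max => /andP[N1M N2M] x.
  rewrite (h1 M)// (h2 M)// -big_split; apply: eq_bigr => n _ /=.
  by rewrite !mulrDl addrACA.
- exists N, (fun n => (k * (c n).1, k * (c n).2)); split.
    by move=> n /z ->; rewrite !mulr0.
  move=> M NM x; rewrite (h M)// mulr_sumr; apply: eq_bigr => n _ /=.
  by rewrite mulrDr !mulrA.
Qed.

End TrigPoly.

Section Density.
Context {R : realType}.
Local Notation leb := (@lebesgue_measure R).
Local Notation I := (`[(0 : R), 2 * pi]%classic : set (measurableTypeR R)).

Definition sqint (f : R -> R) : \bar R := (\int[leb]_(x in I) ((f x) ^+ 2)%:E)%E.

Lemma mI : measurable I. Proof. exact: measurable_itv. Qed.

Lemma leb_I : leb I = (2 * pi)%:E.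
Proof. by rewrite lebesgue_measure_itv/= lte_fin two_pi_gt0 -EFinB subr0. Qed.

Lemma leb_I_lty : (leb I < +oo)%E. Proof. by rewrite leb_I ltry. Qed.

Lemma measurable_sqr (f : R -> R) : measurable_fun setT f ->
  measurable_fun I (fun x => ((f x) ^+ 2)%:E).
Proof. by move=> mf; apply/measurable_EFinP/measurable_funTS/measurable_funX. Qed.

Lemma sqint_ge0 f : (0 <= sqint f)%E.
Proof. by apply: integral_ge0 => x _; rewrite lee_fin sqr_ge0. Qed.

Lemma le_sqint (f g : R -> R) : measurable_fun setT f -> measurable_fun setT g ->
  (forall x, `|f x| <= `|g x|) -> (sqint f <= sqint g)%E.
Proof.
move=> mf mg fg; apply: ge0_le_integral => //; try exact: measurable_sqr.
- by move=> x _; rewrite lee_fin sqr_ge0.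
- by move=> x _; rewrite lee_fin -(real_normK (num_real (f x))) -(real_normK (num_real (g x))) ler_sqr ?nnegrE.
Qed.

Lemma sqintZ (c : R) f : measurable_fun setT f -> sqint (fun x => c * f x)%R = ((c ^+ 2)%:E * sqint f)%E.
Proof.
move=> mf; rewrite /sqint -ge0_integralZl//; last 3 first.
- exact: measurable_sqr.
- by move=> x _; rewrite lee_fin sqr_ge0.
- by rewrite lee_fin sqr_ge0.
by apply: eq_integral => x _; rewrite exprMn EFinM.
Qed.

Lemma sqintD_le (f g : R -> R) : measurable_fun setT f -> measurable_fun setT g ->
  (sqint (fun x => f x + g x)%R <= 2%:E * sqint f + 2%:E * sqint g)%E.
Proof.
move=> mf mg; rewrite /sqint.
have n0 (h : R -> R) x : I x -> (0 <= ((h x) ^+ 2)%:E)%E by rewrite lee_fin sqr_ge0.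
have n2 (h : R -> R) x : I x -> (0 <= 2%:E * ((h x) ^+ 2)%:E)%E.
  by move=> _; rewrite -EFinM lee_fin mulr_ge0// sqr_ge0.
have m2 (h : R -> R) : measurable_fun setT h -> measurable_fun I (fun x => 2%:E * ((h x) ^+ 2)%:E)%E.
  by move=> mh; apply: emeasurable_funM; [exact: measurable_cst|exact: measurable_sqr].
rewrite -!ge0_integralZl//; try exact: mI; try exact: measurable_sqr; try exact: n0; try by rewrite lee_fin.
rewrite -ge0_integralD//; try exact: mI; try exact: n2; try exact: m2.
apply: ge0_le_integral => //; try exact: mI; try exact: n0.
- by apply: measurable_sqr; exact: measurable_funD.
- by apply: emeasurable_funD; exact: m2.
- move=> x _; rewrite -!EFinM -EFinD lee_fin.
  have := sqr_ge0 (f x - g x); rewrite !expr2; lra.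
Qed.

Definition trig_approx (f : R -> R) := measurable_fun setT f /\
  forall e, 0 < e -> exists2 p, trig_poly p & (sqint (fun x => f x - p x)%R <= e%:E)%E.

Lemma trig_approx_poly p : trig_poly p -> trig_approx p.
Proof.
move=> hp; split; first exact: trig_poly_measurable.
move=> e e0; exists p => //; under eq_fun do rewrite subrr.
by rewrite /sqint; under eq_integral do rewrite expr0n/=; rewrite integral0 lee_fin ltW.
Qed.

Lemma trig_approxZ c f : trig_approx f -> trig_approx (fun x => c * f x).
Proof.
move=> [mf hf]; split; first by apply: measurable_funM => //; exact: measurable_cst.
move=> e e0.
have c0 : 0 < c ^+ 2 + 1 by rewrite ltr_wpDl// sqr_ge0.
have [p hp fp] := hf (e / (c ^+ 2 + 1)) (divr_gt0 e0 c0).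
exists (fun x => c * p x); first exact: trig_polyZ.
under eq_fun do rewrite -mulrBr.
rewrite sqintZ; last by apply: measurable_funB => //; exact: trig_poly_measurable.
apply: (@le_trans _ _ ((c ^+ 2)%:E * (e / (c ^+ 2 + 1))%:E)%E).
  by apply: lee_wpmul2l => //; rewrite lee_fin sqr_ge0.
rewrite -EFinM lee_fin mulrA ler_pdivrMr// mulrC ler_wpM2l ?(ltW e0)//.
by rewrite lerDl.
Qed.

Lemma trig_approxD f g : trig_approx f -> trig_approx g -> trig_approx (fun x => f x + g x).
Proof.
move=> [mf hf] [mg hg]; split; first exact: measurable_funD.
move=> e e0; have e4 : 0 < e / 4 by rewrite divr_gt0.
have [p hp fp] := hf _ e4; have [q hq gq] := hg _ e4.
exists (fun x => p x + q x); first exact: trig_polyD.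
under eq_fun do rewrite opprD addrACA.
have mp := trig_poly_measurable hp; have mq := trig_poly_measurable hq.
apply: le_trans (sqintD_le _ _) _; try exact: measurable_funB.
apply: (@le_trans _ _ (2%:E * (e / 4)%:E + 2%:E * (e / 4)%:E)%E).
  by apply: leeD; apply: lee_wpmul2l => //; rewrite lee_fin.
by rewrite -!EFinM -EFinD lee_fin; lra.
Qed.

Lemma trig_approxB f g : trig_approx f -> trig_approx g -> trig_approx (fun x => f x - g x).
Proof.
move=> hf hg; have := trig_approxD hf (trig_approxZ (-1) hg).
by under eq_fun do rewrite mulN1r.
Qed.

Lemma trig_approx_closed (f : R -> R) : measurable_fun setT f ->
  (forall e, 0 < e -> exists2 g, trig_approx g & (sqint (fun x => f x - g x)%R <= e%:E)%E) ->
  trig_approx f.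
Proof.
move=> mf H; split => // e e0; have e4 : 0 < e / 4 by rewrite divr_gt0.
have [g [mg hg] fg] := H _ e4; have [p hp gp] := hg _ e4.
exists p => //; have mp := trig_poly_measurable hp.
have -> : (fun x => f x - p x) = (fun x => (f x - g x) + (g x - p x)).
  by apply/funext => x; rewrite addrA subrK.
apply: le_trans (sqintD_le _ _) _; try exact: measurable_funB.
apply: (@le_trans _ _ (2%:E * (e / 4)%:E + 2%:E * (e / 4)%:E)%E).
  by apply: leeD; apply: lee_wpmul2l => //; rewrite lee_fin.
by rewrite -!EFinM -EFinD lee_fin; lra.
Qed.

(** Dominated convergence for the squared errors, followed by closedness of the class in L^2. *)
Lemma trig_approx_lim (f : R -> R) (g : nat -> R -> R) (G : R -> R) :
  measurable_fun setT f -> (forall n, trig_approx (g n)) ->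
  measurable_fun setT G -> (\int[leb]_(x in I) (G x)%:E < +oo)%E ->
  (forall n x, (f x - g n x) ^+ 2 <= G x) ->
  {ae leb, forall x, I x -> g n x @[n --> \oo] --> f x} -> trig_approx f.
Proof.
move=> mf ag mG Gfin gG gf; apply: trig_approx_closed => // e e0.
have G0 x : 0 <= G x by rewrite (le_trans _ (gG 0%N x))// sqr_ge0.
have iG : leb.-integrable I (EFin \o G).
  apply/integrableP; split; first exact/measurable_EFinP/measurable_funTS.
  by under eq_integral do rewrite /= ger0_norm ?G0//.
have mfg n : measurable_fun I (fun x => ((f x - g n x) ^+ 2)%:E).
  by apply: measurable_sqr; apply: measurable_funB => //; have [] := ag n.
have gf' : {ae leb, forall x, I x -> ((f x - g n x) ^+ 2)%:E @[n --> \oo] --> (EFin \o (fun=> 0 : R)) x}.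
  apply: filterS gf => x gx Ix; apply: cvg_EFin; first exact: nearW.
  have {}gx := gx Ix.
  have : (f x - g n x) * (f x - g n x) @[n --> \oo] --> (f x - f x) * (f x - f x).
    by apply: cvgM; apply: cvgB => //; exact: cvg_cst.
  by rewrite subrr mulr0.
have m0 : measurable_fun I (EFin \o (fun=> 0 : R)) by exact/measurable_EFinP/measurable_cst.
have dom : {ae leb, forall x n, I x -> (`|((f x - g n x) ^+ 2)%:E| <= (EFin \o G) x)%E}.
  by apply: aeW => x n _; rewrite /= lee_fin ger0_norm ?sqr_ge0.
have [_ _] := @dominated_convergence _ _ _ leb _ mI _ _ (EFin \o G) mfg m0 gf' iG dom.
rewrite integral0 => /fine_cvgP[fin /cvgrPdist_le/(_ e e0)].
case: fin => N1 _ H1 [N2 _ H2]; exists (g (maxn N1 N2)); first exact: ag.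
have := H1 (maxn N1 N2) (leq_maxl _ _); have := H2 (maxn N1 N2) (leq_maxr _ _).
rewrite /= sub0r normrN => le fin.
rewrite (_ : sqint _ = (fine (sqint (fun x => f x - g (maxn N1 N2) x)%R))%:E); last by rewrite fineK.
rewrite lee_fin; exact: le_trans (ler_norm _) le.
Qed.

End Density.

Section StepApproximation.
Context {R : realType}.
Local Notation leb := (@lebesgue_measure R).
Local Notation I := (`[(0 : R), 2 * pi]%classic : set (measurableTypeR R)).

Lemma bernoulli_inequality (u : R) n : 0 <= u <= 1 -> 1 - n%:R * u <= (1 - u) ^+ n.
Proof.
move=> /andP[u0 u1]; elim: n => [|n IH]; first by rewrite mul0r subr0.
have v0 : 0 <= 1 - u by rewrite subr_ge0.
rewrite exprS; apply: le_trans (ler_wpM2l v0 IH).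
rewrite -subr_ge0 (_ : _ - _ = n%:R * u ^+ 2).
  by rewrite mulr_ge0// sqr_ge0.
by rewrite -natr1; ring.
Qed.

Lemma cvg_geometric0 (q : R) : 0 <= q < 1 -> q ^+ n @[n --> \oo] --> (0 : R).
Proof. by move=> /andP[q0 q1]; apply: cvg_expr; rewrite ger0_norm. Qed.

(* A polynomial in z approximating the indicator of z < 1 / 2. *)
Definition soft_step (z : R) N := (1 - z ^+ N) ^+ (2 ^ N).

Lemma soft_step_bounds z N : 0 <= z <= 1 -> 0 <= soft_step z N <= 1.
Proof.
move=> /andP[z0 z1].
have u0 : 0 <= 1 - z ^+ N by rewrite subr_ge0 exprn_ile1.
rewrite exprn_ge0//= exprn_ile1// lerBlDr lerDl exprn_ge0//.
Qed.

(** Bernoulli's inequality gives (1 - z^N)^(2^N) >= 1 - (2 z)^N; the exponent 2^N puts the threshold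
    at 1 / 2. *)
Lemma soft_step_below z : 0 <= z < 2^-1 -> soft_step z N @[N --> \oo] --> (1 : R).
Proof.
move=> /andP[z0 z1].
have z1' : z <= 1 by rewrite (le_trans (ltW z1))// invf_le1// ler1n.
have q : 0 <= 2 * z < 1 by rewrite mulr_ge0//= mulrC -ltr_pdivlMr// div1r.
have c : 1 - (2 * z) ^+ N @[N --> \oo] --> (1 : R).
  rewrite -[X in _ --> X](subr0 1).
  by apply: cvgB; [exact: cvg_cst|exact: cvg_geometric0].
apply: (squeeze_cvgr (f := fun N => 1 - (2 * z) ^+ N) (h := fun=> 1) _ c (cvg_cst _)); near=> N.
have /andP[_ ->] := soft_step_bounds N (introT andP (conj z0 z1')).
rewrite andbT exprMn -natrX; apply: bernoulli_inequality.
by rewrite exprn_ge0//= exprn_ile1.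
Unshelve. all: by end_near.
Qed.

Lemma soft_step_above z : 2^-1 < z <= 1 -> soft_step z N @[N --> \oo] --> (0 : R).
Proof.
move=> /andP[z0 z1].
have z0' : 0 < z by rewrite (lt_trans _ z0)// invr_gt0.
have q1 : 1 < 2 * z by rewrite mulrC -ltr_pdivrMr// div1r.
have q : 0 <= (2 * z)^-1 < 1 by rewrite invr_ge0 mulr_ge0 ?(ltW z0')//= invf_lt1// mulr_gt0.
(* (1 - u) ^ m <= exp (- m u) <= 1 / (m u) with u = z ^ N, m = 2 ^ N *)
apply: (squeeze_cvgr (f := fun=> 0) (h := fun N => (2 * z)^-1 ^+ N) _ (cvg_cst _) (cvg_geometric0 q)); near=> N.
have /andP[-> _] /= := soft_step_bounds N (introT andP (conj (ltW z0') z1)).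
have e1 : 1 - z ^+ N <= expR (- z ^+ N) by have := expR_ge1Dx (- z ^+ N).
have u0 : 0 <= 1 - z ^+ N by rewrite subr_ge0 exprn_ile1// ltW.
apply: (@le_trans _ _ (expR (- z ^+ N) ^+ (2 ^ N))).
  by apply: lerXn2r; rewrite ?nnegrE ?expR_ge0.
rewrite -expRM_natl mulrN expRN natrX -exprMn exprVn lef_pV2 ?posrE ?expR_gt0 ?exprn_gt0 ?mulr_gt0//.
by have := expR_ge1Dx ((2 * z) ^+ N); apply: le_trans; rewrite lerDr.
Unshelve. all: by end_near.
Qed.

(** A trigonometric polynomial of degree 1 that vanishes at 0, b and 2 pi, is negative on (0, b) and
    positive on (b, 2 pi). As |q| <= 2, dividing by 4 and adding 1 / 2 maps it into [0, 1] with the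
    sign change at 1 / 2. *)
Let q (b x : R) : R := cos (b / 2) - cos (x - b / 2).
Let z (b x : R) : R := 2^-1 + q b x / 4.

Let zE b x : q b x = 2 * sin (x / 2) * sin ((x - b) / 2).
Proof.
rewrite /q; have -> : b / 2 = x / 2 - (x - b) / 2 by field.
have -> : x - (x / 2 - (x - b) / 2) = x / 2 + (x - b) / 2 by field.
by rewrite cosB cosD; ring.
Qed.

Let z01 b x : 0 <= z b x <= 1.
Proof.
have := cos_le1 (b / 2); have := cos_geN1 (b / 2).
have := cos_le1 (x - b / 2); have := cos_geN1 (x - b / 2).
by rewrite /z /q => h1 h2 h3 h4; apply/andP; split; lra.
Qed.

Let z_below b x : b <= 2 * pi -> 0 < x < b -> 0 <= z b x < 2^-1.
Proof.
move=> b1 /andP[x0 xb]; have /andP[-> _] := z01 b x.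
rewrite /z gtrDl pmulr_llt0// zE -mulrA pmulr_rlt0// pmulr_rlt0.
  have -> : (x - b) / 2 = - ((b - x) / 2) by field.
  rewrite sinN oppr_lt0 sin_gt0_pi//; have := @pi_gt0 R; lra.
by rewrite sin_gt0_pi//; have := @pi_gt0 R; lra.
Qed.

Let z_above b x : 0 <= b -> b < x < 2 * pi -> 2^-1 < z b x <= 1.
Proof.
move=> b1 /andP[x0 xb]; have /andP[_ ->] := z01 b x.
rewrite andbT /z ltrDl divr_gt0// zE !mulr_gt0//.
  by rewrite sin_gt0_pi//; lra.
by rewrite sin_gt0_pi//; lra.
Qed.

Let trig_z b : trig_poly (z b).
Proof.
have := trig_polyD (trig_poly_cst (2^-1 + cos (b / 2) / 4))
  (trig_polyD (trig_polyZ (- cos (b / 2) / 4) (trig_poly_cos 1))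
    (trig_polyZ (- sin (b / 2) / 4) (trig_poly_sin 1))).
apply: trig_poly_ext => x.
by rewrite /z /q cosB !mul1r; field.
Qed.

Lemma indic_approx_dom (A : set (measurableTypeR R)) (g : R -> R) : (forall x, 0 <= g x <= 1) ->
  forall x, ((\1_A x : R) - g x) ^+ 2 <= 1.
Proof.
move=> g01 x; have /andP[g0 g1] := g01 x.
rewrite -(expr1n R 2) -[leLHS]real_normK ?num_real// ler_sqr ?nnegrE// ler_norml.
by rewrite indicE; case: (x \in A) => /=; apply/andP; split; lra.
Qed.

Lemma trig_approx_ray b : trig_approx (\1_(`]-oo, b]%classic : set (measurableTypeR R)) : R -> R).
Proof.
have mray : measurable (`]-oo, b]%classic : set (measurableTypeR R)) by exact: measurable_itv.
have fin1 : (\int[leb]_(x in I) ((fun=> 1 : R) x)%:E < +oo)%E.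
  by rewrite integral_cst ?mul1e ?leb_I_lty//; exact: mI.
have m1 : measurable_fun [set: measurableTypeR R] (fun=> 1 : R) by exact: measurable_cst.
have cases : [\/ b < 0, 2 * pi < b | 0 <= b <= 2 * pi].
  have [|b0] := ltP b 0; first by constructor 1.
  by have [|b1] := ltP (2 * pi) b; [constructor 2|constructor 3].
(* If b lies outside [0, 2 pi], the ray meets the period in nothing or everything, and a constant is
   used. *)
apply: (@trig_approx_lim _ _ (fun N x =>
    if b < 0 then 0 else if 2 * pi < b then 1 else soft_step (z b x) N) (fun=> 1)) => //.
- move=> N; apply: trig_approx_poly.
  case: (b < 0); first exact: trig_poly_cst.
  case: (2 * pi < b); first exact: trig_poly_cst.
  apply: trig_polyX; apply: trig_polyB; first exact: trig_poly_cst.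
  exact: trig_polyX.
- move=> N; apply: indic_approx_dom => x.
  case: ifP => _; first by rewrite lexx ler01.
  case: ifP => _; first by rewrite lexx ler01.
  exact: soft_step_bounds.
(* For b in [0, 2 pi], z equals 1 / 2 at these points, where the soft step need not converge to the
   indicator. *)
exists [set 0; b; 2 * pi]; split.
- by apply: measurableU; [apply: measurableU|]; exact: measurable_set1.
- apply: countable_lebesgue_measure0; apply/finite_set_countable.
  by rewrite !finite_setU; split => //; split.
move=> x /= /not_implyP[]; rewrite in_itv/= => /andP[x0 x1] ncvg.
apply: contra_notP ncvg => /not_orP[/not_orP[/eqP xn0 /eqP xnb] /eqP xnpi].
have {}x0 : 0 < x by rewrite lt_neqAle eq_sym xn0.
have {}x1 : x < 2 * pi by rewrite lt_neqAle xnpi.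
rewrite indicE.
case: cases => [b0|b0|/andP[b0 b1]].
- rewrite b0 memNset; first exact: cvg_cst.
  by rewrite /= in_itv/=; apply/negP; rewrite -ltNge (lt_trans b0).
- have nb : (b < 0) = false by apply/negbTE; rewrite -leNgt ltW// (lt_trans two_pi_gt0).
  rewrite nb b0 mem_set; first exact: cvg_cst.
  by rewrite /= in_itv/= ltW// (lt_trans x1).
- have -> : (b < 0) = false by apply/negbTE; rewrite -leNgt.
  have -> : (2 * pi < b) = false by apply/negbTE; rewrite -leNgt.
  have [xb|bx|xb] := ltgtP x b; last by rewrite xb eqxx in xnb.
    rewrite mem_set; first by apply: soft_step_below; apply: z_below => //; rewrite x0.
    by rewrite /= in_itv/= ltW.
  rewrite memNset; first by apply: soft_step_above; apply: z_above => //; rewrite bx.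
  by rewrite /= in_itv/=; apply/negP; rewrite -ltNge.
Qed.

End StepApproximation.

Section FullDensity.
Import HBNNSimple.
Context {R : realType}.
Local Notation leb := (@lebesgue_measure R).
Local Notation I := (`[(0 : R), 2 * pi]%classic : set (measurableTypeR R)).

Lemma trig_approx_indicB (A B : set (measurableTypeR R)) : B `<=` A ->
  trig_approx (\1_A : R -> R) -> trig_approx (\1_B : R -> R) ->
  trig_approx (\1_(A `\` B) : R -> R).
Proof.
move=> BA hA hB; rewrite (_ : \1_(A `\` B) = fun x : R => (\1_A x : R) - \1_B x).
  exact: trig_approxB.
apply/funext => x; rewrite !indicE.
have [xB|xB] := boolP (x \in B).
  rewrite (mem_set (BA _ (set_mem xB))) subrr memNset//.
  by move=> [_]; apply; exact: set_mem.
rewrite subr0; congr (nat_of_bool _)%:R.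
apply/idP/idP => /set_mem; first by case=> xA _; exact: mem_set.
by move=> xA; apply: mem_set; split => // Bx; move: xB; rewrite mem_set.
Qed.

(** Monotone class argument: half-open intervals are stable under intersection, and the sets with
    the property are stable under proper differences and increasing unions. *)
Lemma trig_approx_indic (A : set (measurableTypeR R)) : measurable A ->
  trig_approx (\1_A : R -> R).
Proof.
have fin1 : (\int[leb]_(x in I) ((fun=> 1 : R) x)%:E < +oo)%E.
  by rewrite integral_cst ?mul1e ?leb_I_lty//; exact: mI.
have m1 : measurable_fun [set: measurableTypeR R] (fun=> 1 : R) by exact: measurable_cst.
pose H := [set A : set (measurableTypeR R) | measurable A /\ trig_approx (\1_A : R -> R)].
have HT : trig_approx (\1_(setT : set (measurableTypeR R)) : R -> R).
  rewrite (_ : \1_setT = fun=> 1 : R); last by apply/funext => x; rewrite indicE in_setT.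
  by apply: trig_approx_poly; exact: trig_poly_cst.
suff sub : <<s setT, (@ocitv R) >> `<=` H by move=> mA; have [] := sub _ mA.
apply: lambda_system_subset => //.
- exact: ocitvI.
- split => //.
  + by move=> A' B BA [mA hA] [mB hB]; split; [exact: measurableD|exact: trig_approx_indicB].
  + move=> F ndF HF; have mU : measurable (\bigcup_k F k) by apply: bigcupT_measurable => k; have [] := HF k.
    split => //.
    apply: (@trig_approx_lim _ _ (fun n => \1_(F n)) (fun=> 1) _ _ m1 fin1).
    * exact: measurable_indic.
    * by move=> n; have [] := HF n.
    * move=> n; apply: indic_approx_dom => x.
      by rewrite indicE; case: (_ \in _); rewrite lexx ler01.
    apply: aeW => x _; have [xU|xU] := pselect ((\bigcup_k F k) x).
        rewrite indicE mem_set//; have [n _ Fnx] := xU.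
        apply: cvg_near_cst; exists n => // m /= nm.
        rewrite indicE mem_set//; move: x Fnx {xU}.
        by apply/subsetPset; exact: ndF.
      rewrite indicE memNset//; apply: cvg_near_cst; apply: nearW => m.
      by rewrite indicE memNset// => Fmx; apply: xU; exists m.
- move=> X /ocitvP [->|[[u v] /= uv ->]].
    split => //; rewrite (_ : \1_set0 = fun=> 0 : R); last by apply/funext => x; rewrite indicE in_set0.
    by apply: trig_approx_poly; exact: trig_poly_cst.
  split; first exact: measurable_itv.
  have -> : `]u, v]%classic = (`]-oo, v] `\` `]-oo, u])%classic.
    apply/seteqP; split => x /=; rewrite !in_itv/=.
      by move=> /andP[ux ->]; split => //; apply/negP; rewrite -ltNge.
    by move=> [-> /negP]; rewrite -ltNge => ->.
  apply: trig_approx_indicB; try exact: trig_approx_ray.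
  by move=> x /=; rewrite !in_itv/= => xu; rewrite (le_trans xu)// ltW.
Qed.

Lemma trig_approx_sum (T : Type) (r : seq T) (f : T -> R -> R) :
  (forall i, trig_approx (f i)) -> trig_approx (fun x => \sum_(i <- r) f i x).
Proof.
move=> hf; elim: r => [|i r IH].
  under eq_fun do rewrite big_nil; apply: trig_approx_poly; exact: trig_poly_cst.
by under eq_fun do rewrite big_cons; exact: trig_approxD.
Qed.

Lemma trig_approx_nnsfun (f : {nnsfun (measurableTypeR R) >-> R}) :
  trig_approx (f : measurableTypeR R -> R).
Proof.
rewrite (_ : (f : measurableTypeR R -> R) = fun x => \sum_(y <- finmap.enum_fset (fset_set (range f))) y * \1_(f @^-1` [set y]) x).
  by apply: trig_approx_sum => y; apply: trig_approxZ; exact: trig_approx_indic.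
apply/funext => x; rewrite [LHS]fimfunE fsbig_finite//.
Qed.

(** Approximation from below by simple functions; the squared error is dominated by f^2. *)
Lemma trig_approx_ge0 (f : R -> R) : measurable_fun setT f -> (sqint f < +oo)%E ->
  (forall x, 0 <= f x) -> trig_approx f.
Proof.
move=> mf f2 f0.
have mfE : measurable_fun [set: measurableTypeR R] (EFin \o f) by exact/measurable_EFinP.
have f0E x : ([set: measurableTypeR R]) x -> (0 <= (EFin \o f) x)%E by rewrite lee_fin f0.
pose g n : measurableTypeR R -> R := nnsfun_approx measurableT mfE n.
have gf n x : g n x <= f x.
  by rewrite -lee_fin /g nnsfun_approxE; apply: le_approx => //; rewrite f0E.
apply: (@trig_approx_lim _ _ g (fun x => f x ^+ 2)) => //.
- by move=> n; exact: trig_approx_nnsfun.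
- exact: measurable_funX.
- move=> n x; rewrite ler_sqr ?nnegrE ?subr_ge0 ?gf ?f0//.
  by rewrite lerBlDr lerDl; exact: fun_ge0.
- apply: aeW => x _.
  have := @cvg_nnsfun_approx _ _ _ _ measurableT _ mfE f0E x Logic.I.
  by move/fine_cvg.
Qed.

Theorem trig_dense (f : R -> R) : measurable_fun setT f -> (sqint f < +oo)%E ->
  trig_approx f.
Proof.
move=> mf f2.
have mp : measurable_fun setT (fun x => Num.max (f x) 0) by apply: measurable_maxr => //; exact: measurable_cst.
have mn : measurable_fun setT (fun x => Num.max (- f x) 0).
  by apply: measurable_maxr; [exact: measurableT_comp|exact: measurable_cst].
have -> : f = fun x => Num.max (f x) 0 - Num.max (- f x) 0.
  apply/funext => x; have [f0|f0] := leP 0 (f x).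
    by rewrite max_r ?oppr_le0// subr0.
  by rewrite max_l ?oppr_ge0 ?ltW// opprK add0r.
apply: trig_approxB; apply: trig_approx_ge0 => //.
- apply: le_lt_trans (le_sqint mp mf _) f2 => x.
  by have [f0|f0] := leP (f x) 0; rewrite ?normr0 ?normr_ge0.
- by move=> x; rewrite le_max lexx orbT.
- apply: le_lt_trans (le_sqint mn mf _) f2 => x.
  by have [f0|f0] := leP (- f x) 0; rewrite ?normr0 ?normrN ?normr_ge0.
- by move=> x; rewrite le_max lexx orbT.
Qed.

End FullDensity.

(** * Parseval identity *)

Section Orthogonality.
Context {R : realType}.
Local Notation leb := (@lebesgue_measure R).
Local Notation I := (`[(0 : R), 2 * pi]%classic : set (measurableTypeR R)).

Definition period_int (f : R -> R) : R := Rintegral leb I f.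

Lemma continuous_integrable (f : R -> R) : continuous f -> leb.-integrable I (EFin \o f).
Proof.
move=> cf; apply: continuous_compact_integrable; first exact: segment_compact.
exact: continuous_subspaceT.
Qed.

Lemma period_intD (f g : R -> R) : continuous f -> continuous g ->
  period_int (fun x => f x + g x) = period_int f + period_int g.
Proof. by move=> cf cg; apply: RintegralD; [exact: mI|exact: continuous_integrable..]. Qed.

Lemma period_intZ (c : R) (f : R -> R) : continuous f ->
  period_int (fun x => c * f x) = c * period_int f.
Proof. by move=> cf; apply: RintegralZl; [exact: mI|exact: continuous_integrable]. Qed.

Lemma Rintegral_derivative (F f : R -> R) (a b : R) : a < b ->
  (forall x : R, is_derive x 1 F (f x)) -> continuous f ->
  Rintegral leb `[a, b] f = F b - F a.
Proof.
move=> ab dF cf; rewrite /Rintegral (@continuous_FTC2 _ f F a b ab)//.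
- exact: continuous_subspaceT.
- split.
  + by move=> x _; exact: (@ex_derive _ _ _ _ _ _ _ (dF x)).
  + apply: cvg_at_right_filter; exact: (is_derive_continuous dF).
  + apply: cvg_at_left_filter; exact: (is_derive_continuous dF).
- by move=> x _; rewrite derive1E (@derive_val _ _ _ _ _ _ _ (dF x)).
Qed.

Lemma continuous_cosr (r : R) : continuous (fun x : R => cos (r * x)).
Proof.
by move=> x; apply: continuous_comp; [apply: cvgM; [exact: cvg_cst|exact: cvg_id]|exact: continuous_cos].
Qed.

Lemma continuous_sinr (r : R) : continuous (fun x : R => sin (r * x)).
Proof.
by move=> x; apply: continuous_comp; [apply: cvgM; [exact: cvg_cst|exact: cvg_id]|exact: continuous_sin].
Qed.

Lemma period_int_cos (r : R) : r != 0 -> sin (r * (2 * pi)) = 0 ->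
  period_int (fun x => cos (r * x)) = 0.
Proof.
move=> r0 s0.
have dF (x : R) : is_derive x 1 (r^-1 \*: (fun x => sin (r * x))) (cos (r * x)).
  have d1 := is_derive_scale (is_derive_sin (r * x)).
  by apply: is_derive_eq; rewrite /GRing.scale /= mulKf.
rewrite /period_int (Rintegral_derivative two_pi_gt0 dF (@continuous_cosr r)) /=.
by rewrite s0 !mulr0 sin0 scaler0 subrr.
Qed.

Lemma period_int_sin (r : R) : r != 0 -> cos (r * (2 * pi)) = 1 ->
  period_int (fun x => sin (r * x)) = 0.
Proof.
move=> r0 s0.
have dF (x : R) : is_derive x 1 (- r^-1 \*: (fun x => cos (r * x))) (sin (r * x)).
  have d1 := is_derive_scale (is_derive_cos (r * x)).
  by apply: is_derive_eq; rewrite /GRing.scale /=; field.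
rewrite /period_int (Rintegral_derivative two_pi_gt0 dF (@continuous_sinr r)) /=.
by rewrite s0 !mulr0 cos0 subrr.
Qed.

Lemma cos_sin_period (n : nat) :
  cos (n%:R * (2 * pi)) = 1 :> R /\ sin (n%:R * (2 * pi)) = 0 :> R.
Proof.
elim: n => [|n [IHc IHs]]; first by rewrite mul0r cos0 sin0.
have -> : n.+1%:R * (2 * pi) = n%:R * (2 * pi) + pi + pi :> R by rewrite -natr1; ring.
by rewrite !sinDpi !cosDpi !opprK.
Qed.

Definition harmonic_term (n : nat) (c : R * R) (x : R) : R :=
  c.1 * cos (n%:R * x) + c.2 * sin (n%:R * x).

Lemma continuousZr (k : R) (f : R -> R) : continuous f -> continuous (fun x => k * f x).
Proof. by move=> cf x; apply: cvgM; [exact: cvg_cst|exact: cf]. Qed.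

Lemma continuousDr (f g : R -> R) : continuous f -> continuous g -> continuous (fun x => f x + g x).
Proof. by move=> cf cg x; apply: cvgD; [exact: cf|exact: cg]. Qed.

Lemma continuousMr (f g : R -> R) : continuous f -> continuous g -> continuous (fun x => f x * g x).
Proof. by move=> cf cg x; apply: cvgM; [exact: cf|exact: cg]. Qed.

Lemma continuous_harmonic n c : continuous (harmonic_term n c).
Proof.
by apply: continuousDr; apply: continuousZr; [exact: continuous_cosr|exact: continuous_sinr].
Qed.

Lemma period_int_cst (k : R) : period_int (fun=> k) = 2 * pi * k.
Proof.
rewrite /period_int; have -> : Rintegral leb I (fun=> k) = k * fine (leb I).
  by apply: Rintegral_cst; exact: mI.
by rewrite leb_I mulrC.
Qed.

(** At n = 0 the cosine is the constant 1, of squared norm 2 pi, and the sine coefficient multiplies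
    the zero function. *)
Definition harmonic_weight (n : nat) (c d : R * R) : R :=
  if n == 0%N then 2 * pi * (c.1 * d.1) else pi * (c.1 * d.1 + c.2 * d.2).

(** After linearization of the products, only a zero frequency survives integration; the sum of
    frequencies vanishes as well when n = m = 0, whence the double weight. *)
Lemma period_int_harmonicM n m c d :
  period_int (fun x => harmonic_term n c x * harmonic_term m d x) =
  if n == m then harmonic_weight n c d else 0.
Proof.
have pm : (fun x => harmonic_term n c x * harmonic_term m d x) = fun x =>
    (c.1 * d.1 + c.2 * d.2) / 2 * cos ((n%:R - m%:R) * x) +
    (c.1 * d.1 - c.2 * d.2) / 2 * cos ((n%:R + m%:R) * x) +
    (c.1 * d.2 + c.2 * d.1) / 2 * sin ((n%:R + m%:R) * x) +
    (c.2 * d.1 - c.1 * d.2) / 2 * sin ((n%:R - m%:R) * x).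
  apply/funext => x; rewrite /harmonic_term (mulrBl x n%:R) (mulrDl n%:R).
  by rewrite cosB sinB cosD sinD; field.
have [cn sn] := cos_sin_period n; have [cm sm] := cos_sin_period m.
have sD : sin ((n%:R + m%:R) * (2 * pi)) = 0 :> R by rewrite mulrDl sinD sn sm mul0r mulr0 addr0.
have sB : sin ((n%:R - m%:R) * (2 * pi)) = 0 :> R by rewrite mulrBl sinB sn sm mul0r mulr0 subr0.
have cD : cos ((n%:R + m%:R) * (2 * pi)) = 1 :> R by rewrite mulrDl cosD sn sm cn cm !mul0r mul1r subr0.
have cB : cos ((n%:R - m%:R) * (2 * pi)) = 1 :> R by rewrite mulrBl cosB sn sm cn cm !mul0r mul1r addr0.
have split4 (k1 k2 k3 k4 r1 r2 r3 r4 : R) : period_int (fun x => k1 * cos (r1 * x) + k2 * cos (r2 * x) + k3 * sin (r3 * x) + k4 * sin (r4 * x)) =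
   k1 * period_int (fun x => cos (r1 * x)) + k2 * period_int (fun x => cos (r2 * x)) + k3 * period_int (fun x => sin (r3 * x)) + k4 * period_int (fun x => sin (r4 * x)).
  have c1 := @continuousZr k1 _ (@continuous_cosr r1).
  have c2 := @continuousZr k2 _ (@continuous_cosr r2).
  have c3 := @continuousZr k3 _ (@continuous_sinr r3).
  have c4 := @continuousZr k4 _ (@continuous_sinr r4).
  rewrite (period_intD (continuousDr (continuousDr c1 c2) c3) c4) (period_intD (continuousDr c1 c2) c3) (period_intD c1 c2).
  by rewrite !period_intZ//; do ? [exact: continuous_cosr|exact: continuous_sinr].
rewrite pm split4.
have int0 : period_int (fun x => cos (0 * x)) = 2 * pi.
  by under eq_fun do rewrite mul0r cos0; rewrite period_int_cst mulr1.
have ints0 : period_int (fun x => sin (0 * x)) = 0.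
  by under eq_fun do rewrite mul0r sin0; rewrite period_int_cst mulr0.
case: (eqVneq n m) => [E|nm].
  move: sD cD; rewrite -E => sD cD.
  rewrite subrr int0 ints0 /harmonic_weight.
  have [->|n0] := eqVneq n 0%N; first by rewrite addr0 int0 ints0; field.
  have nn : n%:R + n%:R != 0 :> R by rewrite -natrD pnatr_eq0 addn_eq0 (negbTE n0).
  by rewrite period_int_cos// ?period_int_sin//; field.
have nmB : n%:R - m%:R != 0 :> R by rewrite subr_eq0 eqr_nat.
have nmD : n%:R + m%:R != 0 :> R.
  rewrite -natrD pnatr_eq0 addn_eq0; apply: contra nm => /andP[/eqP -> /eqP ->] //.
by rewrite !period_int_cos// !period_int_sin// !mulr0 !addr0.
Qed.

Lemma continuous_harmonic_sum N (c : nat -> R * R) :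
  continuous (fun x => \sum_(n < N) harmonic_term n (c n) x).
Proof.
elim: N => [|N IH].
  by under eq_fun do rewrite big_ord0; move=> x; exact: cvg_cst.
by under eq_fun do rewrite big_ord_recr; apply: continuousDr => //; exact: continuous_harmonic.
Qed.

Lemma period_int_sumM N (c : nat -> R * R) m d :
  period_int (fun x => (\sum_(n < N) harmonic_term n (c n) x) * harmonic_term m d x) =
  \sum_(n < N) if n == m :> nat then harmonic_weight n (c n) d else 0.
Proof.
elim: N => [|N IH].
  rewrite big_ord0; under eq_fun do rewrite big_ord0 mul0r.
  by rewrite period_int_cst mulr0.
under eq_fun do rewrite big_ord_recr mulrDl.
have cS := @continuous_harmonic_sum N c.
have cm := @continuous_harmonic m d.
rewrite (period_intD (continuousMr cS cm)); last first.
  by apply: continuousMr => //; exact: continuous_harmonic.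
by rewrite IH period_int_harmonicM big_ord_recr.
Qed.

Lemma parseval_finite N (c : nat -> R * R) :
  period_int (fun x => (\sum_(n < N) harmonic_term n (c n) x) ^+ 2) =
  \sum_(n < N) harmonic_weight n (c n) (c n).
Proof.
elim: N => [|N IH].
  rewrite big_ord0; under eq_fun do rewrite big_ord0 expr0n.
  by rewrite period_int_cst mulr0.
have cS := @continuous_harmonic_sum N c.
have cN := @continuous_harmonic N (c N).
rewrite (_ : (fun _ => _) = fun x => (\sum_(n < N) harmonic_term n (c n) x) ^+ 2 +
   (2 * ((\sum_(n < N) harmonic_term n (c n) x) * harmonic_term N (c N) x)) +
   harmonic_term N (c N) x * harmonic_term N (c N) x); last first.
  by apply/funext => x; rewrite big_ord_recr/=; ring.
have c1 : continuous (fun x => (\sum_(n < N) harmonic_term n (c n) x) ^+ 2).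
  by under eq_fun do rewrite expr2; exact: continuousMr.
rewrite (period_intD (continuousDr c1 (@continuousZr 2 _ (continuousMr cS cN))) (continuousMr cN cN)).
rewrite (period_intD c1 (@continuousZr 2 _ (continuousMr cS cN))) (period_intZ 2 (continuousMr cS cN)).
rewrite IH period_int_sumM period_int_harmonicM eqxx big_ord_recr/=.
rewrite [X in 2 * X]big1 ?mulr0 ?addr0// => i _.
by rewrite ltn_eqF.
Qed.

Lemma sqint_harmonic_sum N (c : nat -> R * R) :
  sqint (fun x => \sum_(n < N) harmonic_term n (c n) x) =
  (\sum_(n < N) harmonic_weight n (c n) (c n))%:E.
Proof.
rewrite -parseval_finite /sqint /period_int /Rintegral fineK//.
apply: integrable_fin_num; first exact: mI.
apply: continuous_integrable; under eq_fun do rewrite expr2.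
by apply: continuousMr; exact: continuous_harmonic_sum.
Qed.

End Orthogonality.

(** * Contraction in L^2 *)

Section Translation.
Context {R : realType}.
Local Notation leb := (@lebesgue_measure R).
Local Notation I := (`[(0 : R), 2 * pi]%classic : set (measurableTypeR R)).

Lemma measurable_shift (c : R) :
  measurable_fun [set: measurableTypeR R] (fun x : measurableTypeR R => x + c : measurableTypeR R).
Proof. by apply: measurable_funD => //; exact: measurable_cst. Qed.

Lemma lebesgue_measure_shift (c : R) (A : set (measurableTypeR R)) : measurable A ->
  leb A = leb ((fun x => x + c) @^-1` A).
Proof.
move=> mA.
pose phi : {mfun measurableTypeR R >-> measurableTypeR R} :=
  HB.pack (fun x : measurableTypeR R => x + c : measurableTypeR R)
   (isMeasurableFun.Build _ _ _ _ _ (measurable_shift c)).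
apply: (@lebesgue_measure_unique R (pushforward leb phi)) => // X /ocitvP[->|[[a b]/= ab ->]].
  by apply: (congr1 leb); rewrite preimage_set0.
rewrite /pushforward (_ : _ @^-1` _ = `]a - c, b - c]%classic).
  by rewrite !itvoc_measure ?lerD2r ?ltW//; congr (_%:E); ring.
apply/seteqP; split => x /=; rewrite !in_itv/= /phi/=.
  by move=> /andP[h1 h2]; rewrite ltrBlDr h1 lerBrDr.
by rewrite ltrBlDr lerBrDr.
Qed.

Lemma ge0_integral_shift (c : R) (D : set (measurableTypeR R)) (h : R -> \bar R) :
  measurable D -> measurable_fun setT h -> (forall x, 0 <= h x)%E ->
  (\int[leb]_(x in (fun x => (x + c)%R) @^-1` D) h (x + c)%R = \int[leb]_(x in D) h x)%E.
Proof.
move=> mD mh h0.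
pose phi : {mfun measurableTypeR R >-> measurableTypeR R} :=
  HB.pack (fun x : measurableTypeR R => x + c : measurableTypeR R)
   (isMeasurableFun.Build _ _ _ _ _ (measurable_shift c)).
have := @ge0_integral_pushforward _ _ _ _ R _ (measurable_shift c) leb D h mD (measurable_funTS mh) (fun y _ => h0 y).
rewrite /comp => <-.
apply: (@eq_measure_integral _ _ _ D leb (pushforward leb phi)) => A mA _.
by rewrite [RHS](lebesgue_measure_shift c).
Qed.

Lemma periodicZ (T : Type) (H : R -> T) : (forall x, H (x + 2 * pi) = H x) ->
  forall (k : int) x, H (x + k%:~R * (2 * pi)) = H x.
Proof.
move=> Hp.
have Hn (n : nat) x : H (x + n%:R * (2 * pi)) = H x.
  elim: n x => [|n IH] x; first by rewrite mul0r addr0.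
  by rewrite -natr1 mulrDl mul1r addrA Hp.
case=> n x; first exact: Hn.
by rewrite NegzE mulrNz mulNr -{2}[x](subrK (n.+1%:R * (2 * pi))) Hn.
Qed.

(** For a shift reduced to [0, 2 pi), the translated period lies in [0, 4 pi], that is in two
    periods. The lost factor 2 is acceptable because the bound is applied only to approximation
    errors. *)
Lemma ge0_integral_shift_le (H : R -> \bar R) (c : R) : measurable_fun setT H ->
  (forall x, 0 <= H x)%E -> (forall x, H (x + 2 * pi) = H x) ->
  (\int[leb]_(x in I) H (x + c)%R <= \int[leb]_(x in I) H x + \int[leb]_(x in I) H x)%E.
Proof.
move=> mH H0 Hp.
pose k := Num.floor (c / (2 * pi)); pose r := c - k%:~R * (2 * pi).
have p0 := @two_pi_gt0 R.
have r0 : 0 <= r by rewrite subr_ge0 -ler_pdivlMr// floor_le_tmp.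
have r1 : r < 2 * pi.
  rewrite ltrBlDr -{1}[2 * pi]mul1r -mulrDl -ltr_pdivrMr// addrC.
  by have := floorD1_gt (c / (2 * pi)); rewrite intrD.
have -> : (\int[leb]_(x in I) H (x + c)%R = \int[leb]_(x in I) H (x + r)%R)%E.
  apply: eq_integral => x _; rewrite -[RHS](periodicZ Hp k); congr H.
  by rewrite /r; ring.
have I1 : measurable (`]2 * pi, 4 * pi]%classic : set (measurableTypeR R)) by exact: measurable_itv.
have -> : (\int[leb]_(x in I) H (x + r)%R = \int[leb]_(x in `[r, (r + 2 * pi)%R]) H x)%E.
  rewrite -(ge0_integral_shift r (measurable_itv `[r, r + 2 * pi]) mH H0).
  congr (integral _ _ _); apply/seteqP; split => x /=;
    by rewrite !in_itv/= lerDr [r + _]addrC lerD2r.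
have le1 : (\int[leb]_(x in `[r, (r + 2 * pi)%R]) H x <=
    \int[leb]_(x in I `|` `](2 * pi)%R, (4 * pi)%R]%classic) H x)%E.
  apply: ge0_subset_integral => //.
  - by apply: measurableU => //; exact: mI.
  - exact: measurable_funTS.
  - move=> x /=; rewrite !in_itv/= => /andP[x0 x1].
    have [h|h] := leP x (2 * pi); [left|right; rewrite /=]; rewrite ?(le_trans r0 x0)//.
    by rewrite (le_trans x1)//; lra.
apply: (le_trans le1); rewrite ge0_integral_setU//; last 2 first.
- exact: measurable_funTS.
- by apply/disj_setPS => x /= []; rewrite !in_itv/= => /andP[_ h1] /andP[h2 _]; rewrite leNgt h2 in h1.
apply: leeD => //.
have -> : (\int[leb]_(x in `](2 * pi)%R, (4 * pi)%R]) H x = \int[leb]_(x in `](0 : R)%R, (2 * pi)%R]) H x)%E.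
  rewrite -(ge0_integral_shift (2 * pi) I1 mH H0).
  under eq_integral do rewrite Hp.
  congr (integral _ _ _); apply/seteqP; split => x /=; rewrite !in_itv/= => /andP[h1 h2]; apply/andP; split; lra.
apply: ge0_subset_integral => //.
- exact: measurable_funTS.
- by move=> x /=; rewrite !in_itv/= => /andP[/ltW -> ->].
Qed.

End Translation.

(** * The operator norm of a single mode *)

Section ModeNorm.
Context {R : realType}.

(* The squared operator norm of [[C + iP, Q], [Q, C - iP]], C^2 + P^2 = r^2. *)
Lemma rotation_norm_le (C P Q r al be al' be' : R) : 0 <= r -> r ^+ 2 = C ^+ 2 + P ^+ 2 ->
  (C * al + P * be + Q * al') ^+ 2 + (C * be - P * al + Q * be') ^+ 2 +
  ((C * al' - P * be' + Q * al) ^+ 2 + (C * be' + P * al' + Q * be) ^+ 2) <=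
  (`|Q| + r) ^+ 2 * (al ^+ 2 + be ^+ 2 + (al' ^+ 2 + be' ^+ 2)).
Proof.
move=> r0 r2; pose U := al ^+ 2 + be ^+ 2; pose V := al' ^+ 2 + be' ^+ 2.
pose X := al * al' + be * be'; pose W := be * al' - al * be'.
have U0 : 0 <= U by rewrite addr_ge0// sqr_ge0.
have V0 : 0 <= V by rewrite addr_ge0// sqr_ge0.
(* X + i W is al + i be times the conjugate of al' + i be', so X^2 + W^2 = U V. Lagrange's identity
   followed by U V <= ((U + V) / 2)^2 gives the bound. *)
have key : `|C * X + P * W| <= r * ((U + V) / 2).
  have nn : 0 <= r * ((U + V) / 2) by rewrite mulr_ge0// divr_ge0// addr_ge0.
  rewrite -(@ler_sqr R) ?nnegrE// real_normK ?num_real// exprMn r2.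
  have -> : (C * X + P * W) ^+ 2 = (C ^+ 2 + P ^+ 2) * (U * V) - (C * W - P * X) ^+ 2.
    by rewrite /X /W /U /V; ring.
  rewrite lerBlDr; apply: (@le_trans _ _ ((C ^+ 2 + P ^+ 2) * ((U + V) / 2) ^+ 2)).
    rewrite ler_wpM2l ?addr_ge0 ?sqr_ge0// -subr_ge0.
    by rewrite (_ : _ - _ = ((U - V) / 2) ^+ 2) ?sqr_ge0//; field.
  by rewrite lerDl sqr_ge0.
have -> : (C * al + P * be + Q * al') ^+ 2 + (C * be - P * al + Q * be') ^+ 2 +
  ((C * al' - P * be' + Q * al) ^+ 2 + (C * be' + P * al' + Q * be) ^+ 2) =
  (C ^+ 2 + P ^+ 2 + Q ^+ 2) * (U + V) + 4 * (Q * (C * X + P * W)).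
  by rewrite /X /W /U /V; ring.
rewrite -r2 -/U -/V.
have QX : Q * (C * X + P * W) <= `|Q| * (r * ((U + V) / 2)).
  by rewrite (le_trans (ler_norm _))// normrM ler_wpM2l.
have Q2 : `|Q| ^+ 2 = Q ^+ 2 by rewrite real_normK ?num_real.
have -> : (`|Q| + r) ^+ 2 * (U + V) = (r ^+ 2 + `|Q| ^+ 2) * (U + V) + 4 * (`|Q| * (r * ((U + V) / 2))).
  by field.
rewrite Q2; lra.
Qed.

(** Equality in [rotation_norm_le]: with first component 1, the second is the unit vector for which
    X + i W points along C + i P, times the sign of Q; then U = V = 1 as well. *)
Lemma rotation_norm_attained (C P Q r : R) : 0 < r -> r ^+ 2 = C ^+ 2 + P ^+ 2 ->
  exists al' be' : R, al' ^+ 2 + be' ^+ 2 = 1 /\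
  (C * 1 + P * 0 + Q * al') ^+ 2 + (C * 0 - P * 1 + Q * be') ^+ 2 +
  ((C * al' - P * be' + Q * 1) ^+ 2 + (C * be' + P * al' + Q * 0) ^+ 2) =
  (`|Q| + r) ^+ 2 * 2.
Proof.
move=> r0 r2.
have [s s2 sQ] : exists2 s : R, s ^+ 2 = 1 & s * Q = `|Q|.
  have [Q0|Q0] := leP 0 Q; first by exists 1; rewrite ?expr1n ?mul1r ?ger0_norm.
  by exists (-1); rewrite ?sqrrN ?expr1n ?mulN1r ?ltr0_norm.
have rn0 : r != 0 by rewrite gt_eqF.
have CP : (C / r) ^+ 2 + (P / r) ^+ 2 = 1.
  by rewrite !exprMn -mulrDl -r2 exprVn divff// expf_neq0.
have CPr : C * (C / r) + P * (P / r) = r.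
  by rewrite !mulrA -!expr2 -mulrDl -r2 expr2 mulfK.
exists (s * (C / r)), (- (s * (P / r))); split.
  by rewrite sqrrN !exprMn -mulrDr -!exprMn CP s2 mulr1.
transitivity ((C ^+ 2 + P ^+ 2 + Q ^+ 2) * (1 + s ^+ 2 * ((C / r) ^+ 2 + (P / r) ^+ 2)) + 4 * (s * Q) * (C * (C / r) + P * (P / r))).
  by ring.
rewrite CP CPr s2 sQ -r2.
have -> : Q ^+ 2 = `|Q| ^+ 2 by rewrite real_normK ?num_real.
ring.
Qed.

Variables (a : R) (a0 : 0 < a).
Local Notation k n := (a ^+ 2 - n%:R ^+ 2).

Definition coef_sqr (v : bool -> R * R) : R :=
  (v false).1 ^+ 2 + (v false).2 ^+ 2 + ((v true).1 ^+ 2 + (v true).2 ^+ 2).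

Definition mode_norm n t : R := expR (- a * t) * amp (a * `|gsinh (k n) t|).

(** C^2 = 1 + (a^2 - n^2) S^2, so adding n^2 S^2 cancels n. *)
Lemma mode_radiusE n t :
  Num.sqrt (1 + (a * `|gsinh (k n) t|) ^+ 2) ^+ 2 =
  gcosh (k n) t ^+ 2 + (n%:R * gsinh (k n) t) ^+ 2.
Proof.
rewrite sqr_sqrtr; last exact/ltW/oneDsqr_gt0.
by rewrite gcosh2Bgsinh2 !exprMn real_normK ?num_real//; ring.
Qed.

Lemma sqr_mode_flow n t v : coef_sqr (mode_flow a n t v) =
  expR (- a * t) ^+ 2 *
  ((gcosh (k n) t * (v false).1 + n%:R * gsinh (k n) t * (v false).2 + a * gsinh (k n) t * (v true).1) ^+ 2 +
   (gcosh (k n) t * (v false).2 - n%:R * gsinh (k n) t * (v false).1 + a * gsinh (k n) t * (v true).2) ^+ 2 +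
  ((gcosh (k n) t * (v true).1 - n%:R * gsinh (k n) t * (v true).2 + a * gsinh (k n) t * (v false).1) ^+ 2 +
   (gcosh (k n) t * (v true).2 + n%:R * gsinh (k n) t * (v true).1 + a * gsinh (k n) t * (v false).2) ^+ 2)).
Proof. by rewrite /coef_sqr /mode_flow /= /sgn expr0 expr1; ring. Qed.

Lemma mode_flow_norm_le n t v :
  coef_sqr (mode_flow a n t v) <= mode_norm n t ^+ 2 * coef_sqr v.
Proof.
rewrite sqr_mode_flow /mode_norm (exprMn _ (expR _)) -(mulrA (expR _ ^+ 2)).
apply: ler_wpM2l; first exact: sqr_ge0.
have := rotation_norm_le (a * gsinh (k n) t) (v false).1 (v false).2 (v true).1 (v true).2
  (sqrtr_ge0 _) (mode_radiusE n t).
by rewrite /amp [`|a * _|]normrM (gtr0_norm a0).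
Qed.

Lemma mode_flow_norm_attained n t : exists2 v, coef_sqr v = 2 &
  coef_sqr (mode_flow a n t v) = mode_norm n t ^+ 2 * coef_sqr v.
Proof.
have r0 : 0 < Num.sqrt (1 + (a * `|gsinh (k n) t|) ^+ 2) by rewrite sqrtr_gt0 oneDsqr_gt0.
have [al' [be' [ab H]]] := rotation_norm_attained (a * gsinh (k n) t) r0 (mode_radiusE n t).
exists (fun y => if y then (al', be') else (1, 0)).
  by rewrite /coef_sqr /= ab expr1n expr0n addr0.
rewrite sqr_mode_flow /= H /mode_norm (exprMn _ (expR _)) -(mulrA (expR _ ^+ 2)) /amp [`|a * _|]normrM (gtr0_norm a0).
by rewrite /coef_sqr /= ab expr1n expr0n addr0.
Qed.

(** For n = 0, C and S are hyperbolic of parameter a; once the mean is removed only the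
    antisymmetric part (x - y) / 2 is left, with factor e^(-2at). The weaker factor e^(-at)
    suffices, since it is below every bound used later. *)
Lemma mean_flow_le t v : 0 <= t ->
  ((mode_flow a 0 t v false).1 - ((v false).1 + (v true).1) / 2) ^+ 2 +
  ((mode_flow a 0 t v true).1 - ((v false).1 + (v true).1) / 2) ^+ 2 <=
  expR (- a * t) ^+ 2 * ((v false).1 ^+ 2 + (v true).1 ^+ 2).
Proof.
move=> t0; set x := (v false).1; set y := (v true).1.
have a2 : 0 < a ^+ 2 by rewrite exprn_gt0.
have sa : Num.sqrt (a ^+ 2) = a by rewrite sqrtr_sqr gtr0_norm.
pose E := expR (- a * t); pose F := expR (a * t).
have EF : E * F = 1 by rewrite /E /F -expRD mulNr addNr expR0.
have CE : gcosh (k 0%N) t = (F + E) / 2.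
  by rewrite expr0n subr0 /gcosh a2 sa /E mulNr.
have SE : a * gsinh (k 0%N) t = (F - E) / 2.
  rewrite expr0n subr0 /gsinh a2 sa /E /F mulNr; field; by rewrite gt_eqF.
rewrite /mode_flow /= !mulr0 !mul0r !addr0 -/x -/y -/E CE SE.
have -> : E * ((F + E) / 2 * x + (F - E) / 2 * y) - (x + y) / 2 = (E * F - 1) * (x + y) / 2 + E ^+ 2 * (x - y) / 2 by field.
have -> : E * ((F + E) / 2 * y + (F - E) / 2 * x) - (x + y) / 2 = (E * F - 1) * (x + y) / 2 - E ^+ 2 * (x - y) / 2 by field.
rewrite EF subrr !mul0r add0r sub0r sqrrN.
have E1 : E ^+ 2 <= 1.
  by rewrite exprn_ile1 ?expR_ge0// /E -expR0 ler_expR mulNr oppr_le0 mulr_ge0// ltW.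
have -> : (E ^+ 2 * (x - y) / 2) ^+ 2 + (E ^+ 2 * (x - y) / 2) ^+ 2 = E ^+ 2 * (E ^+ 2 * ((x - y) ^+ 2 / 2)) by field.
rewrite ler_wpM2l ?sqr_ge0//; apply: (@le_trans _ _ ((x - y) ^+ 2 / 2)).
  by rewrite ler_piMl// divr_ge0// sqr_ge0.
rewrite -subr_ge0 (_ : _ - _ = (x + y) ^+ 2 / 2); last by field.
by rewrite divr_ge0// sqr_ge0.
Qed.

End ModeNorm.

Lemma trig_poly_periodic {R : realType} (f : R -> R) : trig_poly f ->
  forall x, f (x + 2 * pi) = f x.
Proof.
elim=> {f} [n|n|f g _ hf _ hg|c f _ hf] x; last 2 first.
- by rewrite hf hg.
- by rewrite hf.
- by have [c s] := @cos_sin_period R n; rewrite mulrDr cosD c s mulr1 mulr0 subr0.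
- by have [c s] := @cos_sin_period R n; rewrite mulrDr sinD c s mulr1 mulr0 addr0.
Qed.

Section SquareBounds.
Context d (T : measurableType d) {R : realType}.
Variables (m : {measure set T -> \bar R}) (S : set T) (V : R).
Hypotheses (mS : measurable S) (V0 : 0 < V) (mSV : m S = V%:E).
Variable f : T -> R.
Hypothesis mf : measurable_fun S f.

Lemma sqr_integrable : (\int[m]_(x in S) ((f x) ^+ 2)%:E < +oo)%E ->
  m.-integrable S (EFin \o (fun x => f x ^+ 2)).
Proof.
move=> f2; apply/integrableP; split; first by apply/measurable_EFinP/measurable_funX.
by under eq_integral do rewrite gee0_abs ?lee_fin ?sqr_ge0//.
Qed.

Lemma integrable_of_sqr : (\int[m]_(x in S) ((f x) ^+ 2)%:E < +oo)%E ->
  m.-integrable S (EFin \o f).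
Proof.
move=> f2; have i1 : m.-integrable S (EFin \o (fun=> 1 : R)).
  by apply: (@finite_bounded_integrable _ _ _ _ _ 1) => //; [rewrite mSV ltry|move=> _; rewrite normr1].
have i2 : m.-integrable S (EFin \o (fun x => 1 + f x ^+ 2)).
  by have := integrableD mS i1 (sqr_integrable f2).
apply: (le_integrable mS _ _ i2); first exact/measurable_EFinP.
move=> x _; rewrite !abse_EFin lee_fin [leRHS]ger0_norm ?addr_ge0 ?sqr_ge0//.
rewrite -[f x ^+ 2]real_normK ?num_real//.
by have := sqr_ge0 (`|f x| - 1); have := normr_ge0 (f x); nra.
Qed.

(** Cauchy-Schwarz against the constant 1, from the integral of (f - J / V)^2 >= 0. If f^2 has
    infinite integral, V > 0 makes the right side infinite. *)
Lemma sqr_Rintegral_le :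
  ((Rintegral m S f ^+ 2)%:E <= V%:E * \int[m]_(x in S) ((f x) ^+ 2)%:E)%E.
Proof.
have [f2|] := ltP (\int[m]_(x in S) ((f x) ^+ 2)%:E)%E +oo%E; last first.
  by rewrite leye_eq => /eqP ->; rewrite gt0_muley ?leey ?lte_fin.
have i1 := integrable_of_sqr f2; have i2 := sqr_integrable f2.
have -> : (\int[m]_(x in S) ((f x) ^+ 2)%:E = (Rintegral m S (fun x => f x ^+ 2))%:E)%E.
  by rewrite /Rintegral fineK//; exact: integrable_fin_num i2.
rewrite -EFinM lee_fin; set J := Rintegral m S f.
have ic : m.-integrable S (EFin \o (fun=> (J / V) ^+ 2)).
  by apply: (@finite_bounded_integrable _ _ _ _ _ ((J / V) ^+ 2)) => //;
    [rewrite mSV ltry|move=> _; rewrite ger0_norm// sqr_ge0].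
have iz : m.-integrable S (EFin \o (fun x => 2 * (J / V) * f x)) by have := integrableZl mS (2 * (J / V)) i1.
have H : Rintegral m S (fun x => 2 * (J / V) * f x - (J / V) ^+ 2) <= Rintegral m S (fun x => f x ^+ 2).
  apply: le_Rintegral => //; first by have := integrableB mS iz ic.
  by move=> x _; have := sqr_ge0 (f x - J / V); rewrite -subr_ge0 [X in 0 <= X -> _](_ : _ = f x ^+ 2 - (2 * (J / V) * f x - (J / V) ^+ 2)) ?subr_ge0//; ring.
move: H; rewrite RintegralB// RintegralZl// Rintegral_cst// mSV /= -/J => H.
have -> : J ^+ 2 = V * (2 * (J / V) * J - (J / V) ^+ 2 * V) by field; rewrite gt_eqF.
by rewrite ler_wpM2l// ltW.
Qed.

End SquareBounds.

Section Expectation.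
Context {R : realType} d (Omega : measurableType d) (P : probability Omega R).
Local Notation leb := (@lebesgue_measure R).
Local Notation I := (`[(0 : R), 2 * pi]%classic : set (measurableTypeR R)).

Lemma measurable_expectation (f : measurableTypeR R * Omega -> R) :
  measurable_fun setT f ->
  measurable_fun setT (fun x : R => Rintegral P setT (fun w => f (x, w))).
Proof.
move=> mf; have mfE : measurable_fun setT (EFin \o f) by exact/measurable_EFinP.
have mp := @measurable_fun_fubini_tonelli_F _ _ _ _ _ P _ (measurable_funepos mfE) (fun x => funepos_ge0 _ x).
have mn := @measurable_fun_fubini_tonelli_F _ _ _ _ _ P _ (measurable_funeneg mfE) (fun x => funeneg_ge0 _ x).
rewrite (_ : (fun _ => _) = fine \o (fun x : measurableTypeR R =>
    fubini_F P ((EFin \o f)^\+)%E x - fubini_F P ((EFin \o f)^\-)%E x)%E).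
  by apply: measurableT_comp; [exact: measurable_realfun.fine_measurable|exact: emeasurable_funB].
apply/funext => x; rewrite /= /Rintegral /fubini_F.
congr fine; rewrite [LHS]integralE.
congr (_ - _)%E; apply: eq_integral => w _.
  by rewrite !funeposE.
by rewrite !funenegE.
Qed.

Lemma measurable_ge0_expectation (f : measurableTypeR R * Omega -> \bar R) :
  measurable_fun setT f -> (forall z, 0 <= f z)%E ->
  measurable_fun setT (fun x : R => \int[P]_w f (x, w))%E.
Proof. by move=> mf f0; exact: measurable_fun_fubini_tonelli_F. Qed.

Lemma ge0_expectation_swap (f : measurableTypeR R * Omega -> \bar R) :
  measurable_fun setT f -> (forall z, 0 <= f z)%E ->
  (\int[leb]_(x in I) \int[P]_w f (x, w) = \int[P]_w \int[leb]_(x in I) f (x, w))%E.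
Proof.
move=> mf f0.
have mI' : measurable (I `*` [set: Omega]) by apply: measurableX => //; exact: mI.
pose g := (f \_ (I `*` [set: Omega]))%E.
have mg : measurable_fun setT g.
  apply: (measurable_restrictT f mI').1.
  exact: measurable_funTS.
have g0 z : (0 <= g z)%E by rewrite /g patchE; case: ifP.
have := @fubini_tonelli _ _ _ _ R leb P g mg g0.
have gE x w : g (x, w) = if x \in I then f (x, w) else 0%E.
  by rewrite /g patchE in_setX in_setT andbT.
move=> H; rewrite integral_mkcond; transitivity (\int[leb]_x \int[P]_w g (x, w))%E.
  apply: eq_integral => x _; rewrite patchE; case: ifPn => xI.
    by apply: eq_integral => w _; rewrite gE xI.
  by under eq_integral do rewrite gE (negbTE xI); rewrite integral0.
rewrite H; apply: eq_integral => w _; rewrite [RHS]integral_mkcond.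
by apply: eq_integral => x _; rewrite gE patchE.
Qed.

End Expectation.

(** * From trigonometric polynomials to all of L^2 *)

Section Contraction.
Context {R : realType} d (Omega : measurableType d).
Variables (Pr : bool -> probability Omega R) (Y : R -> Omega -> bool).
Variable a : R.
Hypothesis a0 : 0 < a.
Hypothesis hY : flip_chain Pr Y a.
Local Notation leb := (@lebesgue_measure R).
Local Notation I := (`[(0 : R), 2 * pi]%classic : set (measurableTypeR R)).
Implicit Types (F D : bool -> R -> R).

Definition expect t F y x : R :=
  Rintegral (Pr y) setT (fun w => F (Y t w) (x + occupation Y t w)).

Definition mean F : R := (period_int (F false) + period_int (F true)) / (4 * pi).

Lemma measurable_path_pair t F : 0 <= t -> (forall b, measurable_fun setT (F b)) ->
  measurable_fun [set: measurableTypeR R * Omega]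
    (fun z : measurableTypeR R * Omega => F (Y t z.2) (z.1 + occupation Y t z.2)).
Proof.
move=> t0 mF; apply: (@measurable_bool_case _ _ R (fun z : measurableTypeR R * Omega => Y t z.2)
  (fun b z => F b (z.1 + occupation Y t z.2))).
  apply: (measurableT_comp (flip_measurable hY t0)); exact: measurable_snd.
move=> b; apply: measurableT_comp; first exact: mF.
apply: measurable_funD; first exact: measurable_fst.
by apply: measurableT_comp; [exact: (measurable_occupation hY)|exact: measurable_snd].
Qed.

Lemma measurable_expect t F y : 0 <= t -> (forall b, measurable_fun setT (F b)) ->
  measurable_fun setT (expect t F y).
Proof.
move=> t0 mF.
exact: (@measurable_expectation _ _ _ (Pr y)
  (fun z : measurableTypeR R * Omega => F (Y t z.2) (z.1 + occupation Y t z.2))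
  (measurable_path_pair t0 mF)).
Qed.

Lemma expect_integrable t F y x K : 0 <= t -> (forall b, measurable_fun setT (F b)) ->
  (forall b x, `|F b x| <= K) ->
  (Pr y).-integrable setT (EFin \o (fun w => F (Y t w) (x + occupation Y t w))).
Proof.
move=> t0 mF FK; apply: (@bounded_integrable _ _ _ _ _ K) => //.
apply: (@measurable_observable R _ _ Y (flip_measurable hY) F mF) => //.
exact: (measurable_occupation hY).
Qed.

Lemma trig_pair_sumE F : (forall y, trig_poly (F y)) ->
  exists N (V : nat -> bool -> R * R), forall y x, F y x = \sum_(n < N.+1) wave n (V n) y x.
Proof.
move=> tF; have [N1 [c1 [_ H1]]] := trig_poly_sumE (tF false).
have [N2 [c2 [_ H2]]] := trig_poly_sumE (tF true).
exists (maxn N1 N2), (fun n y => if y then c2 n else c1 n) => -[] x.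
  by rewrite (H2 (maxn N1 N2).+1)// leqW// leq_maxr.
by rewrite (H1 (maxn N1 N2).+1)// leqW// leq_maxl.
Qed.

Lemma expect_wave_sum t N (V : nat -> bool -> R * R) y x : 0 <= t ->
  expect t (fun y x => \sum_(n < N) wave n (V n) y x) y x =
  \sum_(n < N) wave n (mode_flow a n t (V n)) y x.
Proof.
move=> t0.
have iw n : (Pr y).-integrable setT (EFin \o (fun w => wave n (V n) (Y t w) (x + occupation Y t w))).
  by apply: (@expect_integrable t (wave n (V n)) y x (coef_norm (V n))) => // *; [exact: measurable_wave|exact: wave_bound].
suff [] : (Pr y).-integrable setT (EFin \o (fun w => \sum_(n < N) wave n (V n) (Y t w) (x + occupation Y t w))) /\
   expect t (fun y x => \sum_(n < N) wave n (V n) y x) y x =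
   \sum_(n < N) wave n (mode_flow a n t (V n)) y x by [].
elim: N => [|N [IHi IH]].
  rewrite /expect; under eq_fun do rewrite big_ord0.
  by rewrite big_ord0 Rintegral_cst// mul0r; split => //; exact: integrable0.
have E : (fun w => \sum_(n < N.+1) wave n (V n) (Y t w) (x + occupation Y t w)) =
  fun w => \sum_(n < N) wave n (V n) (Y t w) (x + occupation Y t w) + wave N (V N) (Y t w) (x + occupation Y t w).
  by apply/funext => w; rewrite big_ord_recr.
rewrite /expect E; split; first by have := integrableD measurableT IHi (iw N).
rewrite RintegralD// big_ord_recr; congr (_ + _); first exact: IH.
exact: (wave_expectation a0 hY).
Qed.

Lemma mean_wave_sum N (V : nat -> bool -> R * R) :
  mean (fun y x => \sum_(n < N.+1) wave n (V n) y x) = ((V 0%N false).1 + (V 0%N true).1) / 2.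
Proof.
have H y : period_int (fun x => \sum_(n < N.+1) wave n (V n) y x) = 2 * pi * (V 0%N y).1.
  have := period_int_sumM N.+1 (fun n => V n y) 0 (1, 0).
  rewrite big_ord_recl/= big1 ?addr0; last by [].
  rewrite /harmonic_weight /= mulr1 => <-; congr period_int; apply/funext => x.
  by rewrite {2}/harmonic_term mul0r cos0 sin0 !mulr0 addr0 !mulr1.
rewrite /mean !H; move: (@pi_gt0 R); move: (pi : R) => q q0; field; exact: lt0r_neq0.
Qed.

Variables (t z : R).
Hypotheses (t0 : 0 <= t) (z0 : 0 <= z).
Hypothesis Sz : forall n, (0 < n)%N -> a * `|gsinh (a ^+ 2 - n%:R ^+ 2) t| <= z.

Local Notation K := (expR (- a * t) * amp z).

Lemma mode_norm_le n : (0 < n)%N -> mode_norm a n t <= K.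
Proof. by move=> n0; apply: ler_wpM2l; [exact: expR_ge0|apply: amp_le; [rewrite mulr_ge0// ltW|exact: Sz]]. Qed.

Lemma K_ge : expR (- a * t) <= K.
Proof. by rewrite ler_peMr ?expR_ge0// amp_ge1. Qed.

(** By Parseval the inequality may be checked mode by mode: [mean_flow_le] for n = 0 and
    [mode_flow_norm_le] for the others, both with constants below the common one. *)
Lemma trig_contraction F : (forall y, trig_poly (F y)) ->
  (sqint (fun x => (expect t F false x - mean F)%R) + sqint (fun x => (expect t F true x - mean F)%R)
    <= (K ^+ 2)%:E * (sqint (F false) + sqint (F true)))%E.
Proof.
move=> tF; have [N [V HV]] := trig_pair_sumE tF.
have -> : F = fun y x => \sum_(n < N.+1) wave n (V n) y x.
  by apply/funext => y; apply/funext => x; exact: HV.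
rewrite mean_wave_sum; set m := (_ / 2).
(* The mean is subtracted from mode 0; its sine coefficient is set to 0, as it multiplies the zero
   function. *)
pose W n y := if n == 0%N then ((mode_flow a 0 t (V 0%N) y).1 - m, 0) else mode_flow a n t (V n) y.
have HW y : (fun x => expect t (fun y x => \sum_(n < N.+1) wave n (V n) y x) y x - m) =
    fun x => \sum_(n < N.+1) harmonic_term n (W n y) x.
  apply/funext => x; rewrite expect_wave_sum// !big_ord_recl addrAC; congr (_ + _).
  by rewrite /harmonic_term /wave /W /= mul0r cos0 sin0 !mulr0 !addr0 !mulr1.
rewrite !HW (sqint_harmonic_sum _ (fun n => W n false)) (sqint_harmonic_sum _ (fun n => W n true)).
rewrite (sqint_harmonic_sum _ (fun n => V n false)) (sqint_harmonic_sum _ (fun n => V n true)).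
rewrite -!EFinD -EFinM lee_fin -!big_split/= mulr_sumr; apply: ler_sum => -[[|n] /= nN] _.
  have scale (k c u v x y : R) : 0 <= c -> u ^+ 2 + v ^+ 2 <= k * (x ^+ 2 + y ^+ 2) ->
      c * (u * u) + c * (v * v) <= k * (c * (x * x) + c * (y * y)).
    by move=> c0 H; rewrite -!mulrDr mulrCA -!expr2 ler_wpM2l.
  apply: scale; first by rewrite mulr_ge0// pi_ge0.
  apply: (le_trans (mean_flow_le a0 (V 0%N) t0)).
  apply: ler_wpM2r; first by rewrite addr_ge0// sqr_ge0.
  rewrite ler_sqr ?nnegrE; [exact: K_ge|exact: expR_ge0|].
  by rewrite mulr_ge0 ?expR_ge0 ?ltW ?amp_gt0.
have scale (k c u u' v v' x x' y y' : R) : 0 <= c ->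
    u ^+ 2 + u' ^+ 2 + (v ^+ 2 + v' ^+ 2) <= k * (x ^+ 2 + x' ^+ 2 + (y ^+ 2 + y' ^+ 2)) ->
    c * (u * u + u' * u') + c * (v * v + v' * v') <=
    k * (c * (x * x + x' * x') + c * (y * y + y' * y')).
  by move=> c0 H; rewrite -!mulrDr mulrCA -!expr2 ler_wpM2l.
apply: scale; first exact: pi_ge0.
apply: (le_trans (mode_flow_norm_le a0 n.+1 t (V n.+1))).
apply: ler_wpM2r; first by rewrite !addr_ge0// sqr_ge0.
rewrite ler_sqr ?nnegrE; [exact: mode_norm_le| |].
  by rewrite mulr_ge0 ?expR_ge0 ?ltW ?amp_gt0.
by rewrite mulr_ge0 ?expR_ge0 ?ltW ?amp_gt0.
Qed.

(** The weight 1 + eta on the main term can be brought to 1, which the factor 2 of [sqintD_le] does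
    not allow; the price 1 + 1 / eta falls on the small term. *)
Lemma sqintD_eta (f g : R -> R) (eta : R) : 0 < eta -> measurable_fun setT f -> measurable_fun setT g ->
  (sqint (fun x => f x + g x)%R <= (1 + eta)%:E * sqint f + (1 + eta^-1)%:E * sqint g)%E.
Proof.
move=> e0 mf mg; rewrite /sqint.
have n0 (h : R -> R) x : I x -> (0 <= ((h x) ^+ 2)%:E)%E by rewrite lee_fin sqr_ge0.
have c1 : 0 <= 1 + eta by rewrite addr_ge0// ltW.
have c2 : 0 <= 1 + eta^-1 by rewrite addr_ge0// invr_ge0 ltW.
rewrite -!ge0_integralZl//; try exact: measurable_sqr; try exact: mI; try exact: n0.
rewrite -ge0_integralD//; last 4 first.
- by move=> x _; rewrite -EFinM lee_fin mulr_ge0// sqr_ge0.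
- by apply: measurable_funeM; exact: measurable_sqr.
- by move=> x _; rewrite -EFinM lee_fin mulr_ge0// sqr_ge0.
- by apply: measurable_funeM; exact: measurable_sqr.
apply: ge0_le_integral => //; try exact: mI; try exact: n0.
- by apply: measurable_sqr; exact: measurable_funD.
- by apply: emeasurable_funD; apply: measurable_funeM; exact: measurable_sqr.
move=> x _; rewrite -!EFinM -EFinD lee_fin -subr_ge0.
have -> : (1 + eta) * f x ^+ 2 + (1 + eta^-1) * g x ^+ 2 - (f x + g x) ^+ 2 = (eta * f x - g x) ^+ 2 / eta.
  by field; rewrite gt_eqF.
by rewrite divr_ge0 ?sqr_ge0// ltW.
Qed.

(** The expected square of D at the endpoint of the path. It dominates the squared expectation and,
    unlike the latter, makes sense without integrability. *)
Definition energy D y x : \bar R :=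
  (\int[Pr y]_w ((D (Y t w) (x + occupation Y t w)) ^+ 2)%:E)%E.

Lemma energy_ge0 D y x : (0 <= energy D y x)%E.
Proof. by apply: integral_ge0 => w _; rewrite lee_fin sqr_ge0. Qed.

Lemma measurable_energy_pair D : (forall b, measurable_fun setT (D b)) ->
  measurable_fun [set: measurableTypeR R * Omega]
    (fun z : measurableTypeR R * Omega => ((D (Y t z.2) (z.1 + occupation Y t z.2)) ^+ 2)%:E).
Proof. by move=> mD; apply/measurable_EFinP; apply: measurable_funX; exact: measurable_path_pair. Qed.

Lemma measurable_energy D y : (forall b, measurable_fun setT (D b)) ->
  measurable_fun setT (energy D y).
Proof.
move=> mD; apply: (@measurable_ge0_expectation _ _ _ (Pr y) _ (measurable_energy_pair mD)) => w.
by rewrite lee_fin sqr_ge0.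
Qed.

(** After exchanging the integrals, each path contributes a translate of a single fibre of D,
    bounded by twice its integral over a period, uniformly in the path. *)
Lemma energy_le D y : (forall b, measurable_fun setT (D b)) ->
  (forall b x, D b (x + 2 * pi) = D b x) ->
  (\int[leb]_(x in I) energy D y x <= 2%:E * (sqint (D false) + sqint (D true)))%E.
Proof.
move=> mD pD; set B := (2%:E * _)%E.
have s0 := @sqint_ge0 R.
have B0 : (0 <= B)%E by rewrite mule_ge0// adde_ge0.
rewrite /energy (@ge0_expectation_swap _ _ _ (Pr y) _ (measurable_energy_pair mD))/=; last first.
  by move=> w; rewrite lee_fin sqr_ge0.
apply: (@le_trans _ _ (\int[Pr y]_w B)%E); last first.
  by rewrite integral_cst//= [X in (_ * X)%E]probability_setT mule1.
apply: ge0_le_integral => //.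
- by move=> w _; apply: integral_ge0 => x _; rewrite lee_fin sqr_ge0.
- have mI' : measurable (I `*` [set: Omega]) by apply: measurableX => //; exact: mI.
  pose f := (fun z : measurableTypeR R * Omega => ((D (Y t z.2) (z.1 + occupation Y t z.2)) ^+ 2)%:E).
  have mg : measurable_fun setT (f \_ (I `*` [set: Omega])).
    by apply: (measurable_restrictT f mI').1; apply: measurable_funTS; exact: measurable_energy_pair.
  have := @measurable_fun_fubini_tonelli_G _ _ _ _ _ leb _ mg.
  rewrite (_ : fubini_G _ _ = fun w => \int[leb]_(x in I) f (x, w))%E; last first.
    apply/funext => w; rewrite /fubini_G [RHS]integral_mkcond; apply: eq_integral => x _.
    by rewrite !patchE in_setX in_setT andbT.
  by apply => z'; rewrite patchE; case: ifP => // _; rewrite lee_fin sqr_ge0.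
move=> w _; set b := Y t w.
have := @ge0_integral_shift_le R (fun x => ((D b x) ^+ 2)%:E) (occupation Y t w).
move=> /(_ _ _ _)/le_trans; apply.
- by apply/measurable_EFinP; exact: measurable_funX.
- by move=> x; rewrite lee_fin sqr_ge0.
- by move=> x; rewrite pD.
have -> : (\int[leb]_(x in I) ((D b x) ^+ 2)%:E = sqint (D b))%E by [].
rewrite -mule2n -mule_natl; apply: (@lee_wpmul2l R) => //.
by case: b; [rewrite leeDr|rewrite leeDl].
Qed.

Lemma mean_sqr_le D (e : R) : (forall b, measurable_fun setT (D b)) ->
  (forall b, sqint (D b) <= e%:E)%E -> mean D ^+ 2 <= e / (2 * pi).
Proof.
move=> mD De; have p0 := @two_pi_gt0 R.
have H b : period_int (D b) ^+ 2 <= 2 * pi * e.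
  rewrite -lee_fin; apply: (le_trans (sqr_Rintegral_le mI p0 leb_I (measurable_funTS (mD b)))).
  rewrite (EFinM (2 * pi)).
  apply: (@lee_wpmul2l R); [by rewrite lee_fin ltW|exact: De].
rewrite /mean; have := H true; have := H false.
move: (period_int (D false)) (period_int (D true)) p0 => u v; move: (pi : R) => q q0 Hu Hv.
have q1 : 0 < q by lra.
have -> : e / (2 * q) = 8 * q * e / (4 * q) ^+ 2 by field; exact: lt0r_neq0.
rewrite exprMn exprVn; apply: ler_wpM2r; first by rewrite invr_ge0 sqr_ge0.
by have := sqr_ge0 (u - v); nra.
Qed.

Lemma mean_split F p : (forall b, measurable_fun setT (F b)) -> (forall b, trig_poly (p b)) ->
  (forall b, sqint (fun x => F b x - p b x)%R < +oo)%E ->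
  mean F = mean p + mean (fun b x => F b x - p b x).
Proof.
move=> mF tp fin.
have H b : period_int (F b) = period_int (p b) + period_int (fun x => F b x - p b x).
  rewrite -[RHS]RintegralD; last 3 first.
  - exact: mI.
  - by apply: continuous_integrable; exact: trig_poly_continuous.
  - apply: (integrable_of_sqr mI leb_I _ (fin b)); apply: measurable_funTS.
    by apply: measurable_funB; [exact: mF|exact: trig_poly_measurable].
  by apply: eq_Rintegral => x _; rewrite addrC subrK.
by rewrite /mean !H; ring.
Qed.

(** Pointwise version of the split into polynomial and error, with values in the extended reals so
    that it holds at every x. *)
Lemma expect_defect_le F p eta y x : 0 < eta -> (forall b, measurable_fun setT (F b)) ->
  (forall b, trig_poly (p b)) ->
  (forall b, sqint (fun x => F b x - p b x)%R < +oo)%E ->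
  (((expect t F y x - mean F) ^+ 2)%:E <=
   (1 + eta)%:E * ((expect t p y x - mean p) ^+ 2)%:E +
   (2 * (1 + eta^-1))%:E * (energy (fun b x => F b x - p b x)%R y x
     + ((mean (fun b x => F b x - p b x)%R) ^+ 2)%:E))%E.
Proof.
move=> e0 mF tp fin; pose D b x := F b x - p b x; rewrite -/D.
have mp b : measurable_fun setT (p b) by exact: trig_poly_measurable.
have mD b : measurable_fun setT (D b) by exact: measurable_funB.
have c2 : 0 < 2 * (1 + eta^-1) by rewrite mulr_gt0// addr_gt0// invr_gt0.
(* Where the energy is infinite the right side is infinite. Elsewhere D is integrable along the
   paths, and the expectation splits. *)
have [G|] := ltP (energy D y x) +oo%E; last first.
  rewrite leye_eq => /eqP ->; rewrite addye// gt0_muley ?lte_fin// addey ?leey//.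
have mDw : measurable_fun setT (fun w => D (Y t w) (x + occupation Y t w)).
  apply: (@measurable_observable R _ _ Y (flip_measurable hY) D mD) => //.
  exact: (measurable_occupation hY).
have P1 : Pr y setT = 1%:E by rewrite probability_setT.
have iD := integrable_of_sqr measurableT P1 mDw G.
have ip : (Pr y).-integrable setT (EFin \o (fun w => p (Y t w) (x + occupation Y t w))).
  have [K1 HK1] := trig_poly_bounded (tp true); have [K2 HK2] := trig_poly_bounded (tp false).
  apply: (@expect_integrable t p y x (Num.max K1 K2)) => // -[] x'; rewrite le_max ?HK1 ?HK2 ?orbT//.
have sp : expect t F y x = expect t p y x + expect t D y x.
  rewrite /expect -RintegralD//; apply: eq_Rintegral => w _.
  by rewrite [RHS]addrC subrK.
have s2 : ((expect t D y x ^+ 2)%:E <= energy D y x)%E.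
  by have := sqr_Rintegral_le measurableT ltr01 P1 mDw; rewrite mul1e.
have E0 := energy_ge0 D y x.
have Ef : energy D y x = (fine (energy D y x))%:E by rewrite fineK// ge0_fin_numE.
move: s2; rewrite Ef -!EFinM -!EFinD !lee_fin sp (mean_split mF tp fin) -/D.
move: (fine _) (expect _ _ _ _) (expect _ _ _ _) (mean p) (mean D) => g u v m n vg.
apply: (@le_trans _ _ ((1 + eta) * (u - m) ^+ 2 + 2 * (1 + eta^-1) * (v ^+ 2 + n ^+ 2))); last first.
  by rewrite lerD2l ler_wpM2l ?(ltW c2)// lerD2r.
rewrite -subr_ge0.
have -> : (1 + eta) * (u - m) ^+ 2 + 2 * (1 + eta^-1) * (v ^+ 2 + n ^+ 2) - (u + v - (m + n)) ^+ 2 =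
  (eta * (u - m) - (v - n)) ^+ 2 / eta + (1 + eta^-1) * (v + n) ^+ 2.
  by field; rewrite gt_eqF.
rewrite addr_ge0// ?divr_ge0 ?sqr_ge0 ?(ltW e0)// mulr_ge0 ?sqr_ge0// addr_ge0// invr_ge0 ltW//.
Qed.

(** The constant 10 is 2 (4 + 1): the energy of the error integrates to at most 2 (e + e), and its
    squared mean, over a period of length 2 pi, to at most e. *)
Lemma sqint_expect_le F p eta e y : 0 < eta -> 0 < e -> (forall b, measurable_fun setT (F b)) ->
  (forall b x, F b (x + 2 * pi) = F b x) -> (forall b, trig_poly (p b)) ->
  (forall b, sqint (fun x => F b x - p b x)%R <= e%:E)%E ->
  (sqint (fun x => expect t F y x - mean F)%R <=
   (1 + eta)%:E * sqint (fun x => expect t p y x - mean p)%R + (10 * (1 + eta^-1) * e)%:E)%E.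
Proof.
move=> eta0 e0 mF pF tp De; pose D b x := F b x - p b x.
have mp b : measurable_fun setT (p b) by exact: trig_poly_measurable.
have mD b : measurable_fun setT (D b) by exact: measurable_funB.
have pD b x : D b (x + 2 * pi) = D b x by rewrite /D pF trig_poly_periodic.
have c1 : 0 <= 1 + eta by rewrite addr_ge0// ltW.
have c2 : 0 <= 2 * (1 + eta^-1) by rewrite mulr_ge0// addr_ge0// invr_ge0 ltW.
have fin b : (sqint (fun x => F b x - p b x)%R < +oo)%E by rewrite (le_lt_trans (De b))// ltry.
have H x := expect_defect_le y x eta0 mF tp fin.
have mTF := measurable_expect y t0 mF; have mTp := measurable_expect y t0 mp.
have mG := measurable_energy y mD.
pose G x := (energy D y x + ((mean D) ^+ 2)%:E)%E.
have G0 x : (0 <= G x)%E by rewrite adde_ge0// ?energy_ge0// lee_fin sqr_ge0.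
have mG' : measurable_fun I G by apply/measurable_funTS/emeasurable_funD => //; exact: measurable_cst.
have mS (f : R -> R) c : measurable_fun setT f -> measurable_fun I (fun x => ((f x - c) ^+ 2)%:E).
  by move=> mf; apply: measurable_sqr; apply: measurable_funB => //; exact: measurable_cst.
apply: (@le_trans _ _ (\int[leb]_(x in I) ((1 + eta)%:E * ((expect t p y x - mean p) ^+ 2)%:E + (2 * (1 + eta^-1))%:E * G x))%E).
  apply: ge0_le_integral => //; try exact: mI; try exact: mS.
  - by move=> x _; rewrite lee_fin sqr_ge0.
  - by apply: emeasurable_funD; apply: measurable_funeM => //; exact: mS.
  - by move=> x _; exact: H.
rewrite ge0_integralD//; last 4 first.
- by move=> x _; rewrite -EFinM lee_fin mulr_ge0// sqr_ge0.
- by apply: measurable_funeM; exact: mS.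
- by move=> x _; rewrite mule_ge0.
- exact: measurable_funeM.
rewrite ge0_integralZl//; try exact: mI; try exact: mS; try (by move=> x _; rewrite lee_fin sqr_ge0); try (by rewrite lee_fin).
rewrite ge0_integralZl//.
apply: leeD => //; rewrite /G ge0_integralD//; try (by move=> x _; exact: energy_ge0); try exact: mI; try exact: measurable_funTS; try (by move=> x _; rewrite lee_fin sqr_ge0).
rewrite integral_cst; last exact: mI.
rewrite [X in (_ + _ * X)%E](_ : _ = (2 * pi)%:E)%E; last exact: leb_I.
rewrite -EFinM.
have e1 : (\int[leb]_(x in I) energy D y x <= (4 * e)%:E)%E.
  apply: (le_trans (energy_le y mD pD)).
  rewrite (_ : 4 * e = 2 * (e + e)); last by ring.
  rewrite EFinM; apply: (@lee_wpmul2l R) => //.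
  by rewrite EFinD; apply: leeD; exact: De.
have e2 := mean_sqr_le mD De.
apply: (@le_trans _ _ ((2 * (1 + eta^-1))%:E * ((4 * e)%:E + (e)%:E))%E).
  rewrite lee_wpmul2l// leeD// lee_fin (le_trans (ler_wpM2r (ltW (@two_pi_gt0 R)) e2))//.
  by rewrite divfK// gt_eqF// two_pi_gt0.
by rewrite -EFinD -EFinM lee_fin le_eqVlt; apply/orP; left; apply/eqP; ring.
Qed.

Lemma expect_contraction F : (forall b, measurable_fun setT (F b)) ->
  (forall b x, F b (x + 2 * pi) = F b x) -> (forall b, sqint (F b) < +oo)%E ->
  (sqint (fun x => expect t F false x - mean F)%R + sqint (fun x => expect t F true x - mean F)%R
    <= (K ^+ 2)%:E * (sqint (F false) + sqint (F true)))%E.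
Proof.
move=> mF pF fF; pose S := fine (sqint (F false) + sqint (F true))%E.
have SE : (sqint (F false) + sqint (F true) = S%:E)%E.
  by rewrite fineK// fin_numD !ge0_fin_numE ?fF ?sqint_ge0.
have S0 : 0 <= S by rewrite -lee_fin -SE adde_ge0// sqint_ge0.
have Kn : 0 <= K ^+ 2 by rewrite sqr_ge0.
rewrite SE -EFinM; apply/lee_addgt0Pr => e e0.
(* Bounds the coefficient of eta in the total error when eta <= 1, as the final expansion shows. *)
pose M := 3 * (K ^+ 2 * S) + 4 * K ^+ 2 + 20.
have KS : 0 <= K ^+ 2 * S by rewrite mulr_ge0.
have M0 : 0 < M by rewrite /M; nra.
pose eta := Num.min 1 (e / M).
have eta0 : 0 < eta by rewrite lt_min ltr01 divr_gt0.
have eta1 : eta <= 1 by rewrite ge_min lexx.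
have etaM : eta * M <= e by rewrite -ler_pdivlMr// ge_min lexx orbT.
have c1 : 0 <= 1 + eta by rewrite addr_ge0// ltW.
have c2 : 0 < 1 + eta^-1 by rewrite addr_gt0// invr_gt0.
(* The accuracy of the polynomial is chosen last, so that the penalty 1 + 1 / eta turns it into eta
   exactly. *)
pose eps := eta / (1 + eta^-1).
have eps0 : 0 < eps by rewrite divr_gt0.
have ceps : (1 + eta^-1) * eps = eta by rewrite /eps mulrCA divff ?mulr1// gt_eqF.
have [p Hp] : exists p : bool -> R -> R, forall b,
    trig_poly (p b) /\ (sqint (fun x => F b x - p b x)%R <= eps%:E)%E.
  have [p1 tp1 h1] := (trig_dense (mF true) (fF true)).2 _ eps0.
  have [p2 tp2 h2] := (trig_dense (mF false) (fF false)).2 _ eps0.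
  by exists (fun b => if b then p1 else p2) => -[].
have tp b := (Hp b).1; have De b := (Hp b).2.
have mp b : measurable_fun setT (p b) by exact: trig_poly_measurable.
have mD b : measurable_fun setT (fun x => F b x - p b x) by apply: measurable_funB.
have H y := sqint_expect_le y eta0 eps0 mF pF tp De.
have P b : (sqint (p b) <= (1 + eta)%:E * sqint (F b) + eta%:E)%E.
  rewrite (_ : p b = fun x => F b x + -1 * (F b x - p b x)); last by apply/funext => x; ring.
  have mDN : measurable_fun setT (fun x => -1 * (F b x - p b x)).
    by apply: measurable_funM => //; exact: measurable_cst.
  apply: (le_trans (sqintD_eta eta0 (mF b) mDN)); rewrite leeD2l// sqintZ// sqrrN expr1n mul1e.
  rewrite -[X in (_ <= X%:E)%E]ceps (EFinM (1 + eta^-1)).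
  by apply: (@lee_wpmul2l R); [rewrite lee_fin ltW|exact: De].
have T := trig_contraction tp.
apply: (le_trans (leeD (H false) (H true))).
rewrite addeACA -ge0_muleDr ?sqint_ge0//.
have -> : 10 * (1 + eta^-1) * eps = 10 * eta by rewrite -mulrA ceps.
apply: (@le_trans _ _ ((1 + eta)%:E * ((K ^+ 2)%:E * ((1 + eta)%:E * S%:E + (2 * eta)%:E))
    + (20 * eta)%:E)%E).
  rewrite -EFinD (_ : 10 * eta + 10 * eta = 20 * eta); last by ring.
  rewrite leeD2r//; apply: (@lee_wpmul2l R); first by rewrite lee_fin.
  apply: (le_trans T); apply: (@lee_wpmul2l R); first by rewrite lee_fin.
  apply: (le_trans (leeD (P false) (P true))).
  rewrite addeACA -ge0_muleDr ?sqint_ge0// SE -EFinD (_ : eta + eta = 2 * eta) //; ring.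
rewrite -!EFinM -!EFinD lee_fin.
have -> : (1 + eta) * (K ^+ 2 * ((1 + eta) * S + 2 * eta)) + 20 * eta =
  K ^+ 2 * S + eta * (2 * (K ^+ 2 * S) + eta * (K ^+ 2 * S) + 2 * K ^+ 2 + 2 * eta * K ^+ 2 + 20) by ring.
rewrite lerD2l (le_trans _ etaM)// ler_wpM2l ?(ltW eta0)// /M lerD2r.
by have := ler_wpM2r KS eta1; have := ler_wpM2r Kn eta1; lra.
Qed.

End Contraction.

(** * Norms over the phase space *)

Section PhaseNorm.
Context {R : realType}.
Local Notation leb := (@lebesgue_measure R).
Local Notation I := (`[(0 : R), 2 * pi]%classic : set (measurableTypeR R)).
Implicit Types (f : phase R -> R[i]) (F : phase R -> R).

Definition fiber F : bool -> R -> R := fun b x => F (x, b).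

Definition repart f : phase R -> R := fun z => complex.Re (f z).
Definition impart f : phase R -> R := fun z => complex.Im (f z).

Lemma measurable_fiber F b : measurable_fun setT F -> measurable_fun setT (fiber F b).
Proof. by move=> mF; exact: (@measurable_fun_pair1 _ _ _ (measurableTypeR R) bool R F b mF). Qed.

Lemma measurable_unfiber (F : bool -> R -> R) : (forall b, measurable_fun setT (F b)) ->
  measurable_fun [set: phase R] (fun z : phase R => F z.2 z.1).
Proof.
move=> mF; rewrite (_ : (fun _ => _) = fun z : phase R => if z.2 then F true z.1 else F false z.1).
  have := @measurable_fun_if_pair _ _ (measurableTypeR R) R (F true) (F false) (mF true) (mF false).
  exact.
by apply/funext => -[x []].
Qed.

Lemma mu_ge0_integral (h : phase R -> \bar R) : measurable_fun setT h -> (forall z, 0 <= h z)%E ->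
  (\int[mu]_z h z = ((4 * pi)^-1)%:E *
    (\int[leb]_(x in I) h (x, false) + \int[leb]_(x in I) h (x, true)))%E.
Proof.
move=> mh h0.
have half01 : 0 <= (2^-1 : R) <= 1 by rewrite invr_ge0 ler0n invf_le1// ler1n.
have mb b : measurable_fun setT (fun x : measurableTypeR R => h (x, b)).
  exact: (@measurable_fun_pair1 _ _ _ (measurableTypeR R) bool (\bar R) h b mh).
rewrite /mu (@fubini_tonelli1 _ _ (measurableTypeR R) bool R (uniform_prob two_pi_gt0) (bernoulli_prob 2^-1) h mh h0).
have FE x : fubini_F (bernoulli_prob (2^-1 : R)) h x = ((2^-1)%:E * (h (x, false) + h (x, true)))%E.
  rewrite /fubini_F integral_bernoulli_prob// (_ : unstable.onem _ = 2^-1).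
    by rewrite addeC ge0_muleDr.
  by rewrite /unstable.onem {1}(splitr (1 : R)) div1r addrK.
rewrite (eq_integral _ _ (fun x _ => FE x)) integral_uniform; last 2 first.
- by apply: measurable_funeM; exact: emeasurable_funD.
- by move=> x; rewrite mule_ge0// ?lee_fin ?invr_ge0// adde_ge0.
rewrite ge0_integralZl//; try exact: mI; last 2 first.
- by apply: measurable_funTS; exact: emeasurable_funD.
- by move=> x _; rewrite adde_ge0.
rewrite muleA -EFinM subr0 ge0_integralD//; try exact: mI; try exact: measurable_funTS.
by congr (_%:E * _)%E; move: (@pi_gt0 R); move: (pi : R) => q q0; field; exact: lt0r_neq0.
Qed.

Definition sqnorm f : \bar R :=
  (sqint (fiber (repart f) false) + sqint (fiber (repart f) true) +
   (sqint (fiber (impart f) false) + sqint (fiber (impart f) true)))%E.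

Lemma sqnorm_ge0 f : (0 <= sqnorm f)%E.
Proof. by apply: adde_ge0; apply: adde_ge0; exact: sqint_ge0. Qed.

Lemma L2norm_ge0 f : (0 <= L2norm f)%E.
Proof. exact: Lnorm_ge0. Qed.

Lemma L2norm_sqr f : measurable_fun setT (repart f) -> measurable_fun setT (impart f) ->
  (L2norm f `^ 2 = ((4 * pi)^-1)%:E * sqnorm f)%E.
Proof.
move=> mr mi; rewrite /L2norm powR_Lnorm ?pnatr_eq0//.
pose g (F : phase R -> R) := fun z => ((F z) ^+ 2)%:E.
have g0 F z : (0 <= g F z)%E by rewrite lee_fin sqr_ge0.
have mg F : measurable_fun setT F -> measurable_fun setT (g F).
  by move=> mF; apply/measurable_EFinP; exact: measurable_funX.
transitivity (\int[mu]_z (g (repart f) z + g (impart f) z))%E.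
  apply: eq_integral => z _; rewrite abse_EFin poweR_EFin powR_mulrn// /g -EFinD /repart /impart.
  case: (f z) => u v /=; rewrite real_normK ?num_real// sqr_sqrtr//.
  by rewrite addr_ge0// sqr_ge0.
rewrite ge0_integralD//; try exact: mg.
rewrite !mu_ge0_integral//; try exact: mg.
by rewrite [RHS]ge0_muleDr//; apply: adde_ge0; exact: sqint_ge0.
Qed.

Lemma L2norm_leE f K : measurable_fun setT (repart f) -> measurable_fun setT (impart f) ->
  0 <= K -> (L2norm f <= K%:E)%E = (sqnorm f <= (4 * pi * K ^+ 2)%:E)%E.
Proof.
move=> mr mi K0; have := L2norm_sqr mr mi; have := L2norm_ge0 f; have := sqnorm_ge0 f.
have p0 : 0 < 4 * pi :> R by rewrite mulr_gt0// pi_gt0.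
have i0 : (0 < ((4 * pi)^-1 : R)%:E)%E by rewrite lte_fin invr_gt0.
case: (L2norm f) => [r| |]//; case: (sqnorm f) => [s| |]//.
- rewrite !lee_fin => s0 r0; rewrite poweR_EFin powR_mulrn// -EFinM => -[rs].
  have -> : s = 4 * pi * r ^+ 2 by rewrite rs mulVKf// gt_eqF.
  by rewrite ler_pM2l// ler_sqr.
- by rewrite gt0_muley// => _ _; rewrite poweR_EFin.
- by rewrite poweRyr// -EFinM.
Qed.

Lemma L2norm_eq f K : measurable_fun setT (repart f) -> measurable_fun setT (impart f) ->
  0 <= K -> sqnorm f = (4 * pi * K ^+ 2)%:E -> L2norm f = K%:E.
Proof.
move=> mr mi K0 sK; have := L2norm_sqr mr mi; have := L2norm_ge0 f; rewrite sK -EFinM mulKf; last first.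
  by rewrite gt_eqF// mulr_gt0// pi_gt0.
case: (L2norm f) => [r| |]//; last by rewrite poweRyr.
rewrite lee_fin => r0; rewrite poweR_EFin powR_mulrn// => -[] /eqP; rewrite eqrXn2// => /eqP ->//.
Qed.

Lemma mu_Rintegral F : measurable_fun setT F -> (forall b, sqint (fiber F b) < +oo)%E ->
  Rintegral mu setT F = mean (fiber F).
Proof.
move=> mF fF; have mE : measurable_fun setT (EFin \o F) by exact/measurable_EFinP.
have iF b : leb.-integrable I (EFin \o fiber F b).
  by apply: (integrable_of_sqr mI leb_I _ (fF b)); apply: measurable_funTS; exact: measurable_fiber.
have ip b := integrable_funepos mI (iF b); have inn b := integrable_funeneg mI (iF b).
have fp b := integrable_fin_num mI (ip b); have fn b := integrable_fin_num mI (inn b).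
rewrite /Rintegral integralE !mu_ge0_integral//; try exact: measurable_funepos; try exact: measurable_funeneg.
have Ep b : (\int[leb]_(x in I) ((EFin \o F)^\+ (x, b)) = \int[leb]_(x in I) ((EFin \o fiber F b)^\+ x))%E.
  by apply: eq_integral => x _; rewrite !funeposE.
have En b : (\int[leb]_(x in I) ((EFin \o F)^\- (x, b)) = \int[leb]_(x in I) ((EFin \o fiber F b)^\- x))%E.
  by apply: eq_integral => x _; rewrite !funenegE.
rewrite [X in fine X](_ : _ = ((4 * pi)^-1)%:E *
  (\int[leb]_(x in I) ((EFin \o fiber F false)^\+ x) + \int[leb]_(x in I) ((EFin \o fiber F true)^\+ x)) -
  ((4 * pi)^-1)%:E *
  (\int[leb]_(x in I) ((EFin \o fiber F false)^\- x) + \int[leb]_(x in I) ((EFin \o fiber F true)^\- x)))%E; last first.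
  by rewrite -!Ep -!En.
have pE b : period_int (fiber F b) = fine (\int[leb]_(x in I) ((EFin \o fiber F b)^\+ x))%E
    - fine (\int[leb]_(x in I) ((EFin \o fiber F b)^\- x))%E.
  rewrite /period_int /Rintegral integralE.
  exact: (fineB (fp b) (fn b)).
rewrite -(fineK (fp true)) -(fineK (fp false)) -(fineK (fn true)) -(fineK (fn false)).
rewrite /mean !pE /=.
by rewrite -mulrBr mulrC; congr (_ / _); ring.
Qed.

End PhaseNorm.

Section OperatorNorm.
Context {R : realType} d (Omega : measurableType d).
Variables (Pr : bool -> probability Omega R) (Y : R -> Omega -> bool).
Variable a : R.
Hypothesis a0 : 0 < a.
Hypothesis hY : flip_chain Pr Y a.
Local Notation leb := (@lebesgue_measure R).
Local Notation I := (`[(0 : R), 2 * pi]%classic : set (measurableTypeR R)).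
Implicit Types f : phase R -> R[i].
Variable t : R.
Hypothesis t0 : 0 <= t.

Local Notation N := (opnorm (fun f z => semigroup Pr Y t f z - mu_op f z)).

Lemma sqnorm_lty f : measurable_fun setT (repart f) -> measurable_fun setT (impart f) ->
  (L2norm f < +oo)%E -> (sqnorm f < +oo)%E.
Proof.
move=> mr mi fin.
have := L2norm_ge0 f; move: fin; case E : (L2norm f) => [r| |]// _; rewrite lee_fin => r0.
have : (L2norm f <= r%:E)%E by rewrite E.
by rewrite L2norm_leE// => /le_lt_trans; apply; rewrite ltry.
Qed.

Lemma sqint_fiber_lty f : measurable_fun setT (repart f) -> measurable_fun setT (impart f) ->
  (L2norm f < +oo)%E ->
  (forall b, sqint (fiber (repart f) b) < +oo)%E /\ (forall b, sqint (fiber (impart f) b) < +oo)%E.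
Proof.
move=> mr mi fin; have := sqnorm_lty mr mi fin; rewrite /sqnorm => H.
have s0 := @sqint_ge0 R.
split=> b; apply: (le_lt_trans _ H); case: b.
- by rewrite (le_trans (leeDr _ (s0 _)) (leeDl _ _))// adde_ge0.
- by rewrite (le_trans (leeDl _ (s0 _)) (leeDl _ _))// adde_ge0.
- by rewrite (le_trans (leeDr _ (s0 _)) (leeDr _ _))// adde_ge0.
- by rewrite (le_trans (leeDl _ (s0 _)) (leeDr _ _))// adde_ge0.
Qed.

Lemma centered_parts f : inL2 f -> let g z := semigroup Pr Y t f z - mu_op f z in
  [/\ repart g = fun z => expect Pr Y t (fiber (repart f)) z.2 z.1 - mean (fiber (repart f)),
      impart g = fun z => expect Pr Y t (fiber (impart f)) z.2 z.1 - mean (fiber (impart f)),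
      measurable_fun setT (repart g) & measurable_fun setT (impart g)].
Proof.
move=> [_ mr mi fin] g; have [fr fi] := sqint_fiber_lty mr mi fin.
have rE : repart g = fun z => expect Pr Y t (fiber (repart f)) z.2 z.1 - mean (fiber (repart f)).
  by apply/funext => z; rewrite -mu_Rintegral.
have iE : impart g = fun z => expect Pr Y t (fiber (impart f)) z.2 z.1 - mean (fiber (impart f)).
  by apply/funext => z; rewrite -mu_Rintegral.
have mE (F : bool -> R -> R) c : (forall b, measurable_fun setT (F b)) ->
    measurable_fun setT (fun z : phase R => expect Pr Y t F z.2 z.1 - c).
  move=> mF; apply: (@measurable_unfiber R (fun b x => expect Pr Y t F b x - c)) => b.
  by apply: measurable_funB; [exact: (measurable_expect hY)|exact: measurable_cst].
by split=> //; rewrite ?rE ?iE; apply: mE => b; exact: measurable_fiber.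
Qed.

(** The contraction is applied to real and imaginary parts, whose squared norms add up. *)
Lemma opnorm_le z : 0 <= z ->
  (forall n, (0 < n)%N -> a * `|gsinh (a ^+ 2 - n%:R ^+ 2) t| <= z) ->
  (N <= (expR (- a * t) * amp z)%:E)%E.
Proof.
move=> z0 Sz; apply: ge_ereal_sup => _ [f [fL f1] <-].
have [rE iE mg1 mg2] := centered_parts fL.
have [pf mr mi fin] := fL; have [fr fi] := sqint_fiber_lty mr mi fin.
set K := expR _ * _; have K0 : 0 <= K by rewrite mulr_ge0 ?expR_ge0 ?ltW ?amp_gt0.
rewrite L2norm_leE// /sqnorm rE iE /fiber/=.
have pr b x : fiber (repart f) b (x + 2 * pi) = fiber (repart f) b x by rewrite /fiber /repart pf.
have pi' b x : fiber (impart f) b (x + 2 * pi) = fiber (impart f) b x by rewrite /fiber /impart pf.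
have Hr := expect_contraction a0 hY t0 z0 Sz (fun b => measurable_fiber b mr) pr fr.
have Hi := expect_contraction a0 hY t0 z0 Sz (fun b => measurable_fiber b mi) pi' fi.
apply: (le_trans (leeD Hr Hi)); rewrite -ge0_muleDr; try by apply: adde_ge0; exact: sqint_ge0.
move: f1; rewrite (@L2norm_leE _ f 1)// expr1n mulr1 => f1.
rewrite (mulrC (4 * pi)) (EFinM (K ^+ 2)); apply: (@lee_wpmul2l R) => //.
by rewrite lee_fin sqr_ge0.
Qed.

Lemma sqint_wave n (v : bool -> R * R) y : (0 < n)%N ->
  sqint (wave n v y) = (pi * ((v y).1 ^+ 2 + (v y).2 ^+ 2))%:E.
Proof.
move=> n0; have := sqint_harmonic_sum n.+1 (fun m => if m == n then v y else 0).
rewrite big_ord_recr/= eqxx big1 => [|i _]; last first.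
  rewrite (ltn_eqF (ltn_ord i)) /harmonic_weight /=; case: ifP; rewrite ?mul0r ?mulr0 ?addr0 ?mulr0//.
rewrite add0r /harmonic_weight gtn_eqF// -!expr2 => <-; congr sqint; apply/funext => x.
rewrite big_ord_recr/= eqxx big1 ?add0r// => i _.
by rewrite (ltn_eqF (ltn_ord i)) /harmonic_term /= !mul0r addr0.
Qed.

Lemma wave_periodic n (v : bool -> R * R) y (x : R) : wave n v y (x + 2 * pi) = wave n v y x.
Proof. by have [c s] := @cos_sin_period R n; rewrite /wave mulrDr cosD sinD c s; ring. Qed.

Lemma mean_wave n (v : bool -> R * R) : (0 < n)%N -> mean (wave n v) = 0.
Proof.
move=> n0; have H y : period_int (wave n v y) = 0.
  have := period_int_harmonicM n 0 (v y) (1, 0); rewrite gtn_eqF// => <-.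
  by congr period_int; apply/funext => x; rewrite /harmonic_term/= mul0r cos0 sin0 !mulr1 mulr0 addr0 mulr1.
by rewrite /mean !H addr0 mul0r.
Qed.

(** The test function has the extremal wave of the mode as both real and imaginary part: as
    [coef_sqr v] = 2, its squared norm is 2 pi + 2 pi = 4 pi before normalization, hence 1 after
    it. *)
Lemma le_opnorm n : (0 < n)%N -> ((mode_norm a n t)%:E <= N)%E.
Proof.
move=> n0; have [v v2 vK] := mode_flow_norm_attained a0 n t.
pose w : phase R -> R := fun z => wave n v z.2 z.1.
pose f : phase R -> R[i] := fun z => Complex (w z) (w z).
have mw : measurable_fun setT w by apply: measurable_unfiber => b; exact: measurable_wave.
have sf : sqnorm f = (4 * pi * 1 ^+ 2)%:E.
  rewrite /sqnorm /fiber /repart /impart /= /w /= !sqint_wave// -!EFinD -!mulrDr; congr (_%:E).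
  by move: v2; rewrite /coef_sqr => ->; ring.
have f1 : L2norm f = 1%:E by exact: L2norm_eq.
have fL : inL2 f.
  by split=> // [x y|]; [rewrite /f /w /= wave_periodic|rewrite f1 ltry].
have [rE iE mg1 mg2] := centered_parts fL.
apply: le_ereal_sup_tmp; exists (L2norm (fun z => semigroup Pr Y t f z - mu_op f z)).
  by exists f => //; split=> //; rewrite f1.
rewrite (_ : L2norm _ = (mode_norm a n t)%:E)//.
apply: L2norm_eq => //; first by rewrite mulr_ge0 ?expR_ge0 ?ltW ?amp_gt0.
have eE y : (fun x => expect Pr Y t (fun b x => wave n v b x) y x - mean (fun b x => wave n v b x))
    = wave n (mode_flow a n t v) y.
  by apply/funext => x; rewrite mean_wave// subr0; exact: (wave_expectation a0 hY).
rewrite /sqnorm rE iE /fiber /repart /impart /= /w /= !eE !sqint_wave// -!EFinD -!mulrDr; congr (_%:E).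
by move: vK; rewrite v2 /coef_sqr => ->; ring.
Qed.

End OperatorNorm.

(** * Eigenvalues of the generator *)

Section Eigenfunctions.
Context {R : realType}.
Local Notation leb := (@lebesgue_measure R).
Local Notation I := (`[(0 : R), 2 * pi]%classic : set (measurableTypeR R)).
Implicit Types v w : bool -> R * R.

Definition wave_pair n v w : phase R -> R[i] :=
  fun z => Complex (wave n v z.2 z.1) (wave n w z.2 z.1).

Lemma wave_pair_sqnorm n v w : (0 < n)%N ->
  sqnorm (wave_pair n v w) = (pi * (coef_sqr v + coef_sqr w))%:E.
Proof.
move=> n0; rewrite /sqnorm /fiber /repart /impart /= !sqint_wave// -!EFinD /coef_sqr.
by congr (_%:E); ring.
Qed.

Lemma measurable_wave_pair n v w :
  measurable_fun setT (repart (wave_pair n v w)) /\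
  measurable_fun setT (impart (wave_pair n v w)).
Proof. by split; apply: (@measurable_unfiber R (wave n _)) => b; exact: measurable_wave. Qed.

Lemma wave_pair_inL2 n v w : (0 < n)%N -> inL2 (wave_pair n v w).
Proof.
move=> n0; have [mr mi] := measurable_wave_pair n v w.
split => // [x y|]; first by rewrite /wave_pair /= !wave_periodic.
have s0 : 0 <= (coef_sqr v + coef_sqr w) / 4.
  by rewrite divr_ge0// /coef_sqr !addr_ge0// sqr_ge0.
rewrite (@L2norm_eq _ _ (Num.sqrt ((coef_sqr v + coef_sqr w) / 4)))// ?ltry//.
by rewrite wave_pair_sqnorm// sqr_sqrtr//; congr (_%:E); field.
Qed.

(** Coefficients of the derivative of a wave of frequency 1. *)
Definition rot v : bool -> R * R := fun y => ((v y).2, - (v y).1).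

Lemma is_derive_wave v y (x : R) : is_derive x 1 (wave 1 v y) (wave 1 (rot v) y x).
Proof.
have -> : wave 1 v y = (v y).1 \*: cos + (v y).2 \*: sin.
  by apply/funext => u; rewrite /wave !mul1r.
apply: is_derive_eq; rewrite /wave /rot /= !mul1r.
by rewrite addrC scalerN mulNr.
Qed.

Lemma wave_primitive v y (x : R) : 0 <= x ->
  wave 1 v y x = wave 1 v y 0 + Rintegral leb `[0, x] (wave 1 (rot v) y).
Proof.
rewrite le_eqVlt => /predU1P[<-|x0]; first by rewrite set_itv1 Rintegral_set1 addr0.
have E := Rintegral_derivative x0 (is_derive_wave v y) (@continuous_wave R 1 (rot v) y).
by rewrite [X in _ + X]E addrC subrK.
Qed.

(** The hypotheses say that (p + i q)^2 = a^2 - 1: p + i q is an eigenvalue of the first mode of L_a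
    + a. *)
Lemma explicit_eigenvalue (a p q : R) : 0 < a -> p ^+ 2 - q ^+ 2 = a ^+ 2 - 1 -> p * q = 0 ->
  eigenvalue_perp a (Complex (p - a) q).
Proof.
move=> a0 pq2 pq; have p2 : p ^+ 2 = a ^+ 2 - 1 + q ^+ 2 by rewrite -pq2 subrK.
(* e^{ix} (a, p + i(q - 1)), an eigenvector of [[i, a], [a, -i]] for p + iq *)
pose v y : R * R := if y then (p, 1 - q) else (a, 0).
pose w y : R * R := if y then (q - 1, p) else (0, a).
exists (wave_pair 1 v w); split.
- split; first exact: wave_pair_inL2.
    pose v' y := ((p - a) * (v y).1 - q * (w y).1, (p - a) * (v y).2 - q * (w y).2).
    pose w' y := ((p - a) * (w y).1 + q * (v y).1, (p - a) * (w y).2 + q * (v y).2).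
    rewrite (_ : (fun _ => _) = wave_pair 1 v' w'); first exact: wave_pair_inL2.
    apply/funext => -[x y]; apply/eqP; rewrite eq_complex /= /wave /v' /w' /=.
    by apply/andP; split; apply/eqP; ring.
  exists (wave_pair 1 (rot v) (rot w)); split; first exact: wave_pair_inL2.
    move=> x y /andP[x0 _]; apply/eqP; rewrite eq_complex /=; apply/andP; split; apply/eqP;
      exact: wave_primitive.
  apply: aeW => -[x y]; apply/eqP; rewrite eq_complex /= /wave /rot /v /w !mul1r.
  by case: y => /=; rewrite /sgn ?expr0 ?expr1; apply/andP; split; apply/eqP; ring: p2 pq.
- have [mr mi] := measurable_wave_pair 1 v w.
  have s0 b u : (sqint (wave 1 u b) < +oo)%E by rewrite sqint_wave// ltry.
  apply/eqP; rewrite eq_complex /=; apply/andP; split; apply/eqP.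
    rewrite (_ : (fun _ => _) = repart (wave_pair 1 v w)); last first.
      by apply/funext => z /=; rewrite /repart /=; ring.
    by rewrite mu_Rintegral// => [|b]; [exact: mean_wave|exact: s0].
  rewrite (_ : (fun _ => _) = impart (wave_pair 1 v w)); last first.
    by apply/funext => z /=; rewrite /impart /=; ring.
  by rewrite mu_Rintegral// => [|b]; [exact: mean_wave|exact: s0].
- have [mr mi] := measurable_wave_pair 1 v w => n0.
  have : (L2norm (wave_pair 1 v w) <= 0%:E)%E by rewrite n0.
  rewrite L2norm_leE// wave_pair_sqnorm// expr0n mulr0 lee_fin leNgt => /negP; apply.
  rewrite mulr_gt0 ?pi_gt0// /coef_sqr /v /w /= expr0n !addr0.
  have := sqr_ge0 p; have := sqr_ge0 (1 - q); have := sqr_ge0 (q - 1); have : 0 < a ^+ 2 by rewrite exprn_gt0.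
  by rewrite add0r; lra.
Qed.

End Eigenfunctions.

(** * Fourier coefficients of absolutely continuous functions *)

Section Fourier.
Context {R : realType}.
Local Notation leb := (@lebesgue_measure R).
Local Notation I := (`[(0 : R), 2 * pi]%classic : set (measurableTypeR R)).

Lemma within_integrable (u : R -> R) : {within I, continuous u} -> leb.-integrable I (EFin \o u).
Proof. by move=> cu; apply: continuous_compact_integrable => //; exact: segment_compact. Qed.

Lemma withinZ (c : R) (u : R -> R) : {within I, continuous u} -> {within I, continuous (fun x => c * u x)}.
Proof. by move=> cu x; apply: cvgM; [exact: cvg_cst|exact: cu]. Qed.

Lemma withinD (u v : R -> R) : {within I, continuous u} -> {within I, continuous v} ->
  {within I, continuous (fun x => u x + v x)}.
Proof. by move=> cu cv x; apply: cvgD; [exact: cu|exact: cv]. Qed.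

Lemma withinM (u v : R -> R) : {within I, continuous u} -> continuous v ->
  {within I, continuous (fun x => u x * v x)}.
Proof. by move=> cu cv x; apply: cvgM; [exact: cu|exact: (continuous_subspaceT cv)]. Qed.

Lemma within_period_intD (u v : R -> R) : {within I, continuous u} -> {within I, continuous v} ->
  period_int (fun x => u x + v x) = period_int u + period_int v.
Proof. by move=> cu cv; apply: RintegralD; [exact: mI|exact: within_integrable..]. Qed.

Lemma within_period_intZ (c : R) (u : R -> R) : {within I, continuous u} ->
  period_int (fun x => c * u x) = c * period_int u.
Proof. by move=> cu; apply: RintegralZl; [exact: mI|exact: within_integrable]. Qed.

Lemma period_int_comb (al be ga : R) (u v w phi : R -> R) :
  {within I, continuous u} -> {within I, continuous v} -> {within I, continuous w} -> continuous phi ->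
  period_int (fun x => (al * u x + be * v x + ga * w x) * phi x) =
  al * period_int (fun x => u x * phi x) + be * period_int (fun x => v x * phi x) +
  ga * period_int (fun x => w x * phi x).
Proof.
move=> cu cv cw cp.
have cM (f : R -> R) : {within I, continuous f} -> {within I, continuous (fun x => f x * phi x)} by move=> cf; exact: withinM.
rewrite -(within_period_intZ al (cM _ cu)) -(within_period_intZ be (cM _ cv)) -(within_period_intZ ga (cM _ cw)).
rewrite -(within_period_intD (@withinZ al _ (cM _ cu)) (@withinZ be _ (cM _ cv))).
rewrite -(within_period_intD (withinD (@withinZ al _ (cM _ cu)) (@withinZ be _ (cM _ cv))) (@withinZ ga _ (cM _ cw))).
by congr period_int; apply/funext => x; ring.
Qed.

Lemma primitive_continuous (c : R) (h : R -> R) : leb.-integrable I (EFin \o h) ->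
  {within I, continuous (fun x => c + Rintegral leb `[0, x] h)}.
Proof.
move=> ih x; apply: cvgD; first exact: cvg_cst.
exact: (parameterized_integral_continuous (ltW (@two_pi_gt0 R)) ih).
Qed.

Lemma primitive_by_parts (c : R) (h phi phi' : R -> R) : {within I, continuous h} ->
  (forall x : R, is_derive x 1 phi (phi' x)) -> continuous phi' ->
  let U (x : R) := c + Rintegral leb `[0, x] h in
  period_int (fun x => U x * phi' x) =
  U (2 * pi) * phi (2 * pi) - U 0 * phi 0 - period_int (fun x => h x * phi x).
Proof.
move=> ch dp cp U; have p0 := @two_pi_gt0 R; have ih := within_integrable ch.
have cU : {within I, continuous U} by exact: primitive_continuous.
have [_ U0 U1] := (continuous_within_itvP U p0).1 cU.
have dU x : x \in `]0, (2 * pi)[ -> is_derive x 1 U (h x).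
  move=> x0; have := within_continuous_continuous p0 ch x0; move: (x0); rewrite in_itv/= => /andP[x1 x2] chx.
  have [dF F'] := continuous_FTC1 x2 ih x1 chx.
  have dh : is_derive x 1 (fun x => Rintegral leb `[0, x] h) (h x).
    by apply: DeriveDef; [exact: dF|move: F'; rewrite derive1E].
  have H := @is_deriveD R R R (cst c) _ x 1 0 (h x) (is_derive_cst c x 1) dh.
  by apply: (is_derive_eq H); rewrite add0r.
have cphi : continuous phi by exact: is_derive_continuous dp.
apply: (@Rintegration_by_parts R U phi h phi' 0 (2 * pi) p0 ch).
- by split => // x x0; have [] := dU x x0.
- by move=> x x0; rewrite derive1E; have [_ ->] := dU x x0.
- exact: continuous_subspaceT.
- split; first by move=> x _; have [] := dp x.
    by apply: cvg_at_right_filter; exact: cphi.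
  by apply: cvg_at_left_filter; exact: cphi.
- by move=> x _; rewrite derive1E; have [_ ->] := dp x.
Qed.

Lemma Rintegral_ae_eq (b : R) (f g : R -> R) : measurable_fun setT f -> measurable_fun setT g ->
  b <= 2 * pi -> {ae leb, forall x, I x -> f x = g x} ->
  Rintegral leb `[0, b] f = Rintegral leb `[0, b] g.
Proof.
move=> mf mg b2 fg; congr fine; apply: ae_eq_integral.
- exact: measurable_itv.
- by apply/measurable_EFinP; exact: measurable_funTS.
- by apply/measurable_EFinP; exact: measurable_funTS.
apply: filterS fg => x /= H xb; rewrite H//.
by move: xb; rewrite /= !in_itv/= => /andP[-> xb]; rewrite (le_trans xb).
Qed.

(** The derivative [du] agrees only almost everywhere with the continuous [h]; under the integral it
    may be replaced, after which u is a primitive of a continuous function and integration by parts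
    applies. Periodicity cancels the boundary terms. *)
Lemma fourier_derivative (u du h phi phi' : R -> R) :
  measurable_fun setT du -> measurable_fun setT h ->
  (forall x, 0 <= x <= 2 * pi -> u x = u 0 + Rintegral leb `[0, x] du) ->
  {ae leb, forall x, I x -> du x = h x} -> {within I, continuous h} ->
  u (2 * pi) = u 0 -> phi (2 * pi) = phi 0 ->
  (forall x : R, is_derive x 1 phi (phi' x)) -> continuous phi' ->
  period_int (fun x => u x * phi' x) = - period_int (fun x => h x * phi x).
Proof.
move=> mdu mh ud duh ch u2 p2 dp cp; have p0 := @two_pi_gt0 R.
pose U x := u 0 + Rintegral leb `[0, x] h.
have uU x : 0 <= x <= 2 * pi -> u x = U x.
  by move=> x0; rewrite ud// /U (Rintegral_ae_eq mdu mh _ duh)//; case/andP: x0.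
have := primitive_by_parts (u 0) ch dp cp; rewrite -/U; lazy zeta.
have -> : period_int (fun x => U x * phi' x) = period_int (fun x => u x * phi' x).
  by apply: eq_Rintegral => x /set_mem /=; rewrite in_itv/= => /uU ->.
by rewrite -[U (2 * pi)]uU ?lexx ?ltW// -[U 0]uU ?lexx ?ltW// u2 p2 subrr sub0r.
Qed.

(** Each of the two velocities has positive mass under [mu], so the fibres of a null set are
    null. *)
Lemma ae_fiber (P : phase R -> Prop) b : {ae mu, forall z, P z} ->
  {ae leb, forall x, I x -> P (x, b)}.
Proof.
move=> [N [mN N0 NP]].
have m1 : measurable_fun setT (EFin \o (\1_N : phase R -> R)).
  by apply/measurable_EFinP; exact: measurable_indic.
have g1 z : (0 <= (EFin \o (\1_N : phase R -> R)) z)%E by rewrite lee_fin.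
have p0 : 0 < 4 * pi :> R by rewrite mulr_gt0// pi_gt0.
pose T := [set x : measurableTypeR R | I x /\ N (x, b)].
have mT : measurable T.
  have -> : T = I `&` [set x : measurableTypeR R | N (x, b)] by [].
  apply: measurableI; first exact: mI.
  have := @pair2_measurable _ _ (measurableTypeR R) bool b measurableT _ mN.
  by rewrite setTI.
exists T; split=> //; last first.
  by move=> x /= /not_implyP[Ix nP]; split=> //; exact: NP.
have Tb : leb T = (\int[leb]_(x in I) (\1_N (x, b))%:E)%E.
  have -> : T = [set x : measurableTypeR R | N (x, b)] `&` I by rewrite setIC.
  rewrite -integral_indic//; last first.
    have := @pair2_measurable _ _ (measurableTypeR R) bool b measurableT _ mN.
    by rewrite setTI.
have := mu_ge0_integral m1 g1; rewrite integral_indic// setIT N0.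
move=> /esym/eqP; rewrite mule_eq0 eqe invr_eq0 gt_eqF//= padde_eq0; last 2 first.
- by apply: integral_ge0 => x _; exact: g1.
- by apply: integral_ge0 => x _; exact: g1.
by move=> /andP[/eqP H1 /eqP H2]; rewrite Tb; case: b {T mT Tb}.
Qed.

(** If u is orthogonal to every trigonometric polynomial p, then the squared norm of u - p is that
    of u plus that of p, so it is at least that of u; by density it can be made arbitrarily
    small. *)
Lemma fourier_complete (u : R -> R) : measurable_fun setT u -> {within I, continuous u} ->
  (forall n : nat, period_int (fun x => u x * cos (n%:R * x)) = 0 /\
    period_int (fun x => u x * sin (n%:R * x)) = 0) -> sqint u = 0%E.
Proof.
move=> mu_ cu H.
have Hp p : trig_poly p -> period_int (fun x => u x * p x) = 0.
  elim=> {p} [n|n|f g tf hf tg hg|c f tf hf]; [exact: (H n).1|exact: (H n).2| |].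
    under eq_fun do rewrite mulrDr.
    by rewrite within_period_intD ?hf ?hg ?addr0//; apply: withinM => //; exact: trig_poly_continuous.
  under eq_fun do rewrite mulrCA.
  by rewrite within_period_intZ ?hf ?mulr0//; apply: withinM => //; exact: trig_poly_continuous.
have cuu : {within I, continuous (fun x => u x ^+ 2)}.
  by move=> x; rewrite /=; apply: cvgM; exact: cu.
have sE (f : R -> R) : {within I, continuous (fun x => f x ^+ 2)} -> sqint f = (period_int (fun x => f x ^+ 2))%:E.
  move=> cf; rewrite /sqint /period_int /Rintegral fineK//.
  by apply: integrable_fin_num; [exact: mI|exact: within_integrable].
apply/eqP; rewrite eq_le sqint_ge0 andbT; apply/lee_addgt0Pr => e e0; rewrite add0e.
have uf : (sqint u < +oo)%E by rewrite sE// ltry.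
have [p tp pe] := (trig_dense mu_ uf).2 _ e0.
apply: le_trans pe.
have cp := trig_poly_continuous tp.
have cpp : {within I, continuous (fun x => p x ^+ 2)}.
  by apply: continuous_subspaceT => x; apply: cvgM; exact: cp.
have cup := withinM cu cp.
have E : (fun x => (u x - p x) ^+ 2) = fun x => u x ^+ 2 + (-2 * (u x * p x) + p x ^+ 2).
  by apply/funext => x; ring.
have cr : {within I, continuous (fun x => -2 * (u x * p x) + p x ^+ 2)} by apply: withinD => //; exact: withinZ.
rewrite !sE// ?E; last exact: withinD.
rewrite lee_fin within_period_intD// within_period_intD//; last exact: withinZ.
rewrite within_period_intZ// Hp// mulr0 add0r lerDl.
by apply: Rintegral_ge0 => x _; rewrite sqr_ge0.
Qed.

End Fourier.

(** * Linear relations between the Fourier coefficients of an eigenfunction *)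

Section Eigenvalues.
Context {R : realType}.
Local Notation leb := (@lebesgue_measure R).
Local Notation I := (`[(0 : R), 2 * pi]%classic : set (measurableTypeR R)).
Variables (a p q : R) (f df : phase R -> R[i]).
Hypotheses (fL : inL2 f) (dfL : inL2 df).
Hypothesis ac : forall x y, 0 <= x <= 2 * pi ->
  f (x, y) = f (0, y) + Cintegral lebesgue_measure `[0, x] (fun s => df (s, y)).
Hypothesis ae : {ae mu, forall z, Complex p q * f z = real_complex R (sgn z.2) * df z +
  real_complex R a * (f (z.1, ~~ z.2) - f z)}.

Let u := fiber (repart f).
Let v := fiber (impart f).

Lemma ReD (x y : R[i]) : complex.Re (x + y) = complex.Re x + complex.Re y.
Proof. by case: x; case: y. Qed.

Lemma ImD (x y : R[i]) : complex.Im (x + y) = complex.Im x + complex.Im y.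
Proof. by case: x; case: y. Qed.

(** Real part of the derivative: y f' = (theta + a) f - a f (., -y) is solved for f' using y^2 = 1.
    The imaginary part is [hv]. *)
Let hu b x := sgn b * (p + a) * u b x + - (sgn b * q) * v b x + - (sgn b * a) * u (~~ b) x.
Let hv b x := sgn b * (p + a) * v b x + sgn b * q * u b x + - (sgn b * a) * v (~~ b) x.

Lemma derivative_parts b : {ae leb, forall x, I x ->
  fiber (repart df) b x = hu b x /\ fiber (impart df) b x = hv b x}.
Proof.
apply: filterS (ae_fiber b ae) => x H Ix; have {H} := H Ix.
have ss := @sqr_sgn R b.
rewrite /hu /hv /u /v /fiber /repart /impart /=.
case: (f (x, b)) => u1 v1; case: (f (x, ~~ b)) => u2 v2; case: (df (x, b)) => d1 d2.
rewrite /real_complex_def => -[/= H1 H2]; split.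
  rewrite -[LHS]mul1r -ss.
  have -> : sgn b * sgn b * d1 = sgn b * ((sgn b * d1 - 0 * d2 + (a * (u2 - u1) - 0 * (v2 - v1))) - a * (u2 - u1)) by ring.
  by rewrite -H1; ring.
rewrite -[LHS]mul1r -ss.
have -> : sgn b * sgn b * d2 = sgn b * ((sgn b * d2 + 0 * d1 + (a * (v2 - v1) + 0 * (u2 - u1))) - a * (v2 - v1)) by ring.
by rewrite -H2; ring.
Qed.

Lemma parts_primitive b x : 0 <= x <= 2 * pi ->
  u b x = u b 0 + Rintegral leb `[0, x] (fiber (repart df) b) /\
  v b x = v b 0 + Rintegral leb `[0, x] (fiber (impart df) b).
Proof. by move=> x0; rewrite /u /v /fiber /repart /impart (ac b x0) ReD ImD. Qed.

Lemma parts_continuous b : {within I, continuous (u b)} /\ {within I, continuous (v b)}.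
Proof.
have [_ mr mi fin] := dfL; have [fr fi] := sqint_fiber_lty mr mi fin.
have ir := integrable_of_sqr mI leb_I (measurable_funTS (measurable_fiber b mr)) (fr b).
have ii := integrable_of_sqr mI leb_I (measurable_funTS (measurable_fiber b mi)) (fi b).
have Hu : {in I, (fun x => u b 0 + Rintegral leb `[0, x] (fiber (repart df) b)) =1 u b}.
  by move=> x /set_mem /=; rewrite in_itv/= => x0; rewrite (parts_primitive b x0).1.
have Hv : {in I, (fun x => v b 0 + Rintegral leb `[0, x] (fiber (impart df) b)) =1 v b}.
  by move=> x /set_mem /=; rewrite in_itv/= => x0; rewrite (parts_primitive b x0).2.
split.
  exact: (subspace_eq_continuous Hu (@primitive_continuous R (u b 0) _ ir)).
exact: (subspace_eq_continuous Hv (@primitive_continuous R (v b 0) _ ii)).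
Qed.

Lemma measurable_parts b : measurable_fun setT (u b) /\ measurable_fun setT (v b).
Proof. by have [_ mr mi _] := fL; split; exact: measurable_fiber. Qed.

Lemma parts_by_parts (phi phi' : R -> R) b : phi (2 * pi) = phi 0 ->
  (forall x : R, is_derive x 1 phi (phi' x)) -> continuous phi' ->
  period_int (fun x => u b x * phi' x) = - period_int (fun x => hu b x * phi x) /\
  period_int (fun x => v b x * phi' x) = - period_int (fun x => hv b x * phi x).
Proof.
move=> p2 dp cp; have [pf mr mi fin] := fL; have [_ mdr mdi _] := dfL.
have f2 : f (2 * pi, b) = f (0, b) by have := pf 0 b; rewrite add0r.
have mc (al be ga : R) (w1 w2 w3 : R -> R) : measurable_fun setT w1 -> measurable_fun setT w2 -> measurable_fun setT w3 ->
    measurable_fun setT (fun x => al * w1 x + be * w2 x + ga * w3 x).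
  move=> m1 m2 m3; have mz (c : R) (w : R -> R) : measurable_fun setT w -> measurable_fun setT (fun x => c * w x).
    by move=> mw; apply: measurable_funM => //; exact: measurable_cst.
  by apply: measurable_funD; [apply: measurable_funD; exact: mz|exact: mz].
have cc (al be ga : R) (w1 w2 w3 : R -> R) : {within I, continuous w1} -> {within I, continuous w2} ->
    {within I, continuous w3} -> {within I, continuous (fun x => al * w1 x + be * w2 x + ga * w3 x)}.
  by move=> c1 c2 c3; apply: withinD; [apply: withinD; exact: withinZ|exact: withinZ].
have [mu1 mv1] := measurable_parts b; have [mu2 mv2] := measurable_parts (~~ b).
have [cu1 cv1] := parts_continuous b; have [cu2 cv2] := parts_continuous (~~ b).
split.
  apply: (@fourier_derivative R (u b) (fiber (repart df) b) (hu b)) => //.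
  - exact: measurable_fiber.
  - exact: mc.
  - by move=> x x0; have [] := parts_primitive b x0.
  - by apply: filterS (derivative_parts b) => x H /H[].
  - exact: cc.
  - by rewrite /u /fiber /repart f2.
apply: (@fourier_derivative R (v b) (fiber (impart df) b) (hv b)) => //.
- exact: measurable_fiber.
- exact: mc.
- by move=> x x0; have [] := parts_primitive b x0.
- by apply: filterS (derivative_parts b) => x H /H[].
- exact: cc.
- by rewrite /v /fiber /impart f2.
Qed.

Let coefc n b : R[i] := Complex (period_int (fun x => u b x * cos (n%:R * x))) (period_int (fun x => v b x * cos (n%:R * x))).
Let coefs n b : R[i] := Complex (period_int (fun x => u b x * sin (n%:R * x))) (period_int (fun x => v b x * sin (n%:R * x))).

Lemma coef_relation n b :
  Complex (p + a) q * coefc n b = real_complex R (sgn b * n%:R) * coefs n b + real_complex R a * coefc n (~~ b) /\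
  Complex (p + a) q * coefs n b = - real_complex R (sgn b * n%:R) * coefc n b + real_complex R a * coefs n (~~ b).
Proof.
have [cu1 cv1] := parts_continuous b; have [cu2 cv2] := parts_continuous (~~ b).
have [c2 s2] := @cos_sin_period R n.
have cc : continuous (fun x : R => n%:R * cos (n%:R * x)) by apply: continuousZr; exact: continuous_cosr.
have cs : continuous (fun x : R => - n%:R * sin (n%:R * x)) by apply: continuousZr; exact: continuous_sinr.
have dc (x : R) : is_derive x 1 (fun x => cos (n%:R * x)) (- n%:R * sin (n%:R * x)).
  by apply: (is_derive_eq (is_derive_scale (is_derive_cos (n%:R * x)))); ring.
have ds (x : R) : is_derive x 1 (fun x => sin (n%:R * x)) (n%:R * cos (n%:R * x)).
  by apply: (is_derive_eq (is_derive_scale (is_derive_sin (n%:R * x)))).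
have pc : cos (n%:R * (2 * pi)) = cos (n%:R * 0) :> R by rewrite c2 mulr0 cos0.
have ps : sin (n%:R * (2 * pi)) = sin (n%:R * 0) :> R by rewrite s2 mulr0 sin0.
have [Hc1 Hc2] := parts_by_parts b pc dc cs.
have [Hs1 Hs2] := parts_by_parts b ps ds cc.
have pz (w : R -> R) (k : R) (g : R -> R) : {within I, continuous w} -> continuous g ->
    period_int (fun x => w x * (k * g x)) = k * period_int (fun x => w x * g x).
  by move=> cw cg; under eq_fun do rewrite mulrCA; rewrite within_period_intZ//; exact: withinM.
have ccos := @continuous_cosr R n%:R; have csin := @continuous_sinr R n%:R.
move: Hc1 Hc2 Hs1 Hs2; rewrite !pz// /hu /hv !period_int_comb//.
have ss := @sqr_sgn R b; rewrite !mulNr => /oppr_inj Hc1 /oppr_inj Hc2 Hs1 Hs2.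
by split; apply/eqP; rewrite eq_complex /=; apply/andP; split; apply/eqP;
  rewrite -?(mulrA (sgn b) n%:R) ?mulNr -?(mulrA (sgn b) n%:R) ?Hc1 ?Hc2 ?Hs1 ?Hs2; ring: ss.
Qed.

(** [coef_relation] is applied twice. The mixed terms cancel because the velocity has opposite signs
    on the two fibres, which leaves (theta + a)^2 c = (a^2 - n^2) c. *)
Lemma coef_eigen n b :
  (Complex (p + a) q ^+ 2 - real_complex R (a ^+ 2 - n%:R ^+ 2)) * coefc n b = 0 /\
  (Complex (p + a) q ^+ 2 - real_complex R (a ^+ 2 - n%:R ^+ 2)) * coefs n b = 0.
Proof.
have [H1 H2] := coef_relation n b; have [H3 H4] := coef_relation n (~~ b).
have En : real_complex R (sgn (~~ b) * n%:R) = - real_complex R (sgn b * n%:R).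
  by rewrite sgn_neg mulNr; exact: (rmorphN (real_complex R)).
move: H1 H2 H3 H4; rewrite negbK En opprK.
have ss : real_complex R (sgn b * n%:R) * real_complex R (sgn b * n%:R) = real_complex R (n%:R ^+ 2).
  by rewrite -rmorphM/=; congr (real_complex R _); have ss := @sqr_sgn R b; ring: ss.
rewrite rmorphB/= -ss rmorphXn/=.
move: (Complex _ _) (real_complex R (_ * _)) (real_complex R a) (coefc n b) (coefs n b)
  (coefc n (~~ b)) (coefs n (~~ b)) => k e A c s c' s' H1 H2 H3 H4.
split; apply/eqP.
  have -> : (k ^+ 2 - (A ^+ 2 - e * e)) * c = k * (k * c) - (A ^+ 2 - e * e) * c by ring.
  rewrite H1 mulrDr (mulrCA k e) H2 (mulrCA k A) H3; apply/eqP; ring.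
have -> : (k ^+ 2 - (A ^+ 2 - e * e)) * s = k * (k * s) - (A ^+ 2 - e * e) * s by ring.
rewrite H2 mulrDr mulNr mulrN (mulrCA k e) H1 (mulrCA k A) H4; apply/eqP; ring.
Qed.

(** If theta avoids all the listed values, every Fourier coefficient of f vanishes, so f has norm 0,
    a contradiction. *)
Lemma eigenvalue_disj : L2inner f Defs.one_fun = 0 -> L2norm f <> 0%E ->
  Complex p q = Complex (- 2 * a) 0 \/
  exists2 n, (0 < n)%N & Complex (p + a) q ^+ 2 = real_complex R (a ^+ 2 - n%:R ^+ 2).
Proof.
move=> f1 f0; apply: contrapT => /not_orP[pq0 nn]; apply: f0.
have [pf mr mi fin] := fL; have [fr fi] := sqint_fiber_lty mr mi fin.
have [Lr Li] : mean u = 0 /\ mean v = 0.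
  move: f1; rewrite /L2inner /Cintegral => -[Hr Hi].
  rewrite -(mu_Rintegral mr fr) -(mu_Rintegral mi fi).
  split; [rewrite -[RHS]Hr|rewrite -[RHS]Hi]; congr (Rintegral _ _ _); apply/funext => z;
    by rewrite /repart /impart; case: (f z) => x y /=; ring.
have c0 (w : bool -> R -> R) b : mean w = 0 -> period_int (w (~~ b)) = - period_int (w b).
  have p4 : 4 * pi != 0 :> R by rewrite gt_eqF// mulr_gt0// pi_gt0.
  rewrite /mean => /eqP; rewrite mulf_eq0 invr_eq0 (negbTE p4) orbF => /eqP H.
  by apply/eqP; rewrite -addr_eq0; case: b; rewrite /= 1?addrC ?H// addrC H.
have cz n b : coefc n b = 0 /\ coefs n b = 0.
  have [H1 H2] := coef_eigen n b.
  case: n H1 H2 => [|n] H1 H2; last first.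
    have k0 : Complex (p + a) q ^+ 2 - real_complex R (a ^+ 2 - n.+1%:R ^+ 2) != 0.
      by apply/negP => /eqP/subr0_eq k0; apply: nn; exists n.+1.
    by split; apply/eqP; [move/eqP: H1|move/eqP: H2]; rewrite mulf_eq0 (negbTE k0).
  have s0 (w : R -> R) : period_int (fun x => w x * sin (0%:R * x)) = 0.
    by under eq_fun do rewrite mul0r sin0 mulr0; rewrite period_int_cst mulr0.
  have cc (w : R -> R) : period_int (fun x => w x * cos (0%:R * x)) = period_int w.
    by congr period_int; apply/funext => x; rewrite mul0r cos0 mulr1.
  split; last by rewrite /coefs !s0.
  (* At n = 0, orthogonality to the constants makes the two fibre means opposite, and the relation
     reduces to (theta + 2 a) c = 0. *)
  have [H3 _] := coef_relation 0 b.
  have E : coefc 0 (~~ b) = - coefc 0 b.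
    by apply/eqP; rewrite eq_complex /= !cc !c0// !eqxx.
  have S0 : coefs 0 b = 0 by rewrite /coefs !s0.
  move: H3; rewrite S0 E mulr0 add0r mulrN => /eqP; rewrite -addr_eq0 -mulrDl mulf_eq0 => /orP[|/eqP//].
  rewrite eq_complex /= => /andP[/eqP Hp /eqP Hq]; exfalso; apply: pq0.
  by congr Complex; lra.
have sz b : sqint (u b) = 0%E /\ sqint (v b) = 0%E.
  have [mu1 mv1] := measurable_parts b; have [cu1 cv1] := parts_continuous b.
  split; apply: fourier_complete => // n; have [] := cz n b; rewrite /coefc /coefs => -[Hc1 Hc2] [Hs1 Hs2];
    by split.
apply: L2norm_eq => //; rewrite /sqnorm.
have [-> ->] := sz true; have [-> ->] := sz false.
by rewrite expr0n mulr0 !adde0.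
Qed.

End Eigenvalues.

(** As (theta + a)^2 is real and at most a^2 - 1, either theta + a is imaginary, and -Re theta = a,
    or it is real of modulus at most sqrt (a^2 - 1). One statement covers all a because [Num.sqrt]
    is 0 on negative numbers. *)
Lemma spectral_gap {R : realType} (a : R) (theta : R[i]) : 0 < a -> eigenvalue_perp a theta ->
  a - Num.sqrt (a ^+ 2 - 1) <= - complex.Re theta.
Proof.
move=> a0 [f [[fL _ [df [dfL ac ae]]] f1 f0]]; case: theta ae => p q ae.
have [[-> _]|[n n0]] := eigenvalue_disj fL dfL ac ae f1 f0.
  by have := sqrtr_ge0 (a ^+ 2 - 1); rewrite /=; lra.
move/eqP; rewrite expr2 eq_complex /= => /andP[/eqP Hp /eqP Hq].
have n1 : 1 <= n%:R ^+ 2 :> R by rewrite exprn_ege1// ler1n.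
have : (p + a) * q = 0 by lra.
move/eqP; rewrite mulf_eq0 => /orP[/eqP pa0|/eqP q0].
  by have := sqrtr_ge0 (a ^+ 2 - 1); lra.
have le : (p + a) ^+ 2 <= a ^+ 2 - 1 by rewrite q0 in Hp; rewrite expr2; lra.
have : `|p + a| <= Num.sqrt (a ^+ 2 - 1) by rewrite -sqrtr_sqr ler_wsqrtr.
by move=> /ler_normlP[_]; lra.
Qed.

Lemma spectral_bound {R : realType} (a : R) : 0 < a ->
  let lambda := inf [set - complex.Re theta | theta in [set theta | eigenvalue_perp a theta]] in
  (1 <= a -> lambda = a - Num.sqrt (a ^+ 2 - 1)) /\ (a <= 1 -> lambda = a).
Proof.
move=> a0 lambda.
(* The infimum is attained as soon as one eigenvalue reaches the bound of [spectral_gap]. *)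
have minE m theta : eigenvalue_perp a theta -> - complex.Re theta = m ->
    m = a - Num.sqrt (a ^+ 2 - 1) -> lambda = m.
  move=> et tm mE; apply/eqP; rewrite eq_le; apply/andP; split.
    apply: ge_inf; last by exists theta.
    by exists m => _ [th eth <-]; rewrite mE; exact: spectral_gap.
  apply: lb_le_inf; first by exists m, theta.
  by move=> _ [th eth <-]; rewrite mE; exact: spectral_gap.
split=> a1.
  have s0 : 0 <= a ^+ 2 - 1 by rewrite subr_ge0 exprn_ege1.
  apply: (minE _ (Complex (Num.sqrt (a ^+ 2 - 1) - a) 0)) => //=; last by rewrite opprB.
  by apply: explicit_eigenvalue; rewrite ?mulr0// sqr_sqrtr// expr0n subr0.
have s0 : 0 <= 1 - a ^+ 2 by rewrite subr_ge0 exprn_ile1// ltW.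
apply: (minE _ (Complex (0 - a) (Num.sqrt (1 - a ^+ 2)))) => /=.
- by apply: explicit_eigenvalue; rewrite ?mul0r// sqr_sqrtr// expr0n sub0r opprB.
- by rewrite sub0r opprK.
- by rewrite ler0_sqrtr ?subr0// -opprB oppr_le0.
Qed.

(** * The operator norm as a function of time *)

Section Asymptotics.
Context {R : realType} d (Omega : measurableType d).
Variables (Pr : bool -> probability Omega R) (Y : R -> Omega -> bool).
Variable a : R.
Hypothesis a0 : 0 < a.
Hypothesis hY : flip_chain Pr Y a.
Implicit Types t : R.

Let N t : \bar R := opnorm (fun f z => semigroup Pr Y t f z - mu_op f z).

Lemma opnorm_mode1 t : 0 <= t ->
  (forall n, (0 < n)%N -> `|gsinh (a ^+ 2 - n%:R ^+ 2) t| <= gsinh (a ^+ 2 - 1) t) ->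
  N t = (mode1_norm a t)%:E.
Proof.
move=> t0 H; have k1 : a ^+ 2 - 1%:R ^+ 2 = a ^+ 2 - 1 :> R by rewrite expr1n.
have g0 : 0 <= gsinh (a ^+ 2 - 1) t by rewrite (le_trans _ (H 1%N isT)).
apply/eqP; rewrite eq_le; apply/andP; split.
  apply: (opnorm_le a0 hY t0); first by rewrite mulr_ge0// ltW.
  by move=> n n0; rewrite ler_pM2l// H.
by have := le_opnorm a0 hY t0 (isT : (0 < 1)%N); rewrite /mode_norm k1 ger0_norm.
Qed.

Lemma opnorm_mode1_ge1 t : 1 <= a -> 0 <= t -> N t = (mode1_norm a t)%:E.
Proof.
move=> a1 t0; apply: opnorm_mode1 => // n n0; apply: norm_gsinh_le => //.
  by rewrite subr_ge0 exprn_ege1.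
by rewrite lerD2l lerN2 exprn_ege1// ler1n.
Qed.

Lemma opnorm_mode1_lt1 t : a < 1 -> 0 <= t -> Num.sqrt (1 - a ^+ 2) * t <= pi / 2 ->
  N t = (mode1_norm a t)%:E.
Proof.
move=> a1 t0 st; apply: opnorm_mode1 => // n n0; apply: norm_gsinh_le_oscillating => //.
- by rewrite subr_lt0 exprn_ilt1 ?ltW.
- by rewrite lerD2l lerN2 exprn_ege1// ler1n.
- by rewrite opprB.
Qed.

Lemma opnorm_small_time (delta : R) : 0 < delta ->
  (forall t, 0 <= t <= delta -> N t = (mode1_norm a t)%:E) ->
  (fine (N t) - (1 - a * t ^+ 3 / 6)) / t ^+ 3 @[t --> (0 : R)^'+] --> (0 : R).
Proof.
move=> d0 H; apply: cvg_trans (mode1_norm_small_time a); apply: near_eq_cvg; near=> t.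
rewrite H//=; apply/andP; split; first by rewrite ltW//; near: t; exact: nbhs_right_gt.
by rewrite ltW//; near: t; exact: nbhs_right_lt.
Unshelve. all: by end_near. Qed.

(** Finiteness must be known before [fine] is used, since [fine] sends an infinite value to 0. For
    the upper bound all modes are compared with k = a^2. *)
Lemma opnorm_fin t : 0 <= t -> N t = (fine (N t))%:E /\ expR (- a * t) <= fine (N t).
Proof.
move=> t0; pose S n := a * `|gsinh (a ^+ 2 - n%:R ^+ 2) t|.
have lo : ((expR (- a * t))%:E <= N t)%E.
  apply: le_trans (le_opnorm a0 hY t0 (isT : (0 < 1)%N)).
  by rewrite lee_fin /mode_norm ler_peMr ?expR_ge0// amp_ge1// mulr_ge0// ltW.
have g0 : 0 <= gsinh (a ^+ 2) t.
  by rewrite (le_trans _ (norm_gsinh_le (sqr_ge0 a) (lexx _) t0)).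
have up : (N t <= (expR (- a * t) * amp (a * gsinh (a ^+ 2) t))%:E)%E.
  apply: (opnorm_le a0 hY t0); first by rewrite mulr_ge0// ltW.
  move=> n _; rewrite ler_pM2l//; apply: norm_gsinh_le => //; first exact: sqr_ge0.
  by rewrite lerBlDr lerDl sqr_ge0.
have NE : N t = (fine (N t))%:E.
  rewrite fineK// fin_numElt (lt_le_trans _ lo) ?ltNyr//= (le_lt_trans up)// ltry//.
by split => //; rewrite -lee_fin -NE.
Qed.

Section Oscillating.
Hypothesis a1 : a < 1.
Let s := Num.sqrt (1 - a ^+ 2).

Let s2 : s ^+ 2 = 1 - a ^+ 2.
Proof. by rewrite sqr_sqrtr// subr_ge0 exprn_ile1// ltW. Qed.

Let s0 : 0 < s.
Proof. by rewrite sqrtr_gt0 subr_gt0 exprn_ilt1// ltW. Qed.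

Definition growth_factor t : R := (fine (N t) * expR (a * t)) ^+ 2.

Lemma growth_factorE t z : N t = (expR (- a * t) * amp z)%:E -> growth_factor t = amp z ^+ 2.
Proof.
move=> NE; rewrite /growth_factor NE /= mulrAC -expRD mulNr addNr expR0 mul1r//.
Qed.

Lemma growth_factor_le t z : 0 <= t -> 0 <= z ->
  (forall n, (0 < n)%N -> a * `|gsinh (a ^+ 2 - n%:R ^+ 2) t| <= z) -> growth_factor t <= amp z ^+ 2.
Proof.
move=> t0 z0 H; have [NE lo] := opnorm_fin t0; have := opnorm_le a0 hY t0 z0 H; rewrite -/(N t) NE lee_fin => up.
have n0 : 0 <= fine (N t) by rewrite (le_trans (expR_ge0 _) lo).
rewrite /growth_factor ler_sqr ?nnegrE ?mulr_ge0 ?expR_ge0 ?(ltW (amp_gt0 _))//.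
apply: (le_trans (ler_wpM2r (expR_ge0 (a * t)) up)).
by rewrite mulrAC -expRD mulNr addNr expR0 mul1r.
Qed.

Lemma growth_factor_ge t n : 0 <= t -> (0 < n)%N ->
  amp (a * `|gsinh (a ^+ 2 - n%:R ^+ 2) t|) ^+ 2 <= growth_factor t.
Proof.
move=> t0 n0; have [NE lo] := opnorm_fin t0; have := le_opnorm a0 hY t0 n0; rewrite -/(N t) NE lee_fin => lo'.
have f0 : 0 <= fine (N t) by rewrite (le_trans (expR_ge0 _) lo).
rewrite /growth_factor ler_sqr ?nnegrE ?mulr_ge0 ?expR_ge0 ?(ltW (amp_gt0 _))//.
apply: le_trans (ler_wpM2r (expR_ge0 (a * t)) lo').
by rewrite mulrAC -expRD mulNr addNr expR0 mul1r.
Qed.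

Lemma growth_factor_ge1 t : 0 <= t -> 1 <= growth_factor t.
Proof.
move=> t0; apply: le_trans (growth_factor_ge t0 (isT : (0 < 1)%N)).
by rewrite exprn_ege1// amp_ge1// mulr_ge0// ltW.
Qed.

Lemma opnorm_growth_factor t : 0 <= t -> N t = (expR (- a * t) * Num.sqrt (growth_factor t))%:E.
Proof.
move=> t0; have [NE lo] := opnorm_fin t0.
have f0 : 0 <= fine (N t) by rewrite (le_trans (expR_ge0 _) lo).
rewrite sqrtr_sqr ger0_norm ?mulr_ge0 ?expR_ge0//.
by rewrite mulrCA -expRD mulNr addNr expR0 mulr1.
Qed.

(** s^2 = (1 - a) (1 + a), and 1 + (a / s)^2 = 1 / s^2, so the amplification at a / s is (1 + a) /
    s. *)
Lemma sqr_amp_sup : amp (a / s) ^+ 2 = (1 + a) / (1 - a).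
Proof.
have a10 : 0 < 1 - a by rewrite subr_gt0.
have -> : amp (a / s) = (1 + a) / s.
  have sV : 1 + (a / s) ^+ 2 = s^-1 ^+ 2.
    by rewrite exprMn exprVn s2; field; rewrite gt_eqF// -s2 exprn_gt0.
  by rewrite /amp sV sqrtr_sqr ger0_norm ?invr_ge0 ?ltW// mulrDl mul1r addrC.
rewrite exprMn exprVn s2; field.
by rewrite !gt_eqF// -s2 exprn_gt0.
Qed.

Lemma norm_gsinh_bounded n t : (0 < n)%N -> a * `|gsinh (a ^+ 2 - n%:R ^+ 2) t| <= a / s.
Proof.
move=> n0; rewrite ler_pM2l//; have n1 : 1 <= n%:R ^+ 2 :> R by rewrite exprn_ege1// ler1n.
have a2 : a ^+ 2 < 1 by rewrite exprn_ilt1 ?ltW.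
have k0 : a ^+ 2 - n%:R ^+ 2 < 0 by rewrite subr_lt0 (lt_le_trans a2).
rewrite /gsinh ltNge (ltW k0)/= k0 normrM normfV.
have sn : s <= Num.sqrt (- (a ^+ 2 - n%:R ^+ 2)).
  by rewrite ler_wsqrtr// opprB lerD2r.
have sn0 := lt_le_trans s0 sn.
rewrite (gtr0_norm sn0) ler_pdivrMr// (le_trans (sin_max _))// ler_pdivlMl// mulr1//.
Qed.

Lemma growth_factor_limsup :
  limf_esup (fun t => (growth_factor t)%:E) (pinfty_nbhs R) = ((1 + a) / (1 - a))%:E.
Proof.
have z0 : 0 <= a / s by rewrite divr_ge0 ?ltW.
rewrite limf_esupE -sqr_amp_sup; apply/eqP; rewrite eq_le; apply/andP; split.
  apply: (@le_trans _ _ (ereal_sup [set (growth_factor t)%:E | t in [set t | 0 < t]])).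
    apply: ereal_inf_lbound; exists [set t | 0 < t] => //.
    by exists 0; split; [exact: num_real|].
  apply: ge_ereal_sup => _ [t /= t0 <-]; rewrite lee_fin.
  by apply: growth_factor_le => //; [exact: ltW|move=> n n0; exact: norm_gsinh_bounded].
apply: le_ereal_inf_tmp => _ [V [M [_ MV]] <-].
pose k := (Num.truncn `|M|).+1.
(* A peak of the first mode, where the sine is 1, taken after enough periods to exceed M. *)
pose t := (pi / 2 + k%:R * (2 * pi)) / s.
have s1 : s <= 1 by rewrite -(@sqrtr1 R) ler_wsqrtr// lerBlDr lerDl sqr_ge0.
have Mk : `|M| < k%:R by exact: truncnS_gt.
have p2 : 1 <= 2 * pi :> R by have := pi_ge2 R; lra.
have kt : k%:R <= t.
  rewrite /t ler_pdivlMr// (@le_trans _ _ k%:R)//; first by rewrite ler_piMr.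
  by rewrite ler_wpDl ?divr_ge0 ?pi_ge0// ler_peMr.
have t0 : 0 <= t by rewrite (le_trans _ kt).
apply: ereal_sup_ge; exists (growth_factor t)%:E.
  by exists t => //; apply: MV; rewrite (lt_le_trans _ kt)// (le_lt_trans (ler_norm M)).
rewrite lee_fin; apply: le_trans (growth_factor_ge t0 (isT : (0 < 1)%N)).
have -> : `|gsinh (a ^+ 2 - 1%:R ^+ 2) t| = s^-1.
  have k0 : a ^+ 2 - 1 < 0 by rewrite subr_lt0 exprn_ilt1 ?ltW.
  rewrite expr1n /gsinh ltNge (ltW k0)/= k0 opprB -/s /t mulrCA divff ?gt_eqF// mulr1.
  have [c2 si2] := @cos_sin_period R k.
  by rewrite sinD c2 si2 sin_pihalf !mulr1 mulr0 addr0 div1r ger0_norm// invr_ge0 ltW.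
by [].
Qed.

Lemma growth_factor_liminf :
  limf_einf (fun t => (growth_factor t)%:E) (pinfty_nbhs R) = 1%E.
Proof.
rewrite limf_einfE; apply/eqP; rewrite eq_le; apply/andP; split.
  apply: ge_ereal_sup => _ [V [M [_ MV]] <-]; apply/lee_addgt0Pr => e e0.
  (* For z <= 1, amp z <= 1 + 2 z and (1 + 2 z)^2 <= 1 + 8 z <= 1 + e. *)
  pose z := Num.min 1 (e / 8).
  have z0 : 0 < z by rewrite lt_min ltr01 divr_gt0.
  have z1 : z <= 1 by rewrite ge_min lexx.
  have z8 : z <= e / 8 by rewrite ge_min lexx orbT.
  have M0 : 0 < `|M| + 1 by rewrite ltr_wpDl.
  have [t Mt St] := gsinh_simultaneously_small (introT andP (conj a0 a1)) (divr_gt0 z0 a0) M0.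
  have t0 : 0 <= t by rewrite (le_trans (ltW M0)).
  apply: (@le_trans _ _ (growth_factor t)%:E).
    apply: ereal_inf_lbound; exists t => //; apply: MV.
    by rewrite (lt_le_trans _ Mt)// ltr_pwDr// ler_norm.
  rewrite -EFinD lee_fin; apply: (@le_trans _ _ (amp z ^+ 2)).
    apply: growth_factor_le => //; first exact: ltW.
    by move=> n n0; rewrite mulrC -ler_pdivlMr// St.
  have am : amp z <= 1 + 2 * z.
    rewrite /amp (_ : 1 + 2 * z = z + (1 + z)); last by ring.
    rewrite lerD2l -(@ger0_norm _ (1 + z)) ?addr_ge0 ?(ltW z0)// -sqrtr_sqr ler_wsqrtr//.
    by rewrite sqrrD expr1n -addrA lerD2l lerDr mul1r mulrn_wge0 ?ltW.
  have : amp z ^+ 2 <= (1 + 2 * z) ^+ 2 by rewrite ler_sqr ?nnegrE ?(ltW (amp_gt0 _))// (le_trans (ltW (amp_gt0 z)) am).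
  by move=> /le_trans; apply; nra.
apply: ereal_sup_ge; exists (ereal_inf [set (growth_factor t)%:E | t in [set t | 0 < t]]).
  exists [set t | 0 < t] => //.
  by exists 0; split; [exact: num_real|].
by apply: le_ereal_inf_tmp => _ [t /= t0 <-]; rewrite lee_fin growth_factor_ge1// ltW.
Qed.

(** The interval is the first quarter period of sin (s t), on which the first mode dominates; 1 -
    cos (2 s t) = 2 sin^2 (s t) turns [sqr_ampE] into the stated form. *)
Lemma growth_factor_initial t : 0 <= t <= pi / (2 * s) ->
  growth_factor t = 1 + 2 / (Num.sqrt ((2 * s) ^+ 2 / a ^+ 2
    * (1 / (2 * (1 - cos (2 * s * t)))) + 1) - 1).
Proof.
move=> /andP[t0]; have ss0 : 0 < 2 * s by rewrite mulr_gt0.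
rewrite ler_pdivlMr// => tpi.
have st : s * t <= pi / 2 by lra.
rewrite (growth_factorE (opnorm_mode1_lt1 a1 t0 st)).
have k0 : a ^+ 2 - 1 < 0 by rewrite subr_lt0 exprn_ilt1 ?ltW.
have -> : gsinh (a ^+ 2 - 1) t = sin (s * t) / s by rewrite /gsinh ltNge (ltW k0)/= k0 opprB.
have -> : 1 - cos (2 * s * t) = 2 * sin (s * t) ^+ 2.
  have -> : 2 * s * t = (s * t) *+ 2 by rewrite mulr2n; ring.
  by rewrite cos_mulr2n sin2cos2 mulr2n; ring.
(* At t = 0 the inverse of 0 is 0 twice over: the square root is then 1, the outer quotient 2 / 0 is
   0, and the formula gives 1, the square of [amp 0]. *)
move: t0; rewrite le_eqVlt => /predU1P[<-|t0].
  by rewrite mulr0 sin0 expr0n/= !mulr0 !mul0r mulr0 invr0 !mulr0 add0r sqrtr1 subrr invr0 mulr0 amp0 expr1n addr0.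
have x0 : 0 < sin (s * t).
  by apply: sin_gt0_pi; rewrite mulr_gt0//= (le_lt_trans st)// ltr_pdivrMr// ltr_pMr ?pi_gt0// ltr1n.
rewrite sqr_ampE; last by rewrite mulr_gt0// divr_gt0.
congr (1 + 2 / (Num.sqrt _ - 1)); rewrite addrC; congr (_ + _).
by field; rewrite !gt_eqF.
Qed.

End Oscillating.

End Asymptotics.

(* The remainder terms and the equivalent below are those of the stated closed
   forms: the cubic coefficient is a / 6 (1 / 3 or a / 3 in the source), and the
   constant of the equivalent for 1 < a is a / sqrt (a ^ 2 - 1) (its square in
   the source). *)
Theorem mainTheorem1 (R : realType) (a : R) (ha : 0 < a)
    (d : measure_display) (Omega : measurableType d)
    (Pr : bool -> probability Omega R) (Y : R -> Omega -> bool)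
    (hY : flip_chain Pr Y a) :
  let lambda : R :=
    inf [set - complex.Re theta | theta in [set theta | eigenvalue_perp a theta]] in
  let N (t : R) : \bar R :=
    opnorm (fun f z => semigroup Pr Y t f z - mu_op f z) in
  [/\ (1 <= a -> lambda = a - Num.sqrt (a ^+ 2 - 1)) /\ (a <= 1 -> lambda = a),
      1 < a ->
        let omega := Num.sqrt (a ^+ 2 - 1) in
        [/\ forall t : R, 0 < t ->
              let gamma := expR (- 2 * omega * t) in
              let c := (1 + gamma) / (1 - gamma) in
              N t = (expR ((- a + Num.sqrt (a ^+ 2 - 1)) * t) *
                Num.sqrt (1 + 2 / (omega ^+ 2 * c
                  + a * Num.sqrt (1 + omega ^+ 2 * c ^+ 2) - 1)))%:E,
            (fine (N t) - (1 - a * t ^+ 3 / 6)) / t ^+ 3 @[t --> (0 : R)^'+] --> (0 : R) &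
            fine (N t) / (a / Num.sqrt (a ^+ 2 - 1) * expR (- lambda * t))
              @[t --> +oo%R] --> (1 : R)],
      a = 1 ->
        [/\ forall t : R, 0 < t ->
              N t = (expR (- t) *
                Num.sqrt (1 + 2 / (Num.sqrt (1 + 1 / t ^+ 2) - 1)))%:E,
            (fine (N t) - (1 - t ^+ 3 / 6)) / t ^+ 3 @[t --> (0 : R)^'+] --> (0 : R) &
            fine (N t) / (2 * t * expR (- t)) @[t --> +oo%R] --> (1 : R)] &
      a < 1 ->
        exists g : R -> R,
        [/\ forall t : R, 0 <= t ->
              0 <= g t /\ N t = (expR (- a * t) * Num.sqrt (g t))%:E,
            (fine (N t) - (1 - a * t ^+ 3 / 6)) / t ^+ 3 @[t --> (0 : R)^'+] --> (0 : R),
            limf_esup (fun t : R => (g t)%:E) (pinfty_nbhs R)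
              = ((1 + a) / (1 - a))%:E,
            limf_einf (fun t : R => (g t)%:E) (pinfty_nbhs R) = 1%E &
            let nu := 2 * Num.sqrt (1 - a ^+ 2) in
            forall t : R, 0 <= t <= pi / nu ->
              g t = 1 + 2 / (Num.sqrt (nu ^+ 2 / a ^+ 2
                * (1 / (2 * (1 - cos (nu * t)))) + 1) - 1)]].
Proof.
move=> lambda N; have [lam1 lam2] := spectral_bound ha; split=> //.
- move=> a1 omega; have a1' := ltW a1.
  have NE t : 0 <= t -> N t = (mode1_norm a t)%:E by exact: (opnorm_mode1_ge1 ha hY).
  split.
  + by move=> t t0 gamma c; rewrite NE ?ltW// (amp_coth_form a1 t0).
  (* For a > 1 the first mode dominates at all times, so the cutoff 1 is arbitrary. *)
  + by apply: (opnorm_small_time (Pr := Pr) (Y := Y) ltr01) => t /andP[t0 _]; exact: NE.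
  + have -> : lambda = a - omega by exact: lam1.
    apply: cvg_trans (amp_quotient_form a1); apply: near_eq_cvg.
    by near=> t; rewrite NE//; near: t; exact: nbhs_pinfty_ge.
- move=> a1; have NE t : 0 <= t -> N t = (mode1_norm 1 t)%:E.
    by rewrite -a1; apply: (opnorm_mode1_ge1 ha hY); rewrite a1.
  have gE t : gsinh ((1 : R) ^+ 2 - 1) t = t by rewrite expr1n subrr /gsinh ltxx.
  split.
  + move=> t t0; rewrite NE ?ltW// /mode1_norm gE mul1r mulN1r -sqr_ampE//.
    by rewrite sqrtr_sqr ger0_norm// ltW// amp_gt0.
  + have := opnorm_small_time (a := a) (Pr := Pr) (Y := Y) ltr01.
    rewrite a1; under eq_fun do rewrite mul1r.
    by apply=> t /andP[t0 _]; rewrite -a1 in NE *; exact: NE.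
  + apply: cvg_trans (@mode1_norm_critical_large_time R); apply: near_eq_cvg.
    by near=> t; rewrite NE//; near: t; exact: nbhs_pinfty_ge.
- move=> a1; exists (growth_factor Pr Y a); split.
  + by move=> t t0; split; [exact: sqr_ge0|exact: opnorm_growth_factor].
  + have s0 : 0 < Num.sqrt (1 - a ^+ 2) by rewrite sqrtr_gt0 subr_gt0 exprn_ilt1 ?ltW.
    (* The cutoff is the first quarter period of the first mode, up to which it is known to
       dominate. *)
    have d0 : 0 < pi / 2 / Num.sqrt (1 - a ^+ 2) by rewrite !divr_gt0 ?pi_gt0.
    apply: (opnorm_small_time (Pr := Pr) (Y := Y) d0) => t /andP[t0 td].
    by apply: (opnorm_mode1_lt1 ha hY) => //; rewrite mulrC -ler_pdivlMr.
  + exact: growth_factor_limsup.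
  + exact: growth_factor_liminf.
  + by move=> nu t; exact: growth_factor_initial.
Unshelve. all: by end_near.
Qed.
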